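(* Let $\Gamma$ be a finite abelian group and let $L=\sum_{\gamma\in\Gamma}L_\gamma$ be a $\Gamma$-subgraded Lie algebra of compact operators on a complex Banach space $\mathcal{X}$. If none of the norm closures $\overline{L_\gamma}$ ($\gamma\in\Gamma$) contains a nonzero finite rank operator, then $L$ is an Engel Lie algebra.
   Context: An operator Lie algebra is a linear subspace $L\subseteq\mathcal{B}(\mathcal{X})$ closed under $[a,b]=ab-ba$, normed by the operator norm; $\operatorname{ad}a:x\mapsto[a,x]$ on $L$. $L$ is Engel if $\lim_n\|(\operatorname{ad}a)^n\|^{1/n}=0$ for every $a\in L$. $L$ is $\Gamma$-subgraded if $L=\sum_{\gamma\in\Gamma}L_\gamma$ for subspaces $L_\gamma$ (not necessarily direct) with $[L_\gamma,L_\delta]\subseteq L_{\gamma+\delta}$. *)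

(* Defs.v *)
From Stdlib Require Import Reals List.
From Stdlib Require Import Classical ClassicalEpsilon FunctionalExtensionality.
Open Scope R_scope.
Set Implicit Arguments.

Record C := mkC { Re : R; Im : R }.
Definition C0 : C := mkC 0 0.
Definition C1 : C := mkC 1 0.
Definition Cadd (a b : C) : C := mkC (Re a + Re b) (Im a + Im b).
Definition Cmul (a b : C) : C :=
  mkC (Re a * Re b - Im a * Im b) (Re a * Im b + Im a * Re b).
Definition Cmod (a : C) : R := sqrt (Re a ^ 2 + Im a ^ 2).

Record CBanach := {
  car :> Type;
  vadd : car -> car -> car;
  vzero : car;
  vopp : car -> car;
  vscal : C -> car -> car;
  vnorm : car -> R;
  vadd_assoc : forall x y z, vadd x (vadd y z) = vadd (vadd x y) z;
  vadd_comm : forall x y, vadd x y = vadd y x;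
  vadd_0 : forall x, vadd x vzero = x;
  vadd_opp : forall x, vadd x (vopp x) = vzero;
  vscal_1 : forall x, vscal C1 x = x;
  vscal_assoc : forall a b x, vscal a (vscal b x) = vscal (Cmul a b) x;
  vscal_distr_v : forall a x y, vscal a (vadd x y) = vadd (vscal a x) (vscal a y);
  vscal_distr_c : forall a b x, vscal (Cadd a b) x = vadd (vscal a x) (vscal b x);
  vnorm_eq0 : forall x, vnorm x = 0 -> x = vzero;
  vnorm_scal : forall a x, vnorm (vscal a x) = Cmod a * vnorm x;
  vnorm_triangle : forall x y, vnorm (vadd x y) <= vnorm x + vnorm y;
  vcomplete : forall u : nat -> car,
    (forall eps, 0 < eps -> exists N, forall m n, (N <= m)%nat -> (N <= n)%nat ->
        vnorm (vadd (u m) (vopp (u n))) < eps) ->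
    exists l, forall eps, 0 < eps -> exists N, forall n, (N <= n)%nat ->
        vnorm (vadd (u n) (vopp l)) < eps
}.
Arguments vadd {c} _ _.
Arguments vzero {c}.
Arguments vopp {c} _.
Arguments vscal {c} _ _.
Arguments vnorm {c} _.

Record FinAbGroup := {
  gcar :> Type;
  gadd : gcar -> gcar -> gcar;
  g0 : gcar;
  gopp : gcar -> gcar;
  gadd_assoc : forall x y z, gadd x (gadd y z) = gadd (gadd x y) z;
  gadd_comm : forall x y, gadd x y = gadd y x;
  gadd_0 : forall x, gadd x g0 = x;
  gadd_opp : forall x, gadd x (gopp x) = g0;
  genum : list gcar;
  genum_nodup : NoDup genum;
  genum_full : forall g, In g genum
}.
Arguments gadd {f} _ _.
Arguments genum {f}.

(* ---------- Supremum (0 for empty or unbounded sets) ---------- *)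
Definition Rsup (E : R -> Prop) : R :=
  match excluded_middle_informative (bound E /\ exists x, E x) with
  | left H => proj1_sig (completeness E (proj1 H) (proj2 H))
  | right _ => 0
  end.

Definition Op (X : CBanach) := X -> X.
Definition opzero {X : CBanach} : Op X := fun _ => vzero.
Definition opadd {X : CBanach} (S T : Op X) : Op X := fun x => vadd (S x) (T x).
Definition opsub {X : CBanach} (S T : Op X) : Op X := fun x => vadd (S x) (vopp (T x)).
Definition opscal {X : CBanach} (c : C) (T : Op X) : Op X := fun x => vscal c (T x).
Definition comm {X : CBanach} (S T : Op X) : Op X :=
  fun x => vadd (S (T x)) (vopp (T (S x))).
Definition opsum {X : CBanach} (l : list (Op X)) : Op X := fold_right opadd opzero l.

Definition is_linear {X : CBanach} (T : Op X) : Prop :=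
  (forall x y, T (vadd x y) = vadd (T x) (T y)) /\
  (forall c x, T (vscal c x) = vscal c (T x)).
Definition is_bounded {X : CBanach} (T : Op X) : Prop :=
  exists M, forall x, vnorm (T x) <= M * vnorm x.
Definition is_bop {X : CBanach} (T : Op X) : Prop := is_linear T /\ is_bounded T.

Definition opnorm {X : CBanach} (T : Op X) : R :=
  Rsup (fun r => exists x, vnorm x <= 1 /\ r = vnorm (T x)).

Definition is_compact {X : CBanach} (T : Op X) : Prop :=
  is_bop T /\
  forall u : nat -> X, (exists M, forall n, vnorm (u n) <= M) ->
    exists phi : nat -> nat, (forall n, (phi n < phi (S n))%nat) /\
      exists l : X, forall eps, 0 < eps -> exists N, forall n, (N <= n)%nat ->
        vnorm (vadd (T (u (phi n))) (vopp l)) < eps.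

Fixpoint lincomb {X : CBanach} (cs : list C) (vs : list X) : X :=
  match cs, vs with
  | c :: cs', v :: vs' => vadd (vscal c v) (lincomb cs' vs')
  | _, _ => vzero
  end.

Definition is_finite_rank {X : CBanach} (T : Op X) : Prop :=
  exists vs : list X, forall x, exists cs : list C,
    length cs = length vs /\ T x = lincomb cs vs.

Definition in_closure {X : CBanach} (S : Op X -> Prop) (T : Op X) : Prop :=
  is_bop T /\ forall eps, 0 < eps -> exists U, S U /\ opnorm (opsub T U) < eps.

Definition is_subspace {X : CBanach} (S : Op X -> Prop) : Prop :=
  S opzero /\ (forall U V, S U -> S V -> S (opadd U V)) /\
  (forall c U, S U -> S (opscal c U)).

Definition is_op_Lie_algebra {X : CBanach} (L : Op X -> Prop) : Prop :=
  (forall T, L T -> is_bop T) /\ is_subspace L /\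
  (forall S T, L S -> L T -> L (comm S T)).

Definition is_subgraded {X : CBanach} (G : FinAbGroup) (L : Op X -> Prop)
  (Lg : G -> Op X -> Prop) : Prop :=
  (forall g, is_subspace (Lg g)) /\
  (forall T, L T <-> exists f : G -> Op X,
      (forall g, Lg g (f g)) /\ T = opsum (map f genum)) /\
  (forall g h S T, Lg g S -> Lg h T -> Lg (gadd g h) (comm S T)).

Definition ad_pow_norm {X : CBanach} (L : Op X -> Prop) (a : Op X) (n : nat) : R :=
  Rsup (fun r => exists x, L x /\ opnorm x <= 1 /\
                           r = opnorm (Nat.iter n (comm a) x)).

(* n-th root of a nonnegative real (0 for r <= 0) *)
Definition nroot (n : nat) (r : R) : R :=
  match Rle_dec r 0 with
  | left _ => 0
  | right _ => Rpower r (/ INR n)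
  end.

Definition is_Engel {X : CBanach} (L : Op X -> Prop) : Prop :=
  forall a, L a -> Un_cv (fun n => nroot n (ad_pow_norm L a n)) 0.

(* Main.v *)
From Stdlib Require Import Reals List Lia Lra Permutation.
From Stdlib Require Import Classical ClassicalEpsilon FunctionalExtensionality ProofIrrelevance.
Require Import Defs.

(**
Replace X by X^G and the family (L_g) by the convolution operators with symbol (y_g), y_g in the norm
closure of L_g. This is a closed space of operators on X^G, it contains a convolution operator a^ attached to
any a = sum_g f_g of L, it is invariant under ad a^, and since the matrix entries of its elements lie in the
closures of the L_g it contains no nonzero finite rank operator.

Let c be a compact operator. By Riesz theory its spectrum outside a small disc is carried by finitely many
finite rank projections P_i; so, up to a block on which ad c has small spectral radius, every block P_i Y P_j
of an operator Y is of finite rank. Hence a spectral projection of ad c onto a half-plane away from 0 takes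
finite rank values. It is a limit of rational functions of ad c with poles on the boundary line, and these
preserve every closed subspace invariant under ad c as soon as the line avoids the spectrum; such lines exist
because sigma(c) - sigma(c) accumulates only at points of +-sigma(c). Applied to c = a^, the half-plane
projections vanish on the graded space, so they vanish on the operators induced by elements of L, which
therefore lie in a spectral subspace of ad a^ contained in an arbitrarily small disc.

X^G retracts onto X (constant functions and averaging); because the retraction intertwines ad a^ and ad a, the
estimate obtained in X^G is uniform on the unit ball of L, although L need not be complete and the sum of
the L_g need not be direct.
*)

Open Scope R_scope.
Set Implicit Arguments.
Unset Strict Implicit.

(** * Complex scalars and linear combinations *)

(** A line, rather than a circle around 0, bounds the spectral sets for a reason: a resolvent at a
    point enclosed by the spectrum need not preserve a closed invariant subspace, whereas a line
    runs to infinity, where resolvents are Neumann series, and a uniform lower bound for lam - T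
    carries the invariance along it. The rational functions are B^m (A^m + B^m)^(-1) with A = y0 +
    k0 - T and B = y0 - k0 - T; they tend to 1 where B dominates A and to 0 where A dominates B. No
    contour integral or Liouville argument occurs: spectral radii enter through power bounds, and
    partial fractions over 2^k-th roots replace analyticity. X^G is forced by the hypothesis, which
    concerns the closure of each L_g separately: a finite rank limit of elements of L gives no
    access to components, while the entries of a finite rank matrix over G are themselves of finite
    rank. Vanishing of the half-plane projections is only qualitative; seminorms adapted to pairs of
    pieces of the spectrum turn it into a bound on the powers of ad. *)

Lemma lt_div_cancel x e k : 0 < k -> x < e / k -> k * x < e.
Proof.
  intros Hk H. apply (Rmult_lt_compat_l k) in H; [|exact Hk].
  replace (k * (e / k)) with e in H by (field; lra). exact H.
Qed.

Lemma inv_mul_le k x y : 0 < k -> k * x <= y -> x <= / k * y.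
Proof.
  intros Hk H. apply Rmult_le_reg_l with k; [exact Hk|]. rewrite <- Rmult_assoc, Rinv_r; lra.
Qed.

Lemma ratio_lt_1 t l : 0 <= t < l -> 0 <= t / l < 1.
Proof.
  intros H. split; [apply Rmult_le_pos; [lra|left; apply Rinv_0_lt_compat; lra]|].
  apply Rmult_lt_reg_r with l; [lra|]. unfold Rdiv. rewrite Rmult_assoc, Rinv_l; lra.
Qed.

Lemma pow_small q B eps : 0 <= q < 1 -> 0 < eps -> exists N, forall n, (N <= n)%nat -> B * q ^ n < eps.
Proof.
  intros Hq He. pose proof (Rabs_pos B). destruct (pow_lt_1_zero q) with (y := eps / (Rabs B + 1)) as [N HN].
  - rewrite Rabs_pos_eq; lra.
  - apply Rdiv_lt_0_compat; lra.
  - exists N. intros n Hn. specialize (HN n Hn).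
    assert (0 <= q ^ n) by (apply pow_le; lra).
    rewrite Rabs_pos_eq in HN by lra. apply lt_div_cancel in HN; [|lra].
    pose proof (Rle_abs B). nra.
Qed.

Lemma C_eq (a b : C) : Re a = Re b -> Im a = Im b -> a = b.
Proof. destruct a, b; simpl; intros; subst; reflexivity. Qed.

Definition Copp (a : C) : C := mkC (- Re a) (- Im a).
Definition Csub (a b : C) : C := Cadd a (Copp b).
Definition Cinv (a : C) : C :=
  mkC (Re a / (Re a ^ 2 + Im a ^ 2)) (- Im a / (Re a ^ 2 + Im a ^ 2)).
Definition Cdiv (a b : C) : C := Cmul a (Cinv b).
Definition RtoC (r : R) : C := mkC r 0.

Lemma C_neq0_norm2 (a : C) : a <> C0 -> Re a ^ 2 + Im a ^ 2 <> 0.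
Proof.
  intros H E. apply H. apply C_eq; simpl; nra.
Qed.

Lemma C_ring_theory : ring_theory C0 C1 Cadd Cmul Csub Copp (@eq C).
Proof.
  constructor; intros; apply C_eq; simpl; ring.
Qed.

Lemma C1_neq_C0 : C1 <> C0.
Proof. intro H; apply (f_equal Re) in H; simpl in H; lra. Qed.

Lemma C_field_theory : field_theory C0 C1 Cadd Cmul Csub Copp Cdiv Cinv (@eq C).
Proof.
  constructor.
  - exact C_ring_theory.
  - exact C1_neq_C0.
  - reflexivity.
  - intros p Hp. apply C_neq0_norm2 in Hp.
    apply C_eq; simpl; field; simpl in Hp; intro E; apply Hp; rewrite <- E; ring.
Qed.
Add Field C_field : C_field_theory.

Declare Scope C_scope.
Delimit Scope C_scope with C.
Bind Scope C_scope with C.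
Infix "+" := Cadd : C_scope.
Infix "*" := Cmul : C_scope.
Infix "-" := Csub : C_scope.
Infix "/" := Cdiv : C_scope.
Notation "- x" := (Copp x) : C_scope.

Lemma Cmod_ge0 a : 0 <= Cmod a.
Proof. apply sqrt_pos. Qed.

Lemma Cmod_sqr a : Cmod a ^ 2 = Re a ^ 2 + Im a ^ 2.
Proof. unfold Cmod. rewrite pow2_sqrt; nra. Qed.

Lemma Cmod_mul a b : Cmod (a * b)%C = Cmod a * Cmod b.
Proof.
  unfold Cmod. rewrite <- sqrt_mult by nra. f_equal. simpl. ring.
Qed.

Lemma Cmod_le_of_sqr a r : 0 <= r -> Re a ^ 2 + Im a ^ 2 <= r ^ 2 -> Cmod a <= r.
Proof.
  intros Hr H. rewrite <- (sqrt_pow2 r Hr). apply sqrt_le_1_alt. exact H.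
Qed.

Lemma Cmod_RtoC r : Cmod (RtoC r) = Rabs r.
Proof.
  unfold Cmod; simpl. replace (r * (r * 1) + 0 * (0 * 1)) with (Rsqr r) by (unfold Rsqr; ring).
  apply sqrt_Rsqr_abs.
Qed.

Lemma Cmod_0 : Cmod C0 = 0.
Proof. change C0 with (RtoC 0). rewrite Cmod_RtoC. apply Rabs_R0. Qed.
Lemma Cmod_1 : Cmod C1 = 1.
Proof. change C1 with (RtoC 1). rewrite Cmod_RtoC. apply Rabs_R1. Qed.

Lemma Cmod_eq0 a : Cmod a = 0 -> a = C0.
Proof.
  intro H. pose proof (Cmod_sqr a) as E. rewrite H in E. apply C_eq; simpl; nra.
Qed.

Lemma Cmod_gt0 a : a <> C0 -> 0 < Cmod a.
Proof.
  intro H. destruct (Cmod_ge0 a) as [G|G]; [exact G|]. symmetry in G. apply Cmod_eq0 in G. contradiction.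
Qed.

Lemma Cmod_pos_neq a : 0 < Cmod a -> a <> C0.
Proof. intros H E. subst. rewrite Cmod_0 in H. lra. Qed.

Lemma Cmod_opp a : Cmod (- a)%C = Cmod a.
Proof. unfold Cmod; simpl. f_equal. ring. Qed.

Lemma Cmod_sub_sym a b : Cmod (a - b)%C = Cmod (b - a)%C.
Proof. rewrite <- Cmod_opp. f_equal. ring. Qed.

Lemma Cmod_inv a : a <> C0 -> Cmod (Cinv a) = / Cmod a.
Proof.
  intro H. pose proof (Cmod_gt0 H).
  apply Rmult_eq_reg_l with (Cmod a); [|lra].
  rewrite <- Cmod_mul. replace (a * Cinv a)%C with C1 by (field; exact H).
  rewrite Cmod_1. field. lra.
Qed.

Lemma Cmod_div a b : b <> C0 -> Cmod (a / b)%C = Cmod a / Cmod b.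
Proof. intro H. unfold Cdiv. rewrite Cmod_mul, Cmod_inv by exact H. reflexivity. Qed.

Lemma Re_le_Cmod a : Rabs (Re a) <= Cmod a.
Proof.
  rewrite <- sqrt_Rsqr_abs. unfold Cmod. apply sqrt_le_1_alt. unfold Rsqr. nra.
Qed.
Lemma Im_le_Cmod a : Rabs (Im a) <= Cmod a.
Proof.
  rewrite <- sqrt_Rsqr_abs. unfold Cmod. apply sqrt_le_1_alt. unfold Rsqr. nra.
Qed.

Lemma Cmod_le_Re_Im a : Cmod a <= Rabs (Re a) + Rabs (Im a).
Proof.
  pose proof (Rabs_pos (Re a)); pose proof (Rabs_pos (Im a)).
  apply Cmod_le_of_sqr; [lra|]. rewrite <- (pow2_abs (Re a)), <- (pow2_abs (Im a)). nra.
Qed.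

(** Half-angle formulas give the moduli p and q of the two coordinates, and the sign of Im u decides
    their relative sign. Square roots on the unit circle let the factorization b^2 - w^2 = (b - w)(b
    + w) be iterated over dyadic powers. *)
Lemma unit_sqrt (u : C) : Cmod u = 1 -> exists v, Cmod v = 1 /\ (v * v)%C = u.
Proof.
  intro Hu. pose proof (Cmod_sqr u) as E. rewrite Hu in E.
  assert (Hre : -1 <= Re u <= 1) by (split; nra).
  set (p := sqrt ((1 + Re u) / 2)). set (q := sqrt ((1 - Re u) / 2)).
  assert (Hp : p * p = (1 + Re u) / 2) by (apply sqrt_sqrt; lra).
  assert (Hq : q * q = (1 - Re u) / 2) by (apply sqrt_sqrt; lra).
  assert (Hpq : (p * q) * (p * q) = (Im u / 2) * (Im u / 2)).
  { replace ((p * q) * (p * q)) with ((p * p) * (q * q)) by ring. rewrite Hp, Hq. nra. }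
  assert (0 <= p) by apply sqrt_pos. assert (0 <= q) by apply sqrt_pos.
  assert (Key : forall v, (v * v)%C = u -> Cmod v = 1).
  { intros v Hv. pose proof (Cmod_mul v v) as H1. rewrite Hv, Hu in H1.
    pose proof (Cmod_ge0 v). nra. }
  destruct (Rle_lt_dec 0 (Im u)) as [Hi|Hi].
  - assert (p * q = Im u / 2).
    { apply Rsqr_inj; unfold Rsqr; [nra|lra|exact Hpq]. }
    assert (Hv : (mkC p q * mkC p q)%C = u) by (apply C_eq; simpl; lra).
    exists (mkC p q). auto.
  - assert (p * q = - (Im u / 2)).
    { apply Rsqr_inj; unfold Rsqr; [nra|lra|]. rewrite Hpq. ring. }
    assert (Hv : (mkC p (-q) * mkC p (-q))%C = u) by (apply C_eq; simpl; lra).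
    exists (mkC p (-q)). auto.
Qed.

Declare Scope V_scope.
Delimit Scope V_scope with V.
Infix "+" := vadd : V_scope.
Notation "- x" := (vopp x) : V_scope.
Notation "x - y" := (vadd x (vopp y)) : V_scope.
Infix "*" := vscal : V_scope.
Open Scope V_scope.
Open Scope R_scope.

Arguments vadd_assoc {c} x y z.
Arguments vadd_comm {c} x y.
Arguments vadd_0 {c} x.
Arguments vadd_opp {c} x.
Arguments vscal_1 {c} x.
Arguments vscal_assoc {c} a b x.
Arguments vscal_distr_v {c} a x y.
Arguments vscal_distr_c {c} a b x.
Arguments vnorm_eq0 {c} x _.
Arguments vnorm_scal {c} a x.
Arguments vnorm_triangle {c} x y.
Arguments vcomplete {c} u _.

Section VectorBasics.
Variable X : CBanach.
Implicit Types (x y z : X) (a b c : C).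

Lemma vadd_cancel x y z : (x + y)%V = (x + z)%V -> y = z.
Proof.
  intro H. apply (f_equal (fun t => vadd (vopp x) t)) in H.
  cbv beta in H. rewrite !vadd_assoc, (vadd_comm (vopp x)), vadd_opp in H.
  rewrite !(vadd_comm vzero), !vadd_0 in H. exact H.
Qed.

Lemma vscal_0 x : (C0 * x)%V = vzero.
Proof.
  apply vadd_cancel with (C0 * x)%V. rewrite <- vscal_distr_c, vadd_0. f_equal. ring.
Qed.

Lemma vopp_scal x : (- x)%V = (vscal (- C1)%C x).
Proof.
  apply vadd_cancel with x. rewrite vadd_opp.
  rewrite <- (vscal_1 x) at 1. rewrite <- vscal_distr_c.
  replace (C1 + - C1)%C with C0 by ring. symmetry; apply vscal_0.
Qed.

Lemma vscal_vzero c : (c * (vzero : X))%V = vzero.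
Proof. rewrite <- (vscal_0 vzero), vscal_assoc. f_equal. ring. Qed.

Lemma vzero_l x : (vzero + x)%V = x.
Proof. rewrite vadd_comm. apply vadd_0. Qed.

(** * Normalization of linear expressions by reflection *)

Inductive vexpr : Type :=
| VAtom (n : nat) | VZero | VAdd (e f : vexpr) | VOpp (e : vexpr) | VScal (c : C) (e : vexpr).

Fixpoint veval (env : list X) (e : vexpr) : X :=
  match e with
  | VAtom n => nth n env vzero
  | VZero => vzero
  | VAdd e f => vadd (veval env e) (veval env f)
  | VOpp e => vopp (veval env e)
  | VScal c e => vscal c (veval env e)
  end.

Fixpoint vlin (cs : list C) (env : list X) : X :=
  match cs, env with
  | c :: cs, v :: env => (c * v + vlin cs env)%V
  | _, _ => vzero
  end.

Fixpoint ladd (l m : list C) : list C :=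
  match l, m with
  | c :: l, d :: m => Cadd c d :: ladd l m
  | nil, m => m
  | l, nil => l
  end.
Fixpoint lscal (c : C) (l : list C) : list C :=
  match l with nil => nil | d :: l => Cmul c d :: lscal c l end.
Fixpoint lunit (n : nat) : list C :=
  match n with O => C1 :: nil | S n => C0 :: lunit n end.
Fixpoint vcoefs (e : vexpr) : list C :=
  match e with
  | VAtom n => lunit n
  | VZero => nil
  | VAdd e f => ladd (vcoefs e) (vcoefs f)
  | VOpp e => lscal (Copp C1) (vcoefs e)
  | VScal c e => lscal c (vcoefs e)
  end.

Lemma vlin_unit n env : vlin (lunit n) env = nth n env vzero.
Proof.
  revert env; induction n; destruct env; simpl; auto.
  - rewrite vscal_1, vadd_0. reflexivity.
  - rewrite IHn, vscal_0. apply vzero_l.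
Qed.

Lemma vlin_add l m env : vlin (ladd l m) env = (vlin l env + vlin m env)%V.
Proof.
  revert m env; induction l; intros m env; simpl.
  - symmetry; apply vzero_l.
  - destruct m, env; simpl; rewrite ?vadd_0; auto.
    rewrite IHl, vscal_distr_c. rewrite <- !vadd_assoc. f_equal.
    rewrite !vadd_assoc. f_equal. apply vadd_comm.
Qed.

Lemma vlin_scal c l env : vlin (lscal c l) env = (c * vlin l env)%V.
Proof.
  revert env; induction l; intros env; simpl.
  - symmetry; apply vscal_vzero.
  - destruct env; simpl.
    + symmetry; apply vscal_vzero.
    + rewrite IHl, vscal_distr_v, vscal_assoc. reflexivity.
Qed.

Lemma veval_coefs env e : veval env e = vlin (vcoefs e) env.
Proof.
  induction e; simpl.
  - symmetry; apply vlin_unit.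
  - reflexivity.
  - rewrite vlin_add. congruence.
  - rewrite vlin_scal, <- vopp_scal. congruence.
  - rewrite vlin_scal. congruence.
Qed.

Fixpoint all_zero (l : list C) : Prop :=
  match l with nil => True | c :: l => c = C0 /\ all_zero l end.
(** Coefficient lists are not padded to a common length, so the tail of the longer one is required
    to vanish. *)
Fixpoint leqv (l m : list C) : Prop :=
  match l, m with
  | nil, m => all_zero m
  | l, nil => all_zero l
  | c :: l, d :: m => c = d /\ leqv l m
  end.

Lemma vlin_all_zero l env : all_zero l -> vlin l env = vzero.
Proof.
  revert env; induction l as [|c l IH]; intros env H; [reflexivity|].
  destruct env; [reflexivity|]. destruct H as [-> H]. simpl.
  rewrite vscal_0, vzero_l. apply IH, H.
Qed.

Lemma vlin_eqv l m env : leqv l m -> vlin l env = vlin m env.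
Proof.
  revert m env; induction l as [|c l IH]; intros m env H.
  - symmetry. exact (vlin_all_zero env H).
  - destruct m as [|d m].
    + exact (vlin_all_zero env H).
    + destruct H as [-> H]. destruct env; simpl; [reflexivity|].
      rewrite (IH m) by exact H. reflexivity.
Qed.

Lemma veval_eq env e f : leqv (vcoefs e) (vcoefs f) -> veval env e = veval env f.
Proof. rewrite !veval_coefs. apply vlin_eqv. Qed.

End VectorBasics.

Ltac v_mem x l :=
  match l with
  | nil => constr:(false)
  | x :: _ => constr:(true)
  | _ :: ?l' => v_mem x l'
  end.
Ltac v_index x l :=
  match l with
  | x :: _ => constr:(O)
  | _ :: ?l' => let n := v_index x l' in constr:(S n)
  end.
Ltac v_atoms e l :=
  match e with
  | vadd ?a ?b => let l1 := v_atoms a l in v_atoms b l1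
  | vopp ?a => v_atoms a l
  | vscal ?c ?a => v_atoms a l
  | vzero => constr:(l)
  | _ => match v_mem e l with true => constr:(l) | false => constr:(e :: l) end
  end.
Ltac v_reify e l :=
  match e with
  | vadd ?a ?b => let a' := v_reify a l in let b' := v_reify b l in constr:(VAdd a' b')
  | vopp ?a => let a' := v_reify a l in constr:(VOpp a')
  | vscal ?c ?a => let a' := v_reify a l in constr:(VScal c a')
  | vzero => constr:(VZero)
  | _ => let n := v_index e l in constr:(VAtom n)
  end.
(* Decides equalities of linear combinations up to C-coefficient identities *)
Ltac vmod_goals :=
  match goal with
  | |- @eq (car ?X) ?a ?b =>
    let l0 := v_atoms a (@nil (car X)) in
    let l := v_atoms b l0 in
    let ea := v_reify a l in
    let eb := v_reify b l in
    change (veval l ea = veval l eb);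
    apply veval_eq;
    cbv [vcoefs ladd lscal lunit leqv all_zero];
    repeat split
  end.
Ltac vmod := vmod_goals; try ring.
Ltac vmodf := vmod_goals; try field.

(** * Normed spaces and bounded operators *)

Section Norm.
Variable X : CBanach.
Implicit Types (x y z : X) (u : nat -> X).

Lemma vnorm_0 : vnorm (vzero : X) = 0.
Proof. rewrite <- (vscal_0 vzero), vnorm_scal, Cmod_0. ring. Qed.

Lemma vnorm_opp x : vnorm (- x)%V = vnorm x.
Proof. rewrite vopp_scal, vnorm_scal, Cmod_opp, Cmod_1. ring. Qed.

Lemma vnorm_ge0 x : 0 <= vnorm x.
Proof.
  pose proof (vnorm_triangle x (- x)%V) as H.
  rewrite vadd_opp, vnorm_0, vnorm_opp in H. lra.
Qed.

Lemma vnorm_sub_sym x y : vnorm (x - y)%V = vnorm (y - x)%V.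
Proof. rewrite <- vnorm_opp. f_equal. vmod. Qed.

Lemma vnorm_sub_triangle y x z : vnorm (x - z)%V <= vnorm (x - y)%V + vnorm (y - z)%V.
Proof.
  replace (x - z)%V with ((x - y) + (y - z))%V by vmod. apply vnorm_triangle.
Qed.

Lemma vnorm_triangle_sub x y : vnorm x - vnorm y <= vnorm (x - y)%V.
Proof.
  pose proof (vnorm_triangle (x - y)%V y) as H.
  replace ((x - y) + y)%V with x in H by vmod. lra.
Qed.

Lemma vnorm_sub_le x y : vnorm (x - y)%V <= vnorm x + vnorm y.
Proof. rewrite <- (vnorm_opp y). apply vnorm_triangle. Qed.

Lemma vsub_eq0 x y : (x - y)%V = vzero -> x = y.
Proof.
  intro H. replace x with ((x - y) + y)%V by vmod. rewrite H. vmod.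
Qed.

Lemma vnorm_gt0 x : x <> vzero -> 0 < vnorm x.
Proof.
  intro H. destruct (vnorm_ge0 x) as [G|G]; [exact G|]. symmetry in G. apply vnorm_eq0 in G. contradiction.
Qed.

Lemma vnorm_arb_small x : (forall eps, 0 < eps -> vnorm x < eps) -> x = vzero.
Proof.
  intro H. apply NNPP. intro N. apply vnorm_gt0 in N. specialize (H _ N). lra.
Qed.

Definition vlim u (l : X) : Prop :=
  forall eps, 0 < eps -> exists N, forall n, (N <= n)%nat -> vnorm (u n - l)%V < eps.

Lemma vlim_unique u l l' : vlim u l -> vlim u l' -> l = l'.
Proof.
  intros H H'. apply vsub_eq0, vnorm_arb_small. intros eps He.
  destruct (H (eps / 2)) as [N HN]; [lra|]. destruct (H' (eps / 2)) as [N' HN']; [lra|].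
  specialize (HN (max N N') ltac:(lia)). specialize (HN' (max N N') ltac:(lia)).
  pose proof (vnorm_sub_triangle (u (max N N')) l l'). rewrite (vnorm_sub_sym l (u (max N N'))) in H0. lra.
Qed.

Lemma vlim_add u v l m : vlim u l -> vlim v m -> vlim (fun n => u n + v n)%V (l + m)%V.
Proof.
  intros H H' eps He.
  destruct (H (eps / 2)) as [N HN]; [lra|]. destruct (H' (eps / 2)) as [N' HN']; [lra|].
  exists (max N N'). intros n Hn. specialize (HN n ltac:(lia)). specialize (HN' n ltac:(lia)).
  replace ((u n + v n) - (l + m))%V with ((u n - l) + (v n - m))%V by vmod.
  pose proof (vnorm_triangle (u n - l)%V (v n - m)%V). lra.
Qed.

Lemma vlim_scal c u l : vlim u l -> vlim (fun n => c * u n)%V (c * l)%V.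
Proof.
  intros H eps He. pose proof (Cmod_ge0 c).
  destruct (H (eps / (Cmod c + 1))) as [N HN]; [apply Rdiv_lt_0_compat; lra|].
  exists N. intros n Hn. specialize (HN n Hn).
  replace (c * u n - c * l)%V with (c * (u n - l))%V by vmod. rewrite vnorm_scal.
  pose proof (vnorm_ge0 (u n - l)%V).
  apply Rle_lt_trans with ((Cmod c + 1) * vnorm (u n - l)%V); [nra|].
  apply lt_div_cancel in HN; [|lra]. exact HN.
Qed.

Lemma vlim_const x : vlim (fun _ => x) x.
Proof. intros eps He. exists O. intros n _. rewrite vadd_opp, vnorm_0. exact He. Qed.

Lemma vlim_ext u v l : (forall n, u n = v n) -> vlim u l -> vlim v l.
Proof. intros E H eps He. destruct (H eps He) as [N HN]. exists N. intros. rewrite <- E. auto. Qed.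

Lemma vlim_sub u v l m : vlim u l -> vlim v m -> vlim (fun n => u n - v n)%V (l - m)%V.
Proof.
  intros H H'. apply (@vlim_scal (Copp C1)) in H'. pose proof (vlim_add H H') as K.
  rewrite <- vopp_scal in K. refine (vlim_ext _ K). intro n. vmod.
Qed.

Lemma vlim_le_norm u l B : vlim u l -> (exists N, forall n, (N <= n)%nat -> vnorm (u n) <= B) -> vnorm l <= B.
Proof.
  intros H [N HB]. apply Rnot_lt_le. intro L.
  destruct (H (vnorm l - B)) as [N' HN']; [lra|].
  specialize (HN' (max N N') ltac:(lia)). specialize (HB (max N N') ltac:(lia)).
  rewrite vnorm_sub_sym in HN'. pose proof (vnorm_triangle_sub l (u (max N N'))). lra.
Qed.

Lemma vlim_le_sub u l x B : vlim u l -> (exists N, forall n, (N <= n)%nat -> vnorm (u n - x)%V <= B) ->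
  vnorm (l - x)%V <= B.
Proof. intros H HB. apply (vlim_le_norm (vlim_sub H (vlim_const x)) HB). Qed.

Lemma subseq_ge (phi : nat -> nat) : (forall n, (phi n < phi (S n))%nat) -> forall n, (n <= phi n)%nat.
Proof. intros H n. induction n; [lia|]. specialize (H n). lia. Qed.

Lemma subseq_lt (phi : nat -> nat) : (forall n, (phi n < phi (S n))%nat) -> forall n m, (n < m)%nat -> (phi n < phi m)%nat.
Proof. intros H n m L. induction L; [apply H|]. specialize (H m). lia. Qed.

Lemma vlim_subseq u l phi : (forall n, (phi n < phi (S n))%nat) -> vlim u l -> vlim (fun n => u (phi n)) l.
Proof.
  intros Hp H eps He. destruct (H eps He) as [N HN]. exists N. intros n Hn. apply HN.
  pose proof (subseq_ge Hp n). lia.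
Qed.

Definition vclosed (W : X -> Prop) : Prop :=
  forall y, (forall eps, 0 < eps -> exists x, W x /\ vnorm (y - x)%V < eps) -> W y.

Lemma vclosed_lim W u l : vclosed W -> (forall n, W (u n)) -> vlim u l -> W l.
Proof.
  intros HW Hu H. apply HW. intros eps He. destruct (H eps He) as [N HN].
  exists (u N). split; [apply Hu|]. rewrite vnorm_sub_sym. apply HN. lia.
Qed.

Record vsubspace (W : X -> Prop) : Prop := {
  vsub_0 : W vzero;
  vsub_add : forall x y, W x -> W y -> W (x + y)%V;
  vsub_scal : forall c x, W x -> W (c * x)%V }.

Lemma vsub_opp W x : vsubspace W -> W x -> W (- x)%V.
Proof. intros HW Hx. rewrite vopp_scal. apply vsub_scal; assumption. Qed.

Lemma vsub_sub W x y : vsubspace W -> W x -> W y -> W (x - y)%V.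
Proof. intros HW Hx Hy. apply vsub_add; auto. apply vsub_opp; auto. Qed.

Lemma geometric_limit u B : (forall n, vnorm (u (S n) - u n)%V <= B * (/ 2) ^ n) ->
  exists l, vlim u l /\ forall n, vnorm (u n - l)%V <= 2 * B * (/ 2) ^ n.
Proof.
  intro H.
  assert (G : forall n k, vnorm (u (n + k)%nat - u n)%V <= 2 * B * (/ 2) ^ n - 2 * B * (/ 2) ^ (n + k)).
  { intros n k. induction k.
    - rewrite Nat.add_0_r, vadd_opp, vnorm_0. lra.
    - rewrite Nat.add_succ_r. pose proof (vnorm_sub_triangle (u (n + k)%nat) (u (S (n + k))) (u n)) as T.
      specialize (H (n + k)%nat). simpl pow. lra. }
  assert (HB : 0 <= B).
  { specialize (H O). pose proof (vnorm_ge0 (u 1%nat - u O)%V). simpl in H. lra. }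
  assert (G2 : forall n m, (n <= m)%nat -> vnorm (u m - u n)%V <= 2 * B * (/ 2) ^ n).
  { intros n m L. replace m with (n + (m - n))%nat by lia. specialize (G n (m - n)%nat).
    assert (0 <= (/ 2) ^ (n + (m - n))) by (apply pow_le; lra). nra. }
  destruct (@vcomplete X u) as [l Hl].
  - intros eps He. destruct (@pow_small (/ 2) (2 * B) (eps / 2)) as [N HN]; [lra|lra|].
    exists N. intros m n Hm Hn.
    pose proof (G2 N m Hm). pose proof (G2 N n Hn). specialize (HN N (le_n N)).
    pose proof (vnorm_sub_triangle (u N) (u m) (u n)) as T. rewrite (vnorm_sub_sym (u N) (u n)) in T. lra.
  - exists l. split; [exact Hl|]. intro n. rewrite vnorm_sub_sym. apply (vlim_le_sub Hl).
    exists n. intros m Hm. apply G2, Hm.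
Qed.

(** The iteration behind the open mapping theorem: an approximate solution with relative error 1/2
    is corrected by solving again for the remainder. The corrections decay like 2^(-n) and sum to at
    most 2 K |y|. Keeping everything inside a closed W is what later makes resolvents preserve W. *)
Lemma approx_surj (W : X -> Prop) (A : X -> X) (K M : R) :
  vsubspace W -> vclosed W ->
  (forall x y, A (x + y)%V = (A x + A y)%V) ->
  A vzero = vzero ->
  (forall x, vnorm (A x) <= M * vnorm x) ->
  (forall x, W x -> W (A x)) ->
  (forall y, W y -> exists x, W x /\ vnorm x <= K * vnorm y /\ vnorm (y - A x)%V <= / 2 * vnorm y) ->
  forall y, W y -> exists x, W x /\ A x = y /\ vnorm x <= 2 * K * vnorm y.
Proof.
  intros HW HC HA HA0 HM HAW HK y Hy.
  assert (HK' : forall y, exists x, W y -> W x /\ vnorm x <= K * vnorm y /\ vnorm (y - A x)%V <= / 2 * vnorm y).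
  { intro z. destruct (classic (W z)) as [Hz|Hz].
    - destruct (HK z Hz) as [x Hx]. exists x. auto.
    - exists vzero. tauto. }
  set (g := fun y => proj1_sig (constructive_indefinite_description _ (HK' y))).
  assert (Hg : forall y, W y -> W (g y) /\ vnorm (g y) <= K * vnorm y /\ vnorm (y - A (g y))%V <= / 2 * vnorm y).
  { intro z. unfold g. destruct constructive_indefinite_description as [x Hx]. simpl. exact Hx. }
  clearbody g. clear HK HK'.
  set (s := fix s n := match n with O => vzero | S n => (s n + g (y - A (s n)))%V end).
  assert (Hs : forall n, W (s n) /\ W (y - A (s n))%V /\ vnorm (y - A (s n))%V <= vnorm y * (/ 2) ^ n).
  { induction n as [|n [I1 [I2 I3]]]; simpl.
    - rewrite HA0. replace (y - vzero)%V with y by vmod. split; [apply HW|]. split; [exact Hy|]. lra.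
    - destruct (Hg _ I2) as [J1 [J2 J3]]. rewrite HA.
      replace (y - (A (s n) + A (g (y - A (s n)))))%V with ((y - A (s n)) - A (g (y - A (s n))))%V by vmod.
      split; [apply vsub_add; auto|]. split.
      + apply vsub_sub; auto.
      + lra. }
  (* A negative K is compatible with the bound on [g y] only when |y| = 0. *)
  assert (HKy : 0 <= K \/ vnorm y = 0).
  { destruct (Rle_lt_dec 0 K); [left; assumption|right].
    destruct (Hg y Hy) as [_ [J _]]. pose proof (vnorm_ge0 (g y)). pose proof (vnorm_ge0 y). nra. }
  assert (HKy' : 0 <= K * vnorm y).
  { destruct HKy as [HK|HK]; [pose proof (vnorm_ge0 y); nra|rewrite HK; lra]. }
  destruct (@geometric_limit s (K * vnorm y)) as [l [Hl Hl']].
  { intro n. simpl s. destruct (Hs n) as [I1 [I2 I3]]. destruct (Hg _ I2) as [J1 [J2 J3]].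
    replace ((s n + g (y - A (s n))) - s n)%V with (g (y - A (s n))%V) by vmod.
    destruct HKy as [HK|HK].
    - eapply Rle_trans; [exact J2|]. rewrite Rmult_assoc. apply Rmult_le_compat_l; assumption.
    - rewrite HK in I3. pose proof (vnorm_ge0 (y - A (s n))%V).
      replace (vnorm (y - A (s n))%V) with 0 in J2 by lra. rewrite HK. lra. }
  assert (Al : forall x z, A (x - z)%V = (A x - A z)%V).
  { intros x z. apply vadd_cancel with (A z). rewrite <- HA.
    replace (z + (x - z))%V with x by vmod. vmod. }
  exists l. split; [|split].
  - apply (vclosed_lim HC (fun n => proj1 (Hs n)) Hl).
  - apply (@vlim_unique (fun n => A (s n))).
    + intros eps He. pose proof (Rabs_pos M). destruct (Hl (eps / (Rabs M + 1))) as [N HN]; [apply Rdiv_lt_0_compat; lra|].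
      exists N. intros n Hn. specialize (HN n Hn). rewrite <- Al.
      pose proof (HM (s n - l)%V). pose proof (vnorm_ge0 (s n - l)%V). pose proof (Rle_abs M).
      apply lt_div_cancel in HN; [|lra]. nra.
    + intros eps He. destruct (@pow_small (/ 2) (vnorm y) eps) as [N HN]; [lra|exact He|]. exists N. intros n Hn.
      rewrite vnorm_sub_sym. destruct (Hs n) as [_ [_ I3]]. specialize (HN n Hn). lra.
  - specialize (Hl' O). simpl in Hl'. replace (vzero - l)%V with (- l)%V in Hl' by vmod.
    rewrite vnorm_opp in Hl'. lra.
Qed.
End Norm.

(** The explicit bound B excludes the default value 0 that [Rsup] takes on unbounded sets. *)
Lemma Rsup_ub (E : R -> Prop) (B r : R) : (forall r, E r -> r <= B) -> E r -> r <= Rsup E.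
Proof.
  intros HB Hr. unfold Rsup. destruct excluded_middle_informative as [H|H].
  - destruct completeness as [m Hm]. simpl. apply Hm, Hr.
  - exfalso. apply H. split; [|exists r; exact Hr]. exists B. exact HB.
Qed.

Lemma Rsup_le (E : R -> Prop) (B : R) : 0 <= B -> (forall r, E r -> r <= B) -> Rsup E <= B.
Proof.
  intros H0 HB. unfold Rsup. destruct excluded_middle_informative as [H|H]; [|exact H0].
  destruct completeness as [m Hm]. simpl. apply Hm. exact HB.
Qed.

Section Opnorm.
Variable X : CBanach.
Implicit Types (T : Op X) (x y : X).

Lemma opnorm_le T M : 0 <= M -> (forall x, vnorm (T x) <= M * vnorm x) -> opnorm T <= M.
Proof.
  intros HM H. apply Rsup_le; [exact HM|]. intros r [x [Hx ->]]. specialize (H x).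
  pose proof (vnorm_ge0 x). nra.
Qed.

Lemma is_bounded_pos T : is_bounded T -> exists M, 0 <= M /\ forall x, vnorm (T x) <= M * vnorm x.
Proof.
  intros [M HM]. exists (Rabs M). split; [apply Rabs_pos|]. intro x. eapply Rle_trans; [apply HM|].
  pose proof (vnorm_ge0 x). pose proof (Rle_abs M). nra.
Qed.

Lemma linear_vzero T : is_linear T -> T vzero = vzero.
Proof. intros [_ H]. rewrite <- (vscal_0 vzero), H. rewrite !vscal_0. reflexivity. Qed.

Lemma opnorm_ub T x : is_bop T -> vnorm (T x) <= opnorm T * vnorm x.
Proof.
  intros [HL HB]. destruct (is_bounded_pos HB) as [M [HM0 HM]].
  destruct (classic (x = vzero)) as [->|Hx].
  - rewrite (linear_vzero HL), vnorm_0. lra.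
  - apply vnorm_gt0 in Hx.
    assert (H : vnorm (T (RtoC (/ vnorm x) * x)%V) <= opnorm T).
    { apply Rsup_ub with M.
      - intros r [y [Hy ->]]. specialize (HM y). pose proof (vnorm_ge0 y). nra.
      - eexists; split; [|reflexivity]. rewrite vnorm_scal, Cmod_RtoC, Rabs_pos_eq.
        + rewrite Rinv_l; lra.
        + left; apply Rinv_0_lt_compat, Hx. }
    rewrite (proj2 HL), vnorm_scal, Cmod_RtoC, Rabs_pos_eq in H by (left; apply Rinv_0_lt_compat, Hx).
    apply (Rmult_le_compat_r (vnorm x)) in H; [|lra].
    replace (/ vnorm x * vnorm (T x) * vnorm x) with (vnorm (T x)) in H by (field; lra). exact H.
Qed.

Lemma opnorm_ge0 T : 0 <= opnorm T.
Proof.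
  unfold opnorm, Rsup. destruct excluded_middle_informative as [H|H]; [|lra].
  destruct completeness as [m Hm]. simpl. apply Rle_trans with (vnorm (T vzero)); [apply vnorm_ge0|].
  apply Hm. exists vzero. rewrite vnorm_0. split; [lra|reflexivity].
Qed.
End Opnorm.

(** Bundling turns bounded operators into a type, which becomes the carrier of the Banach space [BX]
    on which ad acts. *)
Record bop (X : CBanach) := mkBop { bfun :> X -> X; bfun_bop : is_bop bfun }.

Lemma bop_eq (X : CBanach) (S T : bop X) : (forall x, S x = T x) -> S = T.
Proof.
  destruct S as [S HS], T as [T HT]. simpl. intro H. apply functional_extensionality in H.
  subst. f_equal. apply proof_irrelevance.
Qed.

Section BopLin.
Variable X : CBanach.
Implicit Types (S T : bop X) (x y : X).
Lemma bop_add T x y : T (x + y)%V = (T x + T y)%V.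
Proof. apply (bfun_bop T). Qed.
Lemma bop_scal T c x : T (c * x)%V = (c * T x)%V.
Proof. apply (bfun_bop T). Qed.
Lemma bop_opp T x : T (- x)%V = (- T x)%V.
Proof. rewrite !vopp_scal. apply bop_scal. Qed.
Lemma bop_zero T : T vzero = vzero.
Proof. apply linear_vzero, (bfun_bop T). Qed.
Lemma bop_bounded T : exists M, 0 <= M /\ forall x, vnorm (T x) <= M * vnorm x.
Proof. apply is_bounded_pos, (bfun_bop T). Qed.
Lemma bop_norm T x : vnorm (T x) <= opnorm T * vnorm x.
Proof. apply opnorm_ub, bfun_bop. Qed.
Lemma bop_vlim T u l : vlim u l -> vlim (fun n => T (u n)) (T l).
Proof.
  intros Hl eps He. destruct (bop_bounded T) as [M [HM0 HM]].
  destruct (Hl (eps / (M + 1))) as [N HN]; [apply Rdiv_lt_0_compat; lra|].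
  exists N. intros n Hn. specialize (HN n Hn).
  replace (T (u n) - T l)%V with (T (u n - l)%V) by (rewrite bop_add, bop_opp; reflexivity).
  pose proof (HM (u n - l)%V). pose proof (vnorm_ge0 (u n - l)%V).
  apply lt_div_cancel in HN; [|lra]. nra.
Qed.
End BopLin.

#[export] Hint Rewrite bop_add bop_scal bop_opp bop_zero : lin.

Section BopOps.
Variable X : CBanach.
Implicit Types (S T : bop X) (x y : X).

Lemma badd_bop S T : is_bop (fun x => S x + T x)%V.
Proof.
  split; [split|].
  - intros; autorewrite with lin; vmod.
  - intros; autorewrite with lin; vmod.
  - destruct (bop_bounded S) as [M [_ HM]], (bop_bounded T) as [N [_ HN]].
    exists (M + N). intro x. pose proof (vnorm_triangle (S x) (T x)). specialize (HM x); specialize (HN x). lra.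
Qed.
Lemma bscal_bop c T : is_bop (fun x => c * T x)%V.
Proof.
  split; [split|].
  - intros; autorewrite with lin; vmod.
  - intros; autorewrite with lin; vmod.
  - destruct (bop_bounded T) as [N [_ HN]].
    exists (Cmod c * N). intro x. rewrite vnorm_scal. specialize (HN x). pose proof (Cmod_ge0 c). nra.
Qed.
Lemma bcomp_bop S T : is_bop (fun x => S (T x)).
Proof.
  split; [split|].
  - intros; autorewrite with lin; reflexivity.
  - intros; autorewrite with lin; reflexivity.
  - destruct (bop_bounded S) as [M [HM0 HM]], (bop_bounded T) as [N [_ HN]].
    exists (M * N). intro x. specialize (HM (T x)); specialize (HN x). nra.
Qed.
Lemma bid_bop : is_bop (fun x : X => x).
Proof. split; [split|]; auto. exists 1. intro; lra. Qed.
Lemma bzero_bop : is_bop (fun _ : X => (vzero : X)).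
Proof.
  split; [split|].
  - intros; vmod.
  - intros; vmod.
  - exists 0. intro. rewrite vnorm_0. lra.
Qed.

Definition badd S T := mkBop (badd_bop S T).
Definition bscal c T := mkBop (bscal_bop c T).
Definition bcomp S T := mkBop (bcomp_bop S T).
Definition bid := mkBop bid_bop.
Definition bzero := mkBop bzero_bop.
Definition bopp T := bscal (Copp C1) T.
Definition bsub S T := badd S (bopp T).
Fixpoint bpow T (n : nat) : bop X := match n with O => bid | S n => bcomp T (bpow T n) end.

Lemma badd_app S T x : badd S T x = (S x + T x)%V. Proof. reflexivity. Qed.
Lemma bscal_app c T x : bscal c T x = (c * T x)%V. Proof. reflexivity. Qed.
Lemma bopp_app T x : bopp T x = (- T x)%V. Proof. symmetry; apply vopp_scal. Qed.
Lemma bsub_app S T x : bsub S T x = (S x - T x)%V.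
Proof. unfold bsub. rewrite badd_app, bopp_app. reflexivity. Qed.
Lemma bcomp_app S T x : bcomp S T x = S (T x). Proof. reflexivity. Qed.
Lemma bid_app x : bid x = x. Proof. reflexivity. Qed.
Lemma bzero_app x : bzero x = vzero. Proof. reflexivity. Qed.
Lemma bpow_0 T x : bpow T 0 x = x. Proof. reflexivity. Qed.
Lemma bpow_S T n x : bpow T (S n) x = T (bpow T n x). Proof. reflexivity. Qed.
Lemma bpow_Sr T n x : bpow T (S n) x = bpow T n (T x).
Proof. induction n; [reflexivity|]. rewrite bpow_S, IHn. reflexivity. Qed.
Lemma bpow_add T m n x : bpow T (m + n) x = bpow T m (bpow T n x).
Proof. induction m; [reflexivity|]. simpl. rewrite <- IHm. reflexivity. Qed.
Lemma bpow_mul T m n x : bpow T (m * n) x = bpow (bpow T n) m x.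
Proof. induction m; [reflexivity|]. simpl Nat.mul. rewrite bpow_add, IHm. reflexivity. Qed.

Definition commutes S T := forall x, S (T x) = T (S x).
Lemma commutes_pow S T n : commutes S T -> commutes S (bpow T n).
Proof. intros H x. induction n; [reflexivity|]. rewrite !bpow_S, H, IHn. reflexivity. Qed.
Lemma commutes_sym S T : commutes S T -> commutes T S.
Proof. intros H x. symmetry. apply H. Qed.
Lemma commutes_refl T : commutes T T.
Proof. intro. reflexivity. Qed.
Lemma commutes_badd S T U : commutes S T -> commutes S U -> commutes S (badd T U).
Proof. intros H H' x. rewrite !badd_app, bop_add, H, H'. reflexivity. Qed.
Lemma commutes_bscal c S T : commutes S T -> commutes S (bscal c T).
Proof. intros H x. rewrite !bscal_app, bop_scal, H. reflexivity. Qed.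
Lemma commutes_bcomp S T U : commutes S T -> commutes S U -> commutes S (bcomp T U).
Proof. intros H H' x. rewrite !bcomp_app, H, H'. reflexivity. Qed.
Lemma commutes_bid S : commutes S bid.
Proof. intro. reflexivity. Qed.
Lemma commutes_bopp S T : commutes S T -> commutes S (bopp T).
Proof. apply commutes_bscal. Qed.
Lemma commutes_bsub S T U : commutes S T -> commutes S U -> commutes S (bsub T U).
Proof. intros. apply commutes_badd; auto. apply commutes_bopp; auto. Qed.
End BopOps.
Arguments bid {X}.
Arguments bzero {X}.

#[export] Hint Rewrite badd_app bscal_app bopp_app bsub_app bcomp_app bid_app bzero_app : lin.
#[export] Hint Resolve commutes_badd commutes_bscal commutes_bcomp commutes_bid commutes_bopp
  commutes_bsub commutes_pow commutes_refl : comm.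

(** * Spectral radius *)

Lemma bernoulli h n : 0 <= h <= 1 -> 1 - INR n * h <= (1 - h) ^ n.
Proof.
  intro H. induction n as [|n IH]; [simpl; lra|].
  rewrite S_INR. simpl pow.
  assert (0 <= (1 - h) ^ n) by (apply pow_le; lra).
  assert (0 <= INR n) by apply pos_INR.
  apply Rle_trans with ((1 - h) * (1 - INR n * h)); [nra|]. apply Rmult_le_compat_l; lra.
Qed.

Fixpoint Cpow (c : C) (n : nat) : C := match n with O => C1 | S n => Cmul c (Cpow c n) end.
Lemma Cmod_pow c n : Cmod (Cpow c n) = Cmod c ^ n.
Proof. induction n; simpl; [apply Cmod_1|]. rewrite Cmod_mul, IHn. reflexivity. Qed.
Lemma Cpow_neq0 c n : c <> C0 -> Cpow c n <> C0.
Proof. intro H. apply Cmod_pos_neq. rewrite Cmod_pow. apply pow_lt, Cmod_gt0, H. Qed.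

(** Stands in for a bound on the spectral radius: it holds for every t above the spectral radius and
    for no t >= 0 below it. *)
Definition pbound (X : CBanach) (a : bop X) (t : R) : Prop :=
  exists K, 0 <= K /\ forall n x, vnorm (bpow a n x) <= K * t ^ n * vnorm x.

Section PowerBounds.
Variable X : CBanach.
Variable a : bop X.

Lemma pbound_mono t t' : 0 <= t <= t' -> pbound a t -> pbound a t'.
Proof.
  intros H [K [HK0 HK]]. exists K. split; [exact HK0|]. intros n x. eapply Rle_trans; [apply HK|].
  apply Rmult_le_compat_r; [apply vnorm_ge0|]. apply Rmult_le_compat_l; [exact HK0|]. apply pow_incr, H.
Qed.

Lemma pow_norm_le M : 0 <= M -> (forall x, vnorm (a x) <= M * vnorm x) ->
  forall n x, vnorm (bpow a n x) <= M ^ n * vnorm x.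
Proof.
  intros HM H n x. induction n; [simpl; rewrite Rmult_1_l; apply Rle_refl|]. rewrite bpow_S.
  eapply Rle_trans; [apply H|]. simpl. rewrite Rmult_assoc. apply Rmult_le_compat_l; assumption.
Qed.

Lemma pbound_norm M : 0 <= M -> (forall x, vnorm (a x) <= M * vnorm x) -> pbound a M.
Proof.
  intros HM H. exists 1. split; [lra|]. intros. rewrite Rmult_1_l. apply pow_norm_le; assumption.
Qed.

End PowerBounds.

(** Write n = q m + r with r < m. The q full blocks are controlled by the hypothesis, and the r
    leftover factors cost at most M^r <= (1 + M/s)^m s^r. *)
Lemma pbound_of_pow (X : CBanach) (a : bop X) m s : (0 < m)%nat -> 0 < s ->
  (forall x, vnorm (bpow a m x) <= s ^ m * vnorm x) -> pbound a s.
Proof.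
  intros Hm Hs H. destruct (bop_bounded a) as [M [HM0 HM]].
  assert (Hq : 0 <= M / s) by (apply Rmult_le_pos; [lra|left; apply Rinv_0_lt_compat, Hs]).
  exists ((1 + M / s) ^ m). split; [apply pow_le; lra|]. intros n x.
  set (q := (n / m)%nat). set (r := (n mod m)%nat).
  assert (Hr : (r < m)%nat) by (apply Nat.mod_upper_bound; lia).
  assert (E : n = (q * m + r)%nat) by (pose proof (Nat.div_mod_eq n m); unfold q, r; lia).
  rewrite E, bpow_add, bpow_mul.
  eapply Rle_trans; [apply (@pow_norm_le X (bpow a m) (s ^ m)); [apply pow_le; lra|exact H]|].
  rewrite <- pow_mult, pow_add, Nat.mul_comm.
  assert (P : 0 <= s ^ (q * m)) by (apply pow_le; lra).
  replace ((1 + M / s) ^ m * (s ^ (q * m) * s ^ r) * vnorm x)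
    with (s ^ (q * m) * ((1 + M / s) ^ m * s ^ r * vnorm x)) by ring.
  apply Rmult_le_compat_l; [exact P|].
  eapply Rle_trans; [apply (@pow_norm_le X a M HM0 HM)|].
  apply Rmult_le_compat_r; [apply vnorm_ge0|].
  apply Rle_trans with ((1 + M / s) ^ r * s ^ r).
  - rewrite <- Rpow_mult_distr. apply pow_incr. split; [exact HM0|].
    replace ((1 + M / s) * s) with (s + M) by (field; lra). lra.
  - apply Rmult_le_compat_r; [apply pow_le; lra|]. apply Rle_pow; [lra|lia].
Qed.

(** * Neumann series on invariant subspaces *)

Section Neumann.
Variable X : CBanach.
Variable a : bop X.
Variable lam : C.
Hypothesis Hlam : lam <> C0.

(** The partial sum of a^j / lam^(j+1) over j < n, in Horner form. *)
Fixpoint neumann_sum (n : nat) : bop X :=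
  match n with
  | O => bzero
  | S n => bscal (Cinv lam) (badd bid (bcomp a (neumann_sum n)))
  end.

Lemma neumann_sum_spec n y :
  (lam * neumann_sum n y - a (neumann_sum n y))%V = (y - Cinv (Cpow lam n) * bpow a n y)%V.
Proof.
  induction n as [|n IH].
  - change (neumann_sum 0) with (@bzero X). rewrite bpow_0. simpl Cpow. autorewrite with lin.
    vmod_goals; field; apply C1_neq_C0.
  - simpl neumann_sum. autorewrite with lin.
    assert (E : (a (lam * neumann_sum n y - a (neumann_sum n y)))%V = (a y - Cinv (Cpow lam n) * bpow a (S n) y)%V).
    { rewrite IH. autorewrite with lin. rewrite bpow_S. reflexivity. }
    autorewrite with lin in E.
    replace (bpow a (S n) y) with (Cpow lam n * (a y - (lam * a (neumann_sum n y) - a (a (neumann_sum n y)))))%V.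
    + simpl Cpow. pose proof (Cpow_neq0 (n:=n) Hlam). vmod_goals; field; auto.
    + rewrite E. pose proof (Cpow_neq0 (n:=n) Hlam). vmod_goals; field; auto.
Qed.

Lemma neumann_sum_inv (W : X -> Prop) n y : vsubspace W -> (forall x, W x -> W (a x)) -> W y -> W (neumann_sum n y).
Proof.
  intros HW Ha Hy. induction n; simpl; [apply HW|]. apply vsub_scal; auto. apply vsub_add; auto.
Qed.

(** The remainder a^m / lam^m of the m-th partial sum has norm at most K (t / |lam|)^m, below 1/2
    for large m, and [approx_surj] does the rest. Partial sums are polynomials in a, hence the
    solution stays in W. *)
Lemma neumann_surj (W : X -> Prop) t : vsubspace W -> vclosed W -> (forall x, W x -> W (a x)) ->
  pbound a t -> 0 <= t < Cmod lam -> forall y, W y -> exists x, W x /\ (lam * x - a x)%V = y.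
Proof.
  intros HW HC Ha [K [HK0 HK]] Ht y Hy.
  assert (Hl : 0 < Cmod lam) by lra.
  destruct (@pow_small (t / Cmod lam) K (/ 2)) as [m Hm]; [apply ratio_lt_1, Ht|lra|].
  specialize (Hm m (le_n m)).
  destruct (bop_bounded (bsub (bscal lam bid) a)) as [M [_ HM]].
  destruct (bop_bounded (neumann_sum m)) as [B [_ HB]].
  destruct (@approx_surj X W (bsub (bscal lam bid) a) B M HW HC) with (y := y) as [x [Hx [Ex _]]]; auto.
  - apply bop_add.
  - apply bop_zero.
  - intros x Hx. rewrite bsub_app, bscal_app, bid_app. apply vsub_sub; auto. apply vsub_scal; auto.
  - intros z Hz. exists (neumann_sum m z). split; [apply neumann_sum_inv; auto|]. split; [apply HB|].
    rewrite bsub_app, bscal_app, bid_app, neumann_sum_spec.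
    replace (z - (z - Cinv (Cpow lam m) * bpow a m z))%V with (Cinv (Cpow lam m) * bpow a m z)%V by vmod.
    rewrite vnorm_scal, Cmod_inv, Cmod_pow by (apply Cpow_neq0, Hlam).
    apply Rle_trans with (K * (t / Cmod lam) ^ m * vnorm z).
    + unfold Rdiv. rewrite Rpow_mult_distr, pow_inv.
      replace (K * (t ^ m * / Cmod lam ^ m) * vnorm z) with (/ Cmod lam ^ m * (K * t ^ m * vnorm z)) by ring.
      apply Rmult_le_compat_l; [left; apply Rinv_0_lt_compat, pow_lt, Hl|apply HK].
    + apply Rmult_le_compat_r; [apply vnorm_ge0|lra].
  - exists x. split; [exact Hx|]. rewrite bsub_app, bscal_app, bid_app in Ex. exact Ex.
Qed.
End Neumann.

Lemma full_subspace (X : CBanach) : vsubspace (fun _ : X => True).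
Proof. split; auto. Qed.
Lemma full_closed (X : CBanach) : vclosed (fun _ : X => True).
Proof. intros y _. exact I. Qed.

Definition Ccv (c : nat -> C) (l : C) := forall eps, 0 < eps -> exists N, forall n, (N <= n)%nat -> Cmod (c n - l)%C < eps.

Lemma C_complete (c : nat -> C) :
  (forall eps, 0 < eps -> exists N, forall m n, (N <= m)%nat -> (N <= n)%nat -> Cmod (c m - c n)%C < eps) ->
  exists l, Ccv c l.
Proof.
  intro H.
  assert (Hr : Cauchy_crit (fun n => Re (c n))).
  { intros eps He. destruct (H eps He) as [N HN]. exists N. intros m n Hm Hn. specialize (HN m n Hm Hn).
    unfold Rdist. pose proof (Re_le_Cmod (c m - c n)%C) as T. simpl in T. unfold Rminus. lra. }
  assert (Hi : Cauchy_crit (fun n => Im (c n))).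
  { intros eps He. destruct (H eps He) as [N HN]. exists N. intros m n Hm Hn. specialize (HN m n Hm Hn).
    unfold Rdist. pose proof (Im_le_Cmod (c m - c n)%C) as T. simpl in T. unfold Rminus. lra. }
  destruct (R_complete _ Hr) as [x Hx]. destruct (R_complete _ Hi) as [y Hy].
  exists (mkC x y). intros eps He.
  destruct (Hx (eps / 2)) as [N HN]; [lra|]. destruct (Hy (eps / 2)) as [N' HN']; [lra|].
  exists (max N N'). intros n Hn. specialize (HN n ltac:(lia)). specialize (HN' n ltac:(lia)).
  pose proof (Cmod_le_Re_Im (c n - mkC x y)%C) as T. simpl in T. unfold Rdist, Rminus in *. lra.
Qed.

Lemma vlim_line (X : CBanach) (c : nat -> C) (y z : X) : y <> vzero ->
  vlim (fun n => c n * y)%V z -> exists l, Ccv c l /\ z = (l * y)%V.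
Proof.
  intros Hy H. apply vnorm_gt0 in Hy.
  destruct (@C_complete c) as [l Hl].
  - intros eps He. destruct (H (eps / 2 * vnorm y)) as [N HN]; [nra|]. exists N. intros m n Hm Hn.
    pose proof (HN m Hm). pose proof (HN n Hn).
    pose proof (vnorm_sub_triangle z (c m * y)%V (c n * y)%V) as T.
    rewrite (vnorm_sub_sym z) in T.
    replace (c m * y - c n * y)%V with ((c m - c n)%C * y)%V in T by vmod.
    rewrite vnorm_scal in T. apply Rmult_lt_reg_r with (vnorm y); [exact Hy|lra].
  - exists l. split; [exact Hl|]. apply (vlim_unique H). intros eps He.
    destruct (Hl (eps / vnorm y)) as [N HN]; [apply Rdiv_lt_0_compat; lra|].
    exists N. intros n Hn. specialize (HN n Hn).
    replace (c n * y - l * y)%V with ((c n - l)%C * y)%V by vmod. rewrite vnorm_scal.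
    apply lt_div_cancel in HN; [lra|exact Hy].
Qed.

(** * Pushing a power bound across a circle *)

Section SpectralRadius.
Variable X : CBanach.
Variable a : bop X.

(** With m = 2^k, z is (1 - a^m / (t^m u))^(-1) x, which by partial fractions is the average of (1 -
    a / (t v))^(-1) x over the roots v^m = u. Each of these is Lipschitz in t by the lower bound on
    lam - a, and averaging does not increase the constant. The induction performs the average two
    terms at a time: 1 / (1 - w^2) is half the sum of 1 / (1 - w) and 1 / (1 + w). *)
Lemma dyadic_lipschitz s h kap : 0 < s -> 0 < h -> 0 < kap ->
  (forall lam y, s < Cmod lam <= s + h -> kap * vnorm y <= vnorm (lam * y - a y)%V) ->
  exists K, 0 <= K /\ forall k t t' u x z z',
    s < t <= s + h -> s < t' <= s + h -> Cmod u = 1 ->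
    (RtoC (t ^ (2 ^ k)) * u * z - bpow a (2 ^ k) z)%V = (RtoC (t ^ (2 ^ k)) * u * x)%V ->
    (RtoC (t' ^ (2 ^ k)) * u * z' - bpow a (2 ^ k) z')%V = (RtoC (t' ^ (2 ^ k)) * u * x)%V ->
    vnorm (z - z')%V <= K * Rabs (t - t') * vnorm x.
Proof.
  (* K comes from the case k = 0: (l - a)(z - z') = (l - l')(x - z'), where |z'| <= (s + h) |x| /
     kap. *)
  intros Hs Hh Hk Hlow. set (K := / kap * (1 + / kap * (s + h))).
  assert (Hik : 0 < / kap) by (apply Rinv_0_lt_compat, Hk).
  assert (HK : 0 <= K) by (unfold K; apply Rmult_le_pos; [lra|]; assert (0 <= / kap * (s + h)) by (apply Rmult_le_pos; lra); lra).
  exists K. split; [exact HK|].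
  induction k as [|k IH]; intros t t' u x z z' Ht Ht' Hu Ez Ez'.
  - change (2 ^ 0)%nat with 1%nat in *. rewrite bpow_S, bpow_0, !pow_1 in Ez, Ez'.
    set (l := (RtoC t * u)%C) in *. set (l' := (RtoC t' * u)%C) in *.
    assert (Hl : Cmod l = t) by (unfold l; rewrite Cmod_mul, Cmod_RtoC, Hu, Rabs_pos_eq; lra).
    assert (Hl' : Cmod l' = t') by (unfold l'; rewrite Cmod_mul, Cmod_RtoC, Hu, Rabs_pos_eq; lra).
    assert (Hd : Cmod (l - l')%C = Rabs (t - t')).
    { unfold l, l'. replace (RtoC t * u - RtoC t' * u)%C with (RtoC (t - t') * u)%C.
      - rewrite Cmod_mul, Cmod_RtoC, Hu. ring.
      - apply C_eq; simpl; ring. }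
    assert (Hz' : vnorm z' <= / kap * (s + h) * vnorm x).
    { pose proof (@Hlow l' z' ltac:(lra)) as T. rewrite Ez', vnorm_scal, Hl' in T.
      pose proof (vnorm_ge0 x). rewrite Rmult_assoc. apply inv_mul_le; nra. }
    assert (E : (l * (z - z') - a (z - z'))%V = ((l - l')%C * (x - z'))%V).
    { rewrite bop_add, bop_opp.
      replace (l * (z - z') - (a z - a z'))%V with ((l * z - a z) - (l' * z' - a z') - (l - l')%C * z')%V by vmod.
      rewrite Ez, Ez'. vmod. }
    pose proof (@Hlow l (z - z')%V ltac:(lra)) as T. rewrite E, vnorm_scal, Hd in T.
    pose proof (vnorm_sub_le x z').
    apply Rmult_le_reg_l with kap; [exact Hk|].
    replace (kap * (K * Rabs (t - t') * vnorm x)) with (Rabs (t - t') * (vnorm x + / kap * (s + h) * vnorm x)) by (unfold K; field; lra).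
    eapply Rle_trans; [exact T|]. apply Rmult_le_compat_l; [apply Rabs_pos|]. lra.
  - destruct (unit_sqrt Hu) as [v [Hv Hvv]]. subst u.
    replace (2 ^ S k)%nat with (2 ^ k + 2 ^ k)%nat in * by (simpl; lia).
    set (m := (2 ^ k)%nat) in *. rewrite bpow_add, pow_add in Ez, Ez'.
    assert (Split : forall t z, 0 < t ->
      (RtoC (t ^ m * t ^ m) * (v * v) * z - bpow a m (bpow a m z))%V = (RtoC (t ^ m * t ^ m) * (v * v) * x)%V ->
      let w := (RtoC (t ^ m) * v)%C in
      (RtoC (t ^ m) * v * (z + Cinv w * bpow a m z) - bpow a m (z + Cinv w * bpow a m z))%V
        = (RtoC (t ^ m) * v * x)%V /\
      (RtoC (t ^ m) * (- v) * (z - Cinv w * bpow a m z) - bpow a m (z - Cinv w * bpow a m z))%V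
        = (RtoC (t ^ m) * (- v) * x)%V).
    { clear Ez Ez' z z' Ht Ht' t t' Hu. intros t z Ht E w.
      assert (Hw : w <> C0).
      { apply Cmod_pos_neq. unfold w. rewrite Cmod_mul, Hv, Cmod_RtoC.
        pose proof (pow_lt t m Ht). rewrite Rabs_pos_eq; lra. }
      replace (RtoC (t ^ m * t ^ m) * (v * v))%C with (w * w)%C in E by (unfold w; apply C_eq; simpl; ring).
      replace (RtoC (t ^ m) * - v)%C with (- w)%C by (unfold w; ring).
      change (RtoC (t ^ m) * v)%C with w. clearbody w.
      assert (E2 : bpow a m (bpow a m z) = (w * w * z - w * w * x)%V).
      { rewrite <- E. vmod. }
      autorewrite with lin. rewrite E2. split; vmod_goals; field; exact Hw. }
    destruct (Split t z ltac:(lra) Ez) as [A1 A2]. destruct (Split t' z' ltac:(lra) Ez') as [B1 B2].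
    pose proof (IH t t' v x _ _ Ht Ht' Hv A1 B1) as I1.
    pose proof (IH t t' (- v)%C x _ _ Ht Ht' (eq_trans (Cmod_opp v) Hv) A2 B2) as I2.
    match type of I1 with vnorm ?P <= _ => match type of I2 with vnorm ?Q <= _ =>
      replace (z - z')%V with (RtoC (/ 2) * (P + Q))%V end end.
    + rewrite vnorm_scal, Cmod_RtoC, Rabs_pos_eq by lra.
      match type of I1 with vnorm ?P <= _ => match type of I2 with vnorm ?Q <= _ =>
        pose proof (vnorm_triangle P Q) end end. lra.
    + generalize (Cinv (RtoC (t ^ m) * v)) (Cinv (RtoC (t' ^ m) * v)); intros c c'.
      vmod_goals; apply C_eq; simpl; field.
Qed.

(* Rickart: without approximate eigenvalues near the circle |lam| = s, the Lipschitz bound above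
   (uniform in k) pushes the power bound across the circle *)
Lemma pbound_inside s h kap : 0 < s -> 0 < h -> 0 < kap -> (forall t, s < t -> pbound a t) ->
  (forall lam y, s < Cmod lam <= s + h -> kap * vnorm y <= vnorm (lam * y - a y)%V) ->
  exists s', 0 < s' < s /\ pbound a s'.
Proof.
  intros Hs Hh Hk Hp Hlow. destruct (dyadic_lipschitz Hs Hh Hk Hlow) as [K [HK0 HK]].
  (* With K d <= 1/8, the solutions for two radii at distance at most d differ by at most |x| / 8,
     whatever the dyadic exponent. *)
  set (d := Rmin h (/ 8 / (K + 1))).
  assert (Hd0 : 0 < / 8 / (K + 1)) by (apply Rdiv_lt_0_compat; lra).
  assert (Hd : 0 < d) by (apply Rmin_glb_lt; lra).
  assert (HdK : K * d <= / 8).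
  { apply Rle_trans with ((K + 1) * (/ 8 / (K + 1))).
    - pose proof (Rmin_r h (/ 8 / (K + 1))). fold d in H. apply Rmult_le_compat; lra.
    - right. field. lra. }
  set (t' := s + d).
  assert (Ht' : s < t' <= s + h) by (pose proof (Rmin_l h (/ 8 / (K + 1))); fold d in H; unfold t'; lra).
  destruct (Hp (s + d / 2) ltac:(lra)) as [B [HB0 HB]].
  destruct (@pow_small ((s + d / 2) / t') B (/ 16)) as [N HN]; [apply ratio_lt_1; unfold t'; lra|lra|].
  set (m := (2 ^ N)%nat).
  assert (HmN : (N <= m)%nat) by (apply Nat.lt_le_incl, Nat.pow_gt_lin_r; lia).
  assert (Hm0 : (0 < m)%nat) by (apply Nat.neq_0_lt_0, Nat.pow_nonzero; lia).
  specialize (HN m HmN). unfold Rdiv in HN. rewrite Rpow_mult_distr, pow_inv in HN.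
  assert (Ptm : 0 < t' ^ m) by (apply pow_lt; lra).
  assert (Hsm : forall y, vnorm (bpow a m y) <= / 16 * t' ^ m * vnorm y).
  { intro y. eapply Rle_trans; [apply HB|]. apply Rmult_le_compat_r; [apply vnorm_ge0|].
    apply Rmult_le_reg_r with (/ t' ^ m); [apply Rinv_0_lt_compat, Ptm|].
    replace (/ 16 * t' ^ m * / t' ^ m) with (/ 16) by (field; lra). unfold Rdiv in HN. lra. }
  (* The vector x below is chosen so that y solves the equation at radius t with u = 1. The solution
     z' at radius t' is close to x because a^m is at most t'^m / 16, and close to y by the Lipschitz
     bound. Hence |y - x| <= |y| / 2, and y - x is a^m y / t^m. *)
  assert (Main : forall t y, s < t <= t' -> vnorm (bpow a m y) <= / 2 * t ^ m * vnorm y).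
  { intros t y Ht. assert (Ptm2 : 0 < t ^ m) by (apply pow_lt; lra).
    set (x := (y - RtoC (/ t ^ m) * bpow a m y)%V).
    assert (Surj : exists z', True /\ (RtoC (t' ^ m) * z' - bpow a m z')%V = (RtoC (t' ^ m) * x)%V).
    { apply (@neumann_surj X (bpow a m) (RtoC (t' ^ m))) with (W := fun _ => True) (t := / 16 * t' ^ m); auto.
      - apply Cmod_pos_neq. rewrite Cmod_RtoC, Rabs_pos_eq; lra.
      - apply full_subspace.
      - apply full_closed.
      - apply pbound_norm; [lra|exact Hsm].
      - rewrite Cmod_RtoC, Rabs_pos_eq; lra. }
    destruct Surj as [z' [_ Ez']].
    assert (Hz : vnorm (y - z')%V <= K * Rabs (t - t') * vnorm x).
    { apply (HK N t t' C1 x y z'); try lra.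
      - apply Cmod_1.
      - fold m. unfold x. vmod_goals; apply C_eq; simpl; field; lra.
      - fold m. replace (RtoC (t' ^ m) * C1)%C with (RtoC (t' ^ m)) by ring. exact Ez'. }
    assert (Hz2 : vnorm (z' - x)%V <= / 16 * vnorm z').
    { assert (E : (z' - x)%V = (RtoC (/ t' ^ m) * bpow a m z')%V).
      { replace (bpow a m z') with (RtoC (t' ^ m) * z' - (RtoC (t' ^ m) * z' - bpow a m z'))%V by vmod.
        rewrite Ez'. vmod_goals; apply C_eq; simpl; field; lra. }
      rewrite E, vnorm_scal, Cmod_RtoC, Rabs_pos_eq by (left; apply Rinv_0_lt_compat, Ptm).
      apply Rmult_le_reg_l with (t' ^ m); [exact Ptm|]. specialize (Hsm z').
      rewrite <- Rmult_assoc, Rinv_r by lra. lra. }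
    assert (Hyx : vnorm (y - x)%V = / t ^ m * vnorm (bpow a m y)).
    { unfold x. replace (y - (y - RtoC (/ t ^ m) * bpow a m y))%V with (RtoC (/ t ^ m) * bpow a m y)%V by vmod.
      rewrite vnorm_scal, Cmod_RtoC, Rabs_pos_eq by (left; apply Rinv_0_lt_compat, Ptm2). reflexivity. }
    assert (HKt : K * Rabs (t - t') <= / 8).
    { eapply Rle_trans; [|exact HdK]. apply Rmult_le_compat_l; [exact HK0|]. apply Rabs_le. unfold t' in *. lra. }
    pose proof (vnorm_ge0 x) as Gx. pose proof (vnorm_ge0 y).
    pose proof (vnorm_sub_triangle z' y x) as T1.
    pose proof (vnorm_triangle_sub z' x) as T2. pose proof (vnorm_triangle_sub x y) as T3.
    rewrite (vnorm_sub_sym x y) in T3.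
    assert (Hz1 : vnorm (y - z')%V <= / 8 * vnorm x) by (eapply Rle_trans; [exact Hz|]; apply Rmult_le_compat_r; lra).
    assert (F : vnorm (y - x)%V <= / 2 * vnorm y) by lra.
    rewrite Hyx in F. apply (Rmult_le_compat_l (t ^ m)) in F; [|lra].
    rewrite <- Rmult_assoc, Rinv_r, Rmult_1_l in F by lra. lra. }
  (* Bernoulli gives s'^m >= 3/4 s^m, while t^m / 2 <= 2/3 s^m for t close enough to s; there is
     room to go below s. *)
  set (s' := s * (1 - / (4 * INR m))).
  assert (Hm1 : 1 <= INR m) by (apply (le_INR 1); lia).
  assert (Hi : 0 < / (4 * INR m) <= / 4).
  { split; [apply Rinv_0_lt_compat; lra|]. apply Rinv_le_contravar; lra. }
  exists s'. split; [unfold s'; nra|].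
  apply (@pbound_of_pow X a m s' Hm0); [unfold s'; nra|].
  intro y.
  assert (Hs'm : 3 / 4 * s ^ m <= s' ^ m).
  { unfold s'. rewrite Rpow_mult_distr. pose proof (@bernoulli (/ (4 * INR m)) m ltac:(lra)) as Bn.
    replace (INR m * / (4 * INR m)) with (/ 4) in Bn by (field; lra).
    assert (0 < s ^ m) by (apply pow_lt, Hs). rewrite Rmult_comm. apply Rmult_le_compat_l; lra. }
  (* t > s is close enough to s that t^m <= 4/3 s^m *)
  set (t := Rmin t' (s / (1 - / (4 * INR m)))).
  assert (Hden : 3 / 4 <= 1 - / (4 * INR m) < 1) by lra.
  assert (Hst : s < s / (1 - / (4 * INR m))).
  { apply Rmult_lt_reg_r with (1 - / (4 * INR m)); [lra|]. unfold Rdiv. rewrite Rmult_assoc, Rinv_l; nra. }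
  assert (Ht : s < t <= t') by (unfold t; split; [apply Rmin_glb_lt; lra|apply Rmin_l]).
  eapply Rle_trans; [apply (Main t y Ht)|]. apply Rmult_le_compat_r; [apply vnorm_ge0|].
  assert (Htm : 3 / 4 * t ^ m <= s ^ m).
  { pose proof (@bernoulli (/ (4 * INR m)) m ltac:(lra)) as Bn.
    replace (INR m * / (4 * INR m)) with (/ 4) in Bn by (field; lra).
    assert (Hts : t * (1 - / (4 * INR m)) <= s).
    { apply Rle_trans with (s / (1 - / (4 * INR m)) * (1 - / (4 * INR m))).
      - apply Rmult_le_compat_r; [lra|apply Rmin_r].
      - right. field. split; lra. }
    apply Rle_trans with ((t * (1 - / (4 * INR m))) ^ m).
    - rewrite Rpow_mult_distr. assert (0 < t ^ m) by (apply pow_lt; lra). rewrite (Rmult_comm (3/4)).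
      apply Rmult_le_compat_l; lra.
    - apply pow_incr. split; [apply Rmult_le_pos; lra|exact Hts]. }
  assert (0 < s ^ m) by (apply pow_lt, Hs). lra.
Qed.
End SpectralRadius.

(** * Compact operators *)

Lemma functional_choice (A B : Type) (P : A -> B -> Prop) :
  (forall x, exists y, P x y) -> exists f, forall x, P x (f x).
Proof.
  intro H. exists (fun x => proj1_sig (constructive_indefinite_description _ (H x))).
  intro x. apply proj2_sig.
Qed.

Section Compact.
Variable X : CBanach.
Implicit Types (a b T : bop X) (u : nat -> X).

Definition vbounded u := exists M, forall n, vnorm (u n) <= M.
Definition increasing (phi : nat -> nat) := forall n, (phi n < phi (S n))%nat.

Lemma compact_subseq a u : is_compact a -> vbounded u ->
  exists phi, increasing phi /\ exists l, vlim (fun n => a (u (phi n))) l.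
Proof. intros [_ H] Hu. exact (H u Hu). Qed.

Lemma vbounded_bop T u : vbounded u -> vbounded (fun n => T (u n)).
Proof.
  intros [M HM]. destruct (bop_bounded T) as [N [HN0 HN]]. exists (N * M). intro n.
  eapply Rle_trans; [apply HN|]. apply Rmult_le_compat_l; auto.
Qed.

Lemma vbounded_subseq (phi : nat -> nat) u : vbounded u -> vbounded (fun n => u (phi n)).
Proof. intros [M HM]. exists M. auto. Qed.

Lemma compact_comp_r a T : is_compact a -> is_compact (bcomp a T).
Proof. intros [_ H]. split; [apply bfun_bop|]. intros u Hu. apply (H (fun n => T (u n))), vbounded_bop, Hu. Qed.

Lemma compact_add a b : is_compact a -> is_compact b -> is_compact (badd a b).
Proof.
  intros [_ Ha] [_ Hb]. split; [apply bfun_bop|]. intros u Hu.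
  destruct (Ha u Hu) as [phi [Hp [l Hl]]].
  destruct (Hb (fun n => u (phi n)) (vbounded_subseq phi Hu)) as [psi [Hq [m Hm]]].
  exists (fun n => phi (psi n)). split.
  - intro n. apply (subseq_lt Hp), Hq.
  - exists (l + m)%V. apply (@vlim_add X (fun n => a (u (phi (psi n)))) (fun n => b (u (phi (psi n))))).
    + apply (vlim_subseq (u := fun n => a (u (phi n))) Hq Hl).
    + exact Hm.
Qed.

Lemma compact_zero : is_compact (@bzero X).
Proof.
  split; [apply bfun_bop|]. intros u _. exists (fun n => n). split; [intro; lia|].
  exists vzero. exact (vlim_const (vzero : X)).
Qed.

(** The form in which compactness contradicts the separated sequences built from the Riesz lemma. *)
Lemma compact_not_separated a u d : is_compact a -> vbounded u -> 0 < d ->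
  (forall j k, (j < k)%nat -> d <= vnorm (a (u k) - a (u j))%V) -> False.
Proof.
  intros Ha Hu Hd H. destruct (compact_subseq Ha Hu) as [phi [Hp [l Hl]]].
  destruct (Hl (d / 2)) as [N HN]; [lra|].
  pose proof (HN N (le_n N)). pose proof (HN (S N) (le_S _ _ (le_n N))).
  pose proof (H (phi N) (phi (S N)) (Hp N)).
  pose proof (vnorm_sub_triangle l (a (u (phi (S N)))) (a (u (phi N)))) as T.
  rewrite (vnorm_sub_sym l) in T. lra.
Qed.

Lemma dist_inf (W : X -> Prop) x : W vzero ->
  exists d, 0 <= d /\ (forall w, W w -> d <= vnorm (x - w)%V) /\
    (forall eps, 0 < eps -> exists w, W w /\ vnorm (x - w)%V < d + eps).
Proof.
  intro H0. destruct (completeness (fun r => exists w, W w /\ r = - vnorm (x - w)%V)) as [m [Hm1 Hm2]].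
  - exists 0. intros r [w [_ ->]]. pose proof (vnorm_ge0 (x - w)%V). lra.
  - exists (- vnorm (x - vzero)%V), vzero. auto.
  - exists (- m). split; [|split].
    + assert (m <= 0); [|lra]. apply Hm2. intros r [w [_ ->]]. pose proof (vnorm_ge0 (x - w)%V). lra.
    + intros w Hw. pose proof (Hm1 _ (ex_intro _ w (conj Hw eq_refl))). lra.
    + intros eps He. apply NNPP. intro N. assert (m <= m - eps); [|lra].
      apply Hm2. intros r [w [Hw ->]]. apply Rnot_lt_le. intro L. apply N. exists w. split; [exact Hw|lra].
Qed.

(** Take w with |x - w| below twice the distance d from x to W, and c = 1/d. The explicit shape c (x
    - w) is kept because later arguments need the new vector to be a multiple of x modulo W. *)
Lemma riesz_lemma (W : X -> Prop) x : vsubspace W -> vclosed W -> ~ W x ->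
  exists c w, W w /\ vnorm (c * (x - w))%V <= 2 /\ forall v, W v -> 1 <= vnorm (c * (x - w) - v)%V.
Proof.
  intros HW HC Hx. destruct (@dist_inf W x) as [d [Hd0 [Hd1 Hd2]]]; [apply HW|].
  assert (Hd : 0 < d).
  { destruct Hd0 as [Hd0|Hd0]; [exact Hd0|]. exfalso. apply Hx, HC. intros eps He.
    destruct (Hd2 eps He) as [w Hw]. exists w. rewrite <- Hd0, Rplus_0_l in Hw. exact Hw. }
  destruct (Hd2 d Hd) as [w [Hw Hw2]].
  assert (Hi : 0 < / d) by (apply Rinv_0_lt_compat, Hd).
  exists (RtoC (/ d)), w. split; [exact Hw|]. split.
  - rewrite vnorm_scal, Cmod_RtoC, Rabs_pos_eq by lra.
    apply Rmult_le_reg_l with d; [exact Hd|]. rewrite <- Rmult_assoc, Rinv_r; lra.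
  - intros v Hv. replace (RtoC (/ d) * (x - w) - v)%V with (RtoC (/ d) * (x - (w + RtoC d * v)))%V.
    + rewrite vnorm_scal, Cmod_RtoC, Rabs_pos_eq by lra.
      apply Rmult_le_reg_l with d; [exact Hd|]. rewrite <- Rmult_assoc, Rinv_r by lra.
      rewrite Rmult_1_r, Rmult_1_l. apply Hd1. apply vsub_add; auto. apply vsub_scal; auto.
    + vmod_goals; apply C_eq; simpl; field; lra.
Qed.

Definition ker T (x : X) := T x = vzero.

Lemma ker_subspace T : vsubspace (ker T).
Proof.
  split; unfold ker.
  - apply bop_zero.
  - intros x y Hx Hy. rewrite bop_add, Hx, Hy. apply vadd_0.
  - intros c x Hx. rewrite bop_scal, Hx. apply vscal_vzero.
Qed.

Lemma ker_closed T : vclosed (ker T).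
Proof.
  intros y H. apply vnorm_arb_small. intros eps He. destruct (bop_bounded T) as [M [HM0 HM]].
  destruct (H (eps / (M + 1))) as [x [Hx Hn]]; [apply Rdiv_lt_0_compat; lra|].
  replace (T y) with (T (y - x)%V) by (rewrite bop_add, bop_opp, Hx; vmod).
  pose proof (HM (y - x)%V). pose proof (vnorm_ge0 (y - x)%V).
  apply lt_div_cancel in Hn; [|lra]. nra.
Qed.

Lemma vlim_norm u l r : vlim u l -> Un_cv (fun n => vnorm (u n)) r -> vnorm l = r.
Proof.
  intros Hl Hr. apply cond_eq. intros eps He.
  destruct (Hl (eps / 2)) as [N HN]; [lra|]. destruct (Hr (eps / 2)) as [N' HN']; [lra|].
  specialize (HN (max N N') ltac:(lia)). specialize (HN' (max N N') ltac:(lia)).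
  unfold Rdist in HN'. pose proof (vnorm_triangle_sub l (u (max N N'))) as T1.
  pose proof (vnorm_triangle_sub (u (max N N')) l) as T2. rewrite (vnorm_sub_sym l) in T1.
  apply Rabs_def2 in HN'. apply Rabs_def1; lra.
Qed.

Lemma inv_INR_cv_0 eps : 0 < eps -> exists N, forall n, (N <= n)%nat -> / INR (S n) < eps.
Proof.
  intro He. destruct (INR_unbounded (/ eps)) as [N HN]. exists N. intros n Hn.
  rewrite <- (Rinv_inv eps). apply Rinv_lt_contravar.
  - apply Rmult_lt_0_compat; [apply Rinv_0_lt_compat, He|apply lt_0_INR; lia].
  - eapply Rlt_le_trans; [exact HN|]. apply le_INR. lia.
Qed.

Lemma inv_INR_le_1 n : / INR (S n) <= 1.
Proof. rewrite <- Rinv_1. apply Rinv_le_contravar; [lra|]. apply (le_INR 1). lia. Qed.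

Lemma inv_INR_pos n : 0 < / INR (S n).
Proof. apply Rinv_0_lt_compat, lt_0_INR. lia. Qed.

(** s is the spectral radius, obtained as the infimum of the admissible t; [completeness] provides
    suprema, hence the sign changes. *)
Lemma pbound_threshold a eps : 0 < eps -> ~ pbound a eps ->
  exists s, eps <= s /\ (forall t, s < t -> pbound a t) /\ (forall t, 0 < t < s -> ~ pbound a t).
Proof.
  intros He Hn. destruct (bop_bounded a) as [M [HM0 HM]].
  assert (Hge : forall t, 0 < t -> pbound a t -> eps <= t).
  { intros t Ht Hp. apply Rnot_lt_le. intro L. apply Hn, pbound_mono with t; [lra|exact Hp]. }
  destruct (completeness (fun r => exists t, 0 < t /\ pbound a t /\ r = - t)) as [m [Hm1 Hm2]].
  - exists (- eps). intros r [t [Ht [Hp ->]]]. specialize (Hge t Ht Hp). lra.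
  - exists (- (M + 1)), (M + 1). split; [lra|]. split; [|reflexivity].
    apply pbound_mono with M; [lra|]. apply pbound_norm; assumption.
  - exists (- m). split; [|split].
    + assert (m <= - eps); [|lra]. apply Hm2. intros r [t [Ht [Hp ->]]]. specialize (Hge t Ht Hp). lra.
    + intros t Ht. apply NNPP. intro N. assert (m <= - t); [|lra].
      apply Hm2. intros r [t' [Ht' [Hp ->]]]. apply Ropp_le_contravar, Rnot_lt_le. intro L.
      apply N, pbound_mono with t'; [lra|exact Hp].
    + intros t Ht Hp. pose proof (Hm1 (- t) (ex_intro _ t (conj (proj1 Ht) (conj Hp eq_refl)))). lra.
Qed.

(** At the threshold s the conclusion of [pbound_inside] is impossible, so its lower bound fails for
    every kap: there are unit approximate eigenvectors y_n with |lam_n| decreasing towards s. Along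
    a subsequence a y_n converges, so lam_n y_n has the same limit z, of norm s > 0, and z is an
    exact eigenvector. *)
Lemma peripheral_eigenvalue a eps : is_compact a -> 0 < eps -> ~ pbound a eps ->
  exists mu e, eps <= Cmod mu /\ (forall t, Cmod mu < t -> pbound a t) /\ e <> vzero /\ a e = (mu * e)%V.
Proof.
  intros Ha He Hn. destruct (pbound_threshold He Hn) as [s [Hs [Hs1 Hs2]]].
  assert (Hap : forall n : nat, exists p : C * X, s < Cmod (fst p) <= s + / INR (S n) /\
     vnorm (snd p) = 1 /\ vnorm (fst p * snd p - a (snd p))%V < / INR (S n)).
  { intro n. apply NNPP. intro N. pose proof (inv_INR_pos n) as Hi.
    destruct (@pbound_inside X a s (/ INR (S n)) (/ INR (S n))) as [s' [Hs' Hp]]; auto; try lra.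
    - intros lam y Hl. apply Rnot_lt_le. intro L. apply N.
      assert (Hy : 0 < vnorm y).
      { destruct (vnorm_ge0 y) as [G|G]; [exact G|]. rewrite <- G in L.
        pose proof (vnorm_ge0 (lam * y - a y)%V). lra. }
      assert (Hiy : 0 < / vnorm y) by (apply Rinv_0_lt_compat, Hy).
      exists (lam, RtoC (/ vnorm y) * y)%V. unfold fst, snd. split; [exact Hl|]. split.
      + rewrite vnorm_scal, Cmod_RtoC, Rabs_pos_eq by lra. field. lra.
      + rewrite bop_scal.
        replace (lam * (RtoC (/ vnorm y) * y) - RtoC (/ vnorm y) * a y)%V with (RtoC (/ vnorm y) * (lam * y - a y))%V by vmod.
        rewrite vnorm_scal, Cmod_RtoC, Rabs_pos_eq by lra.
        apply Rmult_lt_reg_l with (vnorm y); [exact Hy|]. rewrite <- Rmult_assoc, Rinv_r by lra.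
        lra.
    - apply (Hs2 s'); [lra|exact Hp]. }
  destruct (functional_choice Hap) as [p Hp].
  set (lam := fun n => fst (p n)). set (y := fun n => snd (p n)).
  assert (Hl : forall n, s < Cmod (lam n) <= s + / INR (S n)) by (intro n; apply Hp).
  assert (Hy : forall n, vnorm (y n) = 1) by (intro n; apply Hp).
  assert (Hly : forall n, vnorm (lam n * y n - a (y n))%V < / INR (S n)) by (intro n; apply Hp).
  clearbody lam y. clear p Hp.
  destruct (@compact_subseq a y) as [phi [Hphi [z Hz]]]; [exact Ha|exists 1; intro; rewrite Hy; lra|].
  assert (Hz1 : vlim (fun n => lam (phi n) * y (phi n))%V z).
  { intros ep Hep. destruct (Hz (ep / 2)) as [N HN]; [lra|].
    destruct (@inv_INR_cv_0 (ep / 2)) as [N' HN']; [lra|].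
    exists (max N N'). intros n Hn'. specialize (HN n ltac:(lia)). pose proof (subseq_ge Hphi n).
    specialize (HN' (phi n) ltac:(lia)). specialize (Hly (phi n)).
    pose proof (vnorm_sub_triangle (a (y (phi n))) (lam (phi n) * y (phi n))%V z). lra. }
  assert (Hcv : Un_cv (fun n => Cmod (lam (phi n))) s).
  { intros ep Hep. destruct (@inv_INR_cv_0 ep) as [N HN]; [lra|]. exists N. intros n Hn'.
    pose proof (subseq_ge Hphi n). specialize (HN (phi n) ltac:(lia)). specialize (Hl (phi n)).
    unfold Rdist. rewrite Rabs_pos_eq; lra. }
  assert (Hzs : vnorm z = s).
  { apply (vlim_norm Hz1). intros ep Hep. destruct (Hcv ep Hep) as [N HN]. exists N. intros n Hn'.
    rewrite vnorm_scal, Hy, Rmult_1_r. apply HN, Hn'. }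
  assert (Hz0 : z <> vzero) by (intro E; rewrite E, vnorm_0 in Hzs; lra).
  (* Since lam_n y_n -> z, lam_n a y_n -> a z; since also a y_n -> z with lam_n bounded, lam_n z ->
     a z. Then [vlim_line] makes the scalars converge. *)
  assert (Haz : vlim (fun n => lam (phi n) * z)%V (a z)).
  { pose proof (bop_vlim a Hz1) as H1. intros ep Hep. destruct (H1 (ep / 2)) as [N HN]; [lra|].
    destruct (Hz (ep / 2 / (s + 1))) as [N' HN']; [apply Rdiv_lt_0_compat; lra|].
    destruct (Hcv 1) as [N2 HN2]; [lra|].
    exists (max N (max N' N2)). intros n Hn'. specialize (HN n ltac:(lia)). specialize (HN' n ltac:(lia)).
    specialize (HN2 n ltac:(lia)). unfold Rdist in HN2. apply Rabs_def2 in HN2.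
    rewrite bop_scal in HN.
    pose proof (vnorm_sub_triangle (lam (phi n) * a (y (phi n)))%V (lam (phi n) * z)%V (a z)) as T.
    replace (lam (phi n) * z - lam (phi n) * a (y (phi n)))%V with (lam (phi n) * (z - a (y (phi n))))%V in T by vmod.
    rewrite vnorm_scal, (vnorm_sub_sym z) in T.
    pose proof (vnorm_ge0 (a (y (phi n)) - z)%V).
    apply lt_div_cancel in HN'; [|lra]. nra. }
  destruct (vlim_line Hz0 Haz) as [mu [Hmu Ez]].
  exists mu, z.
  assert (Hmus : Cmod mu = s).
  { apply Rmult_eq_reg_r with (vnorm z); [|lra]. rewrite <- vnorm_scal, <- Ez.
    apply (vlim_norm Haz). intros ep Hep. destruct (Hcv (ep / (vnorm z))) as [N HN]; [apply Rdiv_lt_0_compat; lra|].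
    exists N. intros n Hn'. specialize (HN n Hn'). rewrite vnorm_scal. unfold Rdist in *.
    replace (Cmod (lam (phi n)) * vnorm z - s * vnorm z) with ((Cmod (lam (phi n)) - s) * vnorm z) by ring.
    rewrite Rabs_mult, (Rabs_pos_eq (vnorm z)) by lra.
    apply lt_div_cancel in HN; lra. }
  rewrite Hmus. auto.
Qed.
End Compact.

(** * Riesz projections *)

Definition shift (X : CBanach) (mu : C) (a : bop X) : bop X := bsub (bscal mu bid) a.
Lemma shift_app (X : CBanach) mu (a : bop X) x : shift mu a x = (mu * x - a x)%V.
Proof. unfold shift. autorewrite with lin. reflexivity. Qed.
#[export] Hint Rewrite shift_app : lin.

Lemma commutes_shift (X : CBanach) mu (S a : bop X) : commutes S a -> commutes S (shift mu a).
Proof. unfold shift. auto with comm. Qed.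
#[export] Hint Resolve commutes_shift : comm.

(** Uniformity in |h| <= 1 is what [range_plus_ker] needs to compare (mu - a)^k with powers of
    nearby surjective operators. *)
Lemma shift_pow_perturb (X : CBanach) (a : bop X) mu k : exists K, 0 <= K /\ forall h x, Cmod h <= 1 ->
  vnorm (bpow (shift (mu + h)%C a) k x - bpow (shift mu a) k x)%V <= Cmod h * K * vnorm x.
Proof.
  set (S1 := shift mu a).
  destruct (bop_bounded S1) as [M [HM0 HM]].
  induction k as [|j [K [HK0 HK]]].
  - exists 0. split; [lra|]. intros h x Hh. simpl. rewrite vadd_opp, vnorm_0. lra.
  - exists ((M + 1) * K + M ^ j). pose proof (pow_le M j HM0). split; [nra|].
    intros h x Hh. rewrite !bpow_S. specialize (HK h x Hh).
    pose proof (pow_norm_le HM0 HM j x) as Q.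
    set (p := bpow (shift (mu + h)%C a) j x) in *. set (q := bpow S1 j x) in *.
    replace (shift (mu + h)%C a p - S1 q)%V with (S1 (p - q) + h * (p - q) + h * q)%V
      by (unfold S1; autorewrite with lin; vmod).
    pose proof (vnorm_triangle (S1 (p - q) + h * (p - q))%V (h * q)%V) as T1.
    pose proof (vnorm_triangle (S1 (p - q))%V (h * (p - q))%V) as T2.
    rewrite !vnorm_scal in T1, T2. specialize (HM (p - q)%V).
    pose proof (Cmod_ge0 h). pose proof (vnorm_ge0 (p - q)%V). pose proof (vnorm_ge0 x).
    assert (Cmod h * vnorm (p - q)%V <= vnorm (p - q)%V) by nra.
    assert ((M + 1) * vnorm (p - q)%V <= (M + 1) * (Cmod h * K * vnorm x)) by (apply Rmult_le_compat_l; lra).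
    assert (Cmod h * vnorm q <= Cmod h * (M ^ j * vnorm x)) by (apply Rmult_le_compat_l; lra).
    lra.
Qed.

Section RieszProjection.
Variable X : CBanach.
Variable a : bop X.
Variable mu : C.
Hypothesis Ha : is_compact a.
Hypothesis Hmu : mu <> C0.

Let S1 := shift mu a.

(** If the kernels of S1^k grew strictly forever, the Riesz lemma would give bounded u_k in the
    (k+1)-st kernel at distance at least 1 from the k-th. For j < k, a u_k - a u_j is mu times u_k
    minus an element of the k-th kernel, hence of norm at least |mu|. *)
Lemma finite_ascent : exists k, forall x, bpow S1 (S k) x = vzero -> bpow S1 k x = vzero.
Proof.
  apply NNPP. intro N.
  assert (Hk : forall k, exists x, ker (bpow S1 (S k)) x /\ vnorm x <= 2 /\ forall v, ker (bpow S1 k) v -> 1 <= vnorm (x - v)%V).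
  { intro k. apply NNPP. intro N2. apply N. exists k. intros x Hx. apply NNPP. intro Nx.
    destruct (riesz_lemma (ker_subspace (bpow S1 k)) (@ker_closed _ (bpow S1 k)) Nx) as [c [w [Hw [H2 H1]]]].
    apply N2. exists (c * (x - w))%V. split; [|split; assumption].
    unfold ker in *. rewrite bop_scal, bop_add, bop_opp, Hx. rewrite (bpow_S S1 k w), Hw, bop_zero. vmod. }
  destruct (functional_choice Hk) as [u Hu]. clear N Hk.
  assert (Up : forall j k x, (j <= k)%nat -> ker (bpow S1 j) x -> ker (bpow S1 k) x).
  { intros j k x L Hx. unfold ker in *. replace k with ((k - j) + j)%nat by lia. rewrite bpow_add, Hx, bop_zero. reflexivity. }
  apply (@compact_not_separated X a u (Cmod mu) Ha).
  - exists 2. intro n. apply Hu.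
  - apply Cmod_gt0, Hmu.
  - intros j k L.
    set (v := (S1 (u k) + mu * u j - S1 (u j))%V).
    assert (Hv : ker (bpow S1 k) v).
    { unfold v, ker. rewrite !bop_add, bop_opp, <- !bpow_Sr, bop_scal.
      destruct (Hu k) as [Hk _]. destruct (Hu j) as [Hj _]. unfold ker in Hk. rewrite Hk.
      pose proof (Up (S j) k (u j) L Hj) as E1. unfold ker in E1. rewrite bpow_S, E1, bop_zero. vmod. }
    replace (a (u k) - a (u j))%V with (mu * (u k - Cinv mu * v))%V.
    + rewrite vnorm_scal. destruct (Hu k) as [_ [_ H1]].
      specialize (H1 (Cinv mu * v)%V (vsub_scal (ker_subspace _) _ Hv)).
      pose proof (Cmod_ge0 mu). nra.
    + unfold v, S1. autorewrite with lin. vmod_goals; field; exact Hmu.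
Qed.

(** The polynomial g in a with (mu - a)^k = mu^k - a g: powers of mu - a are again a nonzero scalar
    minus a compact operator. *)
Fixpoint gpow (k : nat) : bop X :=
  match k with
  | O => bzero
  | S k => badd (bscal (Cpow mu k) bid) (bcomp S1 (gpow k))
  end.

Lemma commutes_gpow c k : commutes c a -> commutes c (gpow k).
Proof.
  intro H. induction k; simpl.
  - intro x. rewrite !bzero_app, bop_zero. reflexivity.
  - apply commutes_badd; [auto with comm|]. apply commutes_bcomp; [|exact IHk].
    apply commutes_shift, H.
Qed.

Lemma gpow_spec k x : bpow S1 k x = (Cpow mu k * x - a (gpow k x))%V.
Proof.
  induction k as [|k IH].
  - simpl. rewrite bop_zero. vmod.
  - rewrite bpow_S, IH. simpl gpow. simpl Cpow. unfold S1. autorewrite with lin. vmod.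
Qed.

Variable k : nat.
Hypothesis Hk : forall x, bpow S1 (S k) x = vzero -> bpow S1 k x = vzero.

Let A := bpow S1 k.
Let b := bcomp a (gpow k).
Let muk := Cpow mu k.
Let N := ker A.

Let Hmuk : muk <> C0.
Proof. apply Cpow_neq0, Hmu. Qed.

Let Aspec x : A x = (muk * x - b x)%V.
Proof. apply gpow_spec. Qed.

Let Hb : is_compact b.
Proof. apply compact_comp_r, Ha. Qed.

Let Nsub : vsubspace N.
Proof. apply ker_subspace. Qed.

Lemma ascent_stable j x : bpow S1 (j + k) x = vzero -> bpow S1 k x = vzero.
Proof.
  induction j as [|j IH]; [auto|]. intro H. apply IH.
  destruct j as [|j]; [apply Hk, H|].
  clear IH. revert H.
  replace (S (S j) + k)%nat with (S k + S j)%nat by lia.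
  replace (S j + k)%nat with (k + S j)%nat by lia.
  rewrite !(bpow_add _ _ (S j)). apply Hk.
Qed.

Lemma ker_ker x : N (A x) -> N x.
Proof. intro H. unfold N, ker, A in *. rewrite <- bpow_add in H. apply (ascent_stable H). Qed.

(** A = mu^k - b with b compact. On N this reads n_j = b n_j / mu^k, so the n_j converge along a
    subsequence; then so do the y_j = (A y_j + b y_j) / mu^k, because A y_j - n_j converges. *)
Lemma limit_mod_ker y n x : vbounded y -> vbounded n -> (forall j, N (n j)) ->
  vlim (fun j => A (y j) - n j)%V x ->
  exists phi y0 n0, increasing phi /\ N n0 /\ vlim (fun j => y (phi j)) y0 /\ A y0 = (x + n0)%V.
Proof.
  intros By Bn Hn Hlim.
  destruct (compact_subseq Hb By) as [phi [Hphi [p Hp]]].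
  destruct (compact_subseq Hb (vbounded_subseq phi Bn)) as [psi [Hpsi [q Hq]]].
  set (th := fun j => phi (psi j)).
  assert (Hth : increasing th) by (intro j; apply (subseq_lt Hphi), Hpsi).
  assert (Lp : vlim (fun j => b (y (th j))) p) by (apply (vlim_subseq (u := fun j => b (y (phi j))) Hpsi Hp)).
  assert (Ln : vlim (fun j => n (th j)) (Cinv muk * q)%V).
  { refine (vlim_ext _ (vlim_scal (Cinv muk) Hq)). intro j. cbv beta.
    pose proof (Hn (phi (psi j))) as H. unfold N, ker in H. rewrite Aspec in H. apply vsub_eq0 in H.
    rewrite <- H. unfold th. vmod_goals; field; exact Hmuk. }
  set (n0 := (Cinv muk * q)%V) in *.
  assert (Ly : vlim (fun j => y (th j)) (Cinv muk * ((x + n0) + p))%V).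
  { refine (vlim_ext _ (vlim_scal (Cinv muk) (vlim_add (vlim_add (vlim_subseq Hth Hlim) Ln) Lp))).
    intro j. cbv beta. rewrite Aspec. vmod_goals; field; exact Hmuk. }
  exists th, (Cinv muk * ((x + n0) + p))%V, n0. split; [exact Hth|]. split; [|split; [exact Ly|]].
  - apply (vclosed_lim (@ker_closed _ A) (fun j => Hn (th j)) Ln).
  - apply (vlim_unique (bop_vlim A Ly)).
    refine (vlim_ext _ (vlim_add (vlim_subseq Hth Hlim) Ln)). intro j. cbv beta. vmod.
Qed.

(** Says without quotients that A is bounded below on X / N. Otherwise there are bounded y_j at
    distance at least 1 from N with A y_j - n_j -> 0; a limit point y0 has A y0 in N, hence lies in
    N by [ker_ker], a contradiction. *)
Lemma bounded_below_mod_ker : exists kap, 0 < kap /\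
  forall x n, N n -> exists n', N n' /\ kap * vnorm (x - n')%V <= vnorm (A x - n)%V.
Proof.
  apply NNPP. intro C.
  assert (H : forall j : nat, exists p : X * X, N (snd p) /\
    vnorm (A (fst p) - snd p)%V <= 2 * / INR (S j) /\ vnorm (fst p) <= 2 /\
    forall v, N v -> 1 <= vnorm (fst p - v)%V).
  { intro j. apply NNPP. intro C2. apply C. pose proof (inv_INR_pos j) as Hj.
    exists (/ INR (S j)). split; [exact Hj|]. intros x n Hn. apply NNPP. intro C3. apply C2.
    assert (Hx : ~ N x).
    { intro Hx. apply C3. exists x. split; [exact Hx|]. rewrite vadd_opp, vnorm_0.
      pose proof (vnorm_ge0 (A x - n)%V). lra. }
    destruct (riesz_lemma Nsub (@ker_closed _ A) Hx) as [c [w [Hw [H2 H1]]]].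
    exists (c * (x - w), c * n)%V. unfold fst, snd. split; [apply vsub_scal; auto|]. split; [|split; assumption].
    replace (A (c * (x - w)) - c * n)%V with (c * (A x - n))%V.
    - rewrite vnorm_scal. rewrite vnorm_scal in H2.
      assert (L : vnorm (A x - n)%V <= / INR (S j) * vnorm (x - w)%V).
      { apply Rnot_lt_le. intro L. apply C3. exists w. split; [exact Hw|lra]. }
      pose proof (Cmod_ge0 c). apply Rle_trans with (Cmod c * (/ INR (S j) * vnorm (x - w)%V)).
      + apply Rmult_le_compat_l; assumption.
      + replace (Cmod c * (/ INR (S j) * vnorm (x - w)%V)) with (/ INR (S j) * (Cmod c * vnorm (x - w)%V)) by ring.
        rewrite (Rmult_comm 2). apply Rmult_le_compat_l; lra.
    - unfold N, ker in Hw. rewrite bop_scal, bop_add, bop_opp, Hw. vmod. }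
  destruct (functional_choice H) as [p Hp]. clear H C.
  set (y := fun j => fst (p j)). set (n := fun j => snd (p j)).
  assert (Hn : forall j, N (n j)) by (intro; apply Hp).
  assert (Hs : forall j, vnorm (A (y j) - n j)%V <= 2 * / INR (S j)) by (intro; apply Hp).
  assert (Hy : forall j, vnorm (y j) <= 2) by (intro; apply Hp).
  assert (Hd : forall j v, N v -> 1 <= vnorm (y j - v)%V) by (intro; apply Hp).
  clearbody y n. clear p Hp.
  assert (By : vbounded y) by (exists 2; exact Hy).
  assert (Bn : vbounded n).
  { destruct (vbounded_bop A By) as [M HM]. exists (M + 2). intro j. specialize (Hs j). specialize (HM j).
    pose proof (inv_INR_le_1 j).
    pose proof (vnorm_triangle_sub (n j) (A (y j))) as T. rewrite vnorm_sub_sym in T. lra. }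
  assert (Hlim : vlim (fun j => A (y j) - n j)%V vzero).
  { intros ep Hep. destruct (@inv_INR_cv_0 (ep / 2)) as [M HM]; [lra|]. exists M. intros j Hj.
    specialize (HM j Hj). specialize (Hs j). replace (A (y j) - n j - vzero)%V with (A (y j) - n j)%V by vmod. lra. }
  destruct (limit_mod_ker By Bn Hn Hlim) as [phi [y0 [n0 [Hphi [Hn0 [Ly Ay]]]]]].
  assert (Hy0 : N y0).
  { apply ker_ker. rewrite Ay. apply vsub_add; auto. apply Nsub. }
  destruct (Ly 1) as [M HM]; [lra|]. specialize (HM M (le_n M)). specialize (Hd (phi M) y0 Hy0). lra.
Qed.

Hypothesis Hsurj : forall z y, Cmod mu < Cmod z -> exists x, shift z a x = y.

Lemma shift_pow_surj z j y : Cmod mu < Cmod z -> exists x, bpow (shift z a) j x = y.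
Proof.
  intro Hz. revert y. induction j as [|j IH]; intro y; [exists y; reflexivity|].
  destruct (Hsurj y Hz) as [x Hx]. destruct (IH x) as [x' Hx']. exists x'. rewrite bpow_S, Hx'. exact Hx.
Qed.

(** A Fredholm alternative by perturbation: (mu + h - a)^k is onto when |mu + h| > |mu|. Solutions
    for h -> 0, corrected by elements of N, stay bounded because A is bounded below modulo N, and
    [limit_mod_ker] extracts a solution for A. *)
Lemma range_plus_ker x : exists n y, N n /\ x = (n + A y)%V.
Proof.
  destruct bounded_below_mod_ker as [kap [Hkap HB]].
  destruct (shift_pow_perturb a mu k) as [K [HK0 HK]].
  (* h j points radially outwards from mu and has modulus 1/(j+1). *)
  set (h := fun j : nat => (RtoC (/ INR (S j) * / Cmod mu) * mu)%C).
  assert (Gmu : 0 < Cmod mu) by (apply Cmod_gt0, Hmu).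
  assert (Gi : 0 < / Cmod mu) by (apply Rinv_0_lt_compat, Gmu).
  assert (Hh : forall j, Cmod (h j) = / INR (S j)).
  { intro j. unfold h. pose proof (inv_INR_pos j). rewrite Cmod_mul, Cmod_RtoC, Rabs_pos_eq by nra.
    rewrite Rmult_assoc, Rinv_l; lra. }
  assert (Hz : forall j, Cmod mu < Cmod (mu + h j)%C).
  { intro j. pose proof (inv_INR_pos j) as Hj.
    replace (mu + h j)%C with (RtoC (1 + / INR (S j) * / Cmod mu) * mu)%C by (unfold h; apply C_eq; simpl; ring).
    rewrite Cmod_mul, Cmod_RtoC. assert (0 < / INR (S j) * / Cmod mu) by nra. rewrite Rabs_pos_eq by lra. nra. }
  assert (Hh1 : forall j, Cmod (h j) <= 1).
  { intro j. rewrite Hh. apply inv_INR_le_1. }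
  set (D := fun j => bpow (shift (mu + h j)%C a) k).
  assert (DN : forall j w, N w -> N (D j w)).
  { intros j w Hw. unfold N, ker in *. rewrite <- (bop_zero (D j)), <- Hw.
    apply commutes_sym. unfold A, D, S1. apply commutes_pow, commutes_sym, commutes_pow, commutes_shift, commutes_sym, commutes_shift, commutes_refl. }
  assert (HD : forall j y, vnorm (D j y - A y)%V <= / INR (S j) * K * vnorm y).
  { intros j y. rewrite <- Hh. apply HK, Hh1. }
  destruct (@inv_INR_cv_0 (kap / 2 / (K + 1))) as [J HJ]; [repeat apply Rdiv_lt_0_compat; lra|].
  assert (HJK : forall j, (J <= j)%nat -> / INR (S j) * K <= kap / 2).
  { intros j Hj. specialize (HJ j Hj). apply lt_div_cancel in HJ; [|lra].
    pose proof (inv_INR_pos j). nra. }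
  (* The quotient term bounds y modulo N; the extra 1 is the slack with which n0 realizes the
     distance from y to N. *)
  set (B := (vnorm x + kap / 2) / (kap / 2) + 1).
  assert (Hy : forall j, exists y, vnorm y <= B /\ exists n, N n /\ D (j + J)%nat y = (x + n)%V).
  { intro j. destruct (shift_pow_surj k x (Hz (j + J)%nat)) as [y Ey].
    fold (D (j + J)%nat) in Ey.
    destruct (@dist_inf X N y) as [d [Hd0 [Hd1 Hd2]]]; [apply Nsub|].
    destruct (Hd2 1) as [n0 [Hn0 Hn0d]]; [lra|].
    exists (y - n0)%V.
    assert (ED : D (j + J)%nat (y - n0)%V = (x - D (j + J)%nat n0)%V) by (rewrite bop_add, bop_opp, Ey; reflexivity).
    split; [|exists (- D (j + J)%nat n0)%V; split; [apply vsub_opp; auto|exact ED]].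
    destruct (HB y (- D (j + J)%nat n0)%V) as [n' [Hn' Hle]]; [apply vsub_opp; auto|].
    specialize (Hd1 n' Hn').
    assert (EA : (A y - - D (j + J)%nat n0)%V = (x - (D (j + J)%nat (y - n0) - A (y - n0)))%V).
    { rewrite ED, !bop_add, !bop_opp. unfold N, ker in Hn0. rewrite Hn0. vmod. }
    rewrite EA in Hle. pose proof (vnorm_sub_le x (D (j + J)%nat (y - n0) - A (y - n0))%V) as T.
    pose proof (HD (j + J)%nat (y - n0)%V) as T2. specialize (HJK (j + J)%nat ltac:(lia)).
    pose proof (vnorm_ge0 (y - n0)%V). pose proof (vnorm_ge0 (y - n')%V).
    assert (T3 : / INR (S (j + J)) * K * vnorm (y - n0)%V <= kap / 2 * vnorm (y - n0)%V) by (apply Rmult_le_compat_r; lra).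
    assert (T4 : kap / 2 * vnorm (y - n0)%V <= kap / 2 * (vnorm (y - n')%V + 1)) by (apply Rmult_le_compat_l; lra).
    assert (T5 : kap / 2 * vnorm (y - n')%V <= vnorm x + kap / 2) by lra.
    assert (T6 : vnorm (y - n')%V <= (vnorm x + kap / 2) / (kap / 2)).
    { apply Rmult_le_reg_l with (kap / 2); [lra|]. eapply Rle_trans; [exact T5|]. right. field. lra. }
    unfold B. lra. }
  destruct (functional_choice Hy) as [y Hy']. clear Hy.
  assert (By : vbounded y) by (exists B; apply Hy').
  assert (Hn : forall j, exists n, N n /\ D (j + J)%nat (y j) = (x + n)%V) by apply Hy'.
  destruct (functional_choice Hn) as [n Hn']. clear Hn.
  assert (Hdiff : forall j, vnorm (A (y j) - n j - x)%V <= / INR (S (j + J)) * K * B).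
  { intro j. destruct (Hn' j) as [_ E].
    replace (A (y j) - n j - x)%V with (- (D (j + J)%nat (y j) - A (y j)))%V by (rewrite E; vmod).
    rewrite vnorm_opp. eapply Rle_trans; [apply HD|]. apply Rmult_le_compat_l; [|apply Hy'].
    pose proof (inv_INR_pos (j + J)). nra. }
  assert (B0 : 0 <= B) by (pose proof (vnorm_ge0 (y O)); pose proof (proj1 (Hy' O)); lra).
  assert (Hlim : vlim (fun j => A (y j) - n j)%V x).
  { intros ep Hep. destruct (@inv_INR_cv_0 (ep / (K * B + 1))) as [M HM].
    - apply Rdiv_lt_0_compat; [lra|]. nra.
    - exists M. intros j Hj. eapply Rle_lt_trans; [apply Hdiff|].
      specialize (HM (j + J)%nat ltac:(lia)). pose proof (inv_INR_pos (j + J)).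
      assert (0 <= K * B) by nra.
      apply lt_div_cancel in HM; [|lra]. nra. }
  assert (Bn : vbounded n).
  { destruct (vbounded_bop A By) as [M HM]. exists (M + vnorm x + K * B). intro j.
    specialize (Hdiff j). specialize (HM j).
    pose proof (inv_INR_le_1 (j + J)).
    assert (/ INR (S (j + J)) * K * B <= K * B) by (assert (0 <= K * B) by nra; nra).
    replace (n j) with (A (y j) - x - (A (y j) - n j - x))%V by vmod.
    pose proof (vnorm_sub_le (A (y j) - x)%V (A (y j) - n j - x)%V).
    pose proof (vnorm_sub_le (A (y j)) x). lra. }
  destruct (limit_mod_ker By Bn (fun j => proj1 (Hn' j)) Hlim) as [phi [y0 [n0 [_ [Hn0 [_ Ay]]]]]].
  exists (- n0)%V, y0. split; [apply vsub_opp; auto|]. rewrite Ay. vmod.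
Qed.

Lemma range_plus_ker_unique n y n' y' : N n -> N n' -> (n + A y)%V = (n' + A y')%V -> n = n'.
Proof.
  intros Hn Hn' E. apply vsub_eq0.
  assert (E2 : (n - n')%V = A (y' - y)%V).
  { rewrite bop_add, bop_opp. replace n with ((n + A y) - A y)%V by vmod. rewrite E. vmod. }
  rewrite E2. change (N (y' - y)%V). apply ker_ker. rewrite <- E2. apply vsub_sub; auto.
Qed.

(** P is the projection onto N along the range of A; uniqueness of the decomposition gives linearity
    and commutation. On N one has mu^k = a [gpow], so P = a g P with g = [gpow] / mu^k. This last
    identity later provides both compactness of P and its orthogonality to whatever a
    annihilates. *)
Lemma riesz_projection_ex : exists P : bop X,
  (forall x, A (P x) = vzero) /\ (forall n, A n = vzero -> P n = n) /\
  (forall c, commutes c a -> commutes c P) /\ exists g, commutes g a /\ forall x, P x = a (g (P x)).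
Proof.
  destruct (functional_choice range_plus_ker) as [P HP].
  assert (HN : forall x, N (P x)) by (intro x; destruct (HP x) as [y [H _]]; exact H).
  assert (HE : forall x, exists y, x = (P x + A y)%V) by (intro x; destruct (HP x) as [y [_ H]]; exists y; exact H).
  clear HP.
  assert (Uniq : forall x n y, N n -> x = (n + A y)%V -> P x = n).
  { intros x n y Hn E. destruct (HE x) as [y' E']. apply (@range_plus_ker_unique (P x) y' n y); auto. congruence. }
  assert (HL : is_linear P).
  { split.
    - intros x y. destruct (HE x) as [x' Ex]. destruct (HE y) as [y' Ey].
      apply Uniq with (x' + y')%V; [apply vsub_add; auto|]. rewrite Ex at 1. rewrite Ey at 1. rewrite bop_add. vmod.
    - intros c x. destruct (HE x) as [x' Ex]. apply Uniq with (c * x')%V; [apply vsub_scal; auto|].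
      rewrite Ex at 1. rewrite bop_scal. vmod. }
  assert (HBd : is_bounded P).
  { destruct bounded_below_mod_ker as [kap [Hkap HB]]. destruct (bop_bounded A) as [M [HM0 HM]].
    exists (1 + M * / kap). intro x. destruct (HE x) as [y Ey].
    destruct (HB y (- P x)%V) as [n' [Hn' Hle]]; [apply vsub_opp; auto|].
    replace (A y - - P x)%V with x in Hle by (rewrite Ey at 1; vmod).
    assert (EA : A y = A (y - n')%V) by (unfold N, ker in Hn'; rewrite bop_add, bop_opp, Hn'; vmod).
    assert (EP : P x = (x - A (y - n'))%V) by (rewrite <- EA; rewrite Ey at 2; vmod).
    rewrite EP. pose proof (vnorm_sub_le x (A (y - n'))%V). specialize (HM (y - n')%V).
    assert (vnorm (y - n')%V <= / kap * vnorm x) by (apply inv_mul_le; assumption).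
    nra. }
  exists (mkBop (conj HL HBd)). simpl. split; [exact HN|]. split; [|split].
  - intros n Hn. apply Uniq with vzero; [exact Hn|]. rewrite bop_zero. vmod.
  - intros c Hc x. simpl. destruct (HE x) as [y Ey]. symmetry.
    assert (CA : commutes c A) by (unfold A, S1; auto with comm).
    apply Uniq with (c y).
    + unfold N, ker. rewrite <- (CA (P x)). pose proof (HN x) as Hx. unfold N, ker in Hx. rewrite Hx. apply bop_zero.
    + rewrite Ey at 1. rewrite bop_add, CA. reflexivity.
  - exists (bscal (Cinv muk) (gpow k)). split.
    + apply commutes_sym, commutes_bscal, commutes_gpow, commutes_refl.
    + intro x. rewrite bscal_app, bop_scal. pose proof (HN x) as Hx. unfold N, ker in Hx.
      rewrite Aspec in Hx. apply vsub_eq0 in Hx. unfold b in Hx. rewrite bcomp_app in Hx. rewrite <- Hx.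
      vmod_goals; field; exact Hmuk.
Qed.
End RieszProjection.

Lemma compact_pbound_surj (X : CBanach) (a : bop X) mu : (forall t, Cmod mu < t -> pbound a t) ->
  forall z y, Cmod mu < Cmod z -> exists x, shift z a x = y.
Proof.
  intros H z y Hz. pose proof (Cmod_ge0 mu).
  destruct (@neumann_surj X a z) with (W := fun _ : X => True) (t := (Cmod mu + Cmod z) / 2) (y := y) as [x [_ E]]; auto.
  - apply Cmod_pos_neq. lra.
  - apply full_subspace.
  - apply full_closed.
  - apply H. lra.
  - lra.
  - exists x. rewrite shift_app. exact E.
Qed.

(** * Finite dimensional spans and finite rank projections *)

Section FiniteRank.
Variable X : CBanach.

Definition span (l : list X) (x : X) : Prop := exists cs, length cs = length l /\ x = lincomb cs l.

Lemma span_cons v l x : span (v :: l) x <-> exists c y, span l y /\ x = (c * v + y)%V.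
Proof.
  split.
  - intros [cs [Hl ->]]. destruct cs as [|c cs]; [discriminate|]. injection Hl as Hl.
    exists c, (lincomb cs l). split; [exists cs; auto|]. reflexivity.
  - intros [c [y [[cs [Hl ->]] ->]]]. exists (c :: cs). simpl. split; [congruence|reflexivity].
Qed.

Lemma span_nil x : span nil x <-> x = vzero.
Proof.
  split.
  - intros [cs [Hl ->]]. destruct cs; [reflexivity|discriminate].
  - intros ->. exists nil. auto.
Qed.

Lemma span_subspace l : vsubspace (span l).
Proof.
  induction l as [|v l IH].
  - split; [apply span_nil; reflexivity| |]; intros; rewrite span_nil in *; subst; [apply vadd_0|apply vscal_vzero].
  - split.
    + apply span_cons. exists C0, vzero. split; [apply IH|vmod].
    + intros x y Hx Hy. rewrite span_cons in *. destruct Hx as [c [x' [Hx ->]]]. destruct Hy as [d [y' [Hy ->]]].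
      exists (c + d)%C, (x' + y')%V. split; [apply vsub_add; auto|vmod].
    + intros c x Hx. rewrite span_cons in *. destruct Hx as [d [x' [Hx ->]]].
      exists (c * d)%C, (c * x')%V. split; [apply vsub_scal; auto|vmod].
Qed.

Lemma span_incl_cons v l x : span l x -> span (v :: l) x.
Proof. intro H. apply span_cons. exists C0, x. split; [exact H|vmod]. Qed.
Lemma span_head v l : span (v :: l) v.
Proof. apply span_cons. exists C1, vzero. split; [apply span_subspace|vmod]. Qed.

(** By induction: if v is outside the closed span of l, the Riesz lemma bounds |c| by a constant
    times |c v + y| for y in that span. The coefficients of v in an approximating sequence are
    therefore Cauchy, and what remains converges inside the span of l. *)
Lemma span_closed l : vclosed (span l).
Proof.
  induction l as [|v l IH].
  - intros y H. apply span_nil. apply vnorm_arb_small. intros eps He. destruct (H eps He) as [x [Hx Hn]].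
    rewrite span_nil in Hx. subst. replace (y - vzero)%V with y in Hn by vmod. exact Hn.
  - destruct (classic (span l v)) as [Hv|Hv].
    + assert (E : forall x, span (v :: l) x -> span l x).
      { intros x Hx. rewrite span_cons in Hx. destruct Hx as [c [y [Hy ->]]].
        apply vsub_add; [apply span_subspace|apply vsub_scal; [apply span_subspace|exact Hv]|exact Hy]. }
      intros y H. apply span_incl_cons, IH. intros eps He. destruct (H eps He) as [x [Hx Hn]]. exists x. auto.
    + destruct (riesz_lemma (span_subspace l) IH Hv) as [c0 [w [Hw [_ Hd]]]].
      assert (Hc0 : c0 <> C0).
      { intros ->. specialize (Hd vzero (vsub_0 (span_subspace l))).
        replace (C0 * (v - w) - vzero)%V with (vzero : X) in Hd by vmod. rewrite vnorm_0 in Hd. lra. }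
      assert (Hlow : forall c y, span l y -> Cmod c <= Cmod c0 * vnorm (c * v + y)%V).
      { intros c y Hy. destruct (classic (c = C0)) as [->|Hc].
        - rewrite Cmod_0. apply Rmult_le_pos; [apply Cmod_ge0|apply vnorm_ge0].
        - pose proof (Hd (- (c0 / c * (y + c * w)))%V) as T.
          replace (c0 * (v - w) - - (c0 / c * (y + c * w)))%V with (c0 / c * (c * v + y))%V in T
            by (vmod_goals; field; exact Hc).
          rewrite vnorm_scal, Cmod_div in T by exact Hc.
          pose proof (Cmod_gt0 Hc) as Gc.
          assert (T' : 1 <= Cmod c0 / Cmod c * vnorm (c * v + y)%V).
          { apply T, vsub_opp; [apply span_subspace|]. apply vsub_scal; [apply span_subspace|].
            apply vsub_add; [apply span_subspace|exact Hy|]. apply vsub_scal; [apply span_subspace|exact Hw]. }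
          apply (Rmult_le_compat_l (Cmod c)) in T'; [|lra].
          replace (Cmod c * (Cmod c0 / Cmod c * vnorm (c * v + y)%V)) with (Cmod c0 * vnorm (c * v + y)%V) in T' by (field; lra).
          lra. }
      intros y H.
      assert (Hs : forall n : nat, exists p : C * X, span l (snd p) /\ vnorm (y - (fst p * v + snd p))%V < / INR (S n)).
      { intro n. destruct (H (/ INR (S n)) (inv_INR_pos n)) as [x [Hx Hn]]. rewrite span_cons in Hx.
        destruct Hx as [c [z [Hz ->]]]. exists (c, z). auto. }
      destruct (functional_choice Hs) as [p Hp].
      set (c := fun n => fst (p n)). set (z := fun n => snd (p n)).
      assert (Hz : forall n, span l (z n)) by (intro; apply Hp).
      assert (Hn : forall n, vnorm (y - (c n * v + z n))%V < / INR (S n)) by (intro; apply Hp).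
      clearbody c z.
      pose proof (Cmod_gt0 Hc0) as G0.
      destruct (@C_complete c) as [l0 Hl0].
      { intros eps He. destruct (@inv_INR_cv_0 (eps / 2 / Cmod c0)) as [M HM]; [repeat apply Rdiv_lt_0_compat; lra|].
        exists M. intros m n Hm Hn'. pose proof (HM m Hm). pose proof (HM n Hn').
        pose proof (Hn m). pose proof (Hn n).
        pose proof (@Hlow (c m - c n)%C (z m - z n)%V (vsub_sub (span_subspace l) (Hz m) (Hz n))) as T.
        replace ((c m - c n)%C * v + (z m - z n))%V with ((c m * v + z m) - (c n * v + z n))%V in T by vmod.
        pose proof (vnorm_sub_triangle y (c m * v + z m)%V (c n * v + z n)%V) as T2.
        rewrite (vnorm_sub_sym _ y) in T2.
        eapply Rle_lt_trans; [exact T|].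
        apply Rlt_le_trans with (Cmod c0 * (eps / 2 / Cmod c0 + eps / 2 / Cmod c0)).
        - apply Rmult_lt_compat_l; lra.
        - right. field. lra. }
      apply span_cons. exists l0, (y - l0 * v)%V. split; [|vmod].
      apply (vclosed_lim IH Hz). intros eps He.
      destruct (@inv_INR_cv_0 (eps / 2)) as [M HM]; [lra|].
      pose proof (vnorm_ge0 v).
      destruct (Hl0 (eps / 2 / (vnorm v + 1))) as [M' HM']; [repeat apply Rdiv_lt_0_compat; lra|].
      exists (max M M'). intros n Hn'. specialize (HM n ltac:(lia)). specialize (HM' n ltac:(lia)). specialize (Hn n).
      replace (z n - (y - l0 * v))%V with (- (y - (c n * v + z n)) - (c n - l0)%C * v)%V by vmod.
      pose proof (vnorm_sub_le (- (y - (c n * v + z n)))%V ((c n - l0)%C * v)%V) as T.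
      rewrite vnorm_opp, vnorm_scal in T.
      apply lt_div_cancel in HM'; [|lra].
      pose proof (Cmod_ge0 (c n - l0)%C). nra.
Qed.

(** If no finite list spans the range, the Riesz lemma produces a bounded, 1-separated sequence of
    vectors fixed by P, and P maps it to itself. *)
Lemma compact_projection_finite_rank (P : bop X) : is_compact P -> (forall x, P (P x) = P x) -> is_finite_rank P.
Proof.
  intros HP HPP. apply NNPP. intro C.
  assert (H : forall l, exists x, P x = x /\ vnorm x <= 2 * opnorm P + 2 /\
     ((forall v, span l v -> P v = v) -> forall v, span l v -> 1 <= vnorm (x - v)%V)).
  { intro l. pose proof (opnorm_ge0 P).
    destruct (classic (forall v, span l v -> P v = v)) as [Hl|Hl].
    - assert (exists x, ~ span l (P x)) as [x Hx].
      { apply NNPP. intro C2. apply C. exists l. intro x. apply NNPP. intro C3. apply C2. exists x.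
        intros [cs Hcs]. apply C3. exists cs. exact Hcs. }
      destruct (riesz_lemma (span_subspace l) (@span_closed l) Hx) as [c [w [Hw [H2 H1]]]].
      exists (c * (P x - w))%V. split; [|split].
      + rewrite bop_scal, bop_add, bop_opp, HPP, (Hl w Hw). reflexivity.
      + lra.
      + intros _. exact H1.
    - exists vzero. split; [apply bop_zero|]. split; [rewrite vnorm_0; lra|]. intro; contradiction. }
  destruct (functional_choice H) as [f Hf].
  set (ls := fix ls n := match n with O => nil | S n => f (ls n) :: ls n end).
  assert (Hls : forall n v, span (ls n) v -> P v = v).
  { induction n as [|n IH]; intros v Hv; simpl in Hv.
    - rewrite span_nil in Hv. subst. apply bop_zero.
    - rewrite span_cons in Hv. destruct Hv as [c [y [Hy ->]]]. rewrite bop_add, bop_scal, (IH y Hy).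
      destruct (Hf (ls n)) as [-> _]. reflexivity. }
  set (u := fun n => f (ls n)).
  assert (Hin : forall j k, (j < k)%nat -> span (ls k) (u j)).
  { intros j k L. induction L; simpl; [apply span_head|apply span_incl_cons; assumption]. }
  apply (@compact_not_separated X P u 1 HP).
  - exists (2 * opnorm P + 2). intro n. apply Hf.
  - lra.
  - intros j k L. assert (Eu : forall n, P (u n) = u n) by (intro; apply Hf). rewrite !Eu.
    apply Hf; [apply Hls|apply Hin, L].
Qed.
End FiniteRank.

Lemma riesz_projection (X : CBanach) (a : bop X) mu : is_compact a -> mu <> C0 ->
  (forall t, Cmod mu < t -> pbound a t) ->
  exists (P g : bop X) k, (forall x, P (P x) = P x) /\ is_finite_rank P /\
    (forall c, commutes c a -> commutes c P) /\ (forall x, bpow (shift mu a) k (P x) = vzero) /\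
    (forall e, a e = (mu * e)%V -> P e = e) /\ commutes g a /\ (forall x, P x = a (g (P x))).
Proof.
  intros Ha Hmu Hp. destruct (finite_ascent Ha Hmu) as [k Hk].
  (* The exponent is raised by one so as to be positive; a single factor of (mu - a)^(k+1) then
     kills every eigenvector for mu. *)
  assert (Hk' : forall x, bpow (shift mu a) (S (S k)) x = vzero -> bpow (shift mu a) (S k) x = vzero).
  { intros x Hx. rewrite bpow_Sr in Hx |- *. apply Hk, Hx. }
  destruct (riesz_projection_ex Ha Hmu Hk' (compact_pbound_surj Hp)) as [P [H1 [H2 [H3 [g [H4 H5]]]]]].
  exists P, g, (S k).
  assert (HPP : forall x, P (P x) = P x) by (intro; apply H2, H1).
  split; [exact HPP|]. split; [|split; [exact H3|split; [exact H1|split; [|split; [exact H4|exact H5]]]]].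
  - apply compact_projection_finite_rank; [|exact HPP].
    replace P with (bcomp a (bcomp g P)) by (apply bop_eq; intro x; symmetry; apply H5).
    apply compact_comp_r, Ha.
  - intros e He. apply H2. rewrite bpow_Sr, shift_app, He, vadd_opp. apply bop_zero.
Qed.

(** * Spectral decomposition of a compact operator *)

Definition eigenvalue (X : CBanach) (a : bop X) (mu : C) : Prop :=
  exists e, e <> vzero /\ a e = (mu * e)%V.

Section Decomposition.
Variable X : CBanach.
Variable a : bop X.

Fixpoint bsum (l : list (C * bop X)) : bop X :=
  match l with nil => bzero | p :: l => badd (snd p) (bsum l) end.

(** Riesz projections of a split off so far, mutually orthogonal, for eigenvalues of modulus at
    least eps. The recorded eigenvector in the range of each projection is what forces the
    extraction to stop. *)
Inductive pieces (eps : R) : list (C * bop X) -> Prop :=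
| pieces_nil : pieces eps nil
| pieces_cons (mu : C) (P : bop X) (l : list (C * bop X)) :
    pieces eps l ->
    (forall x, P (P x) = P x) -> is_finite_rank P -> commutes a P ->
    (exists k, forall x, bpow (shift mu a) k (P x) = vzero) ->
    eps <= Cmod mu ->
    (exists e, e <> vzero /\ a e = (mu * e)%V /\ P e = e) ->
    (forall q x, In q l -> P (snd q x) = vzero /\ snd q (P x) = vzero) ->
    pieces eps ((mu, P) :: l).

Lemma bsum_orth (P : bop X) (l : list (C * bop X)) : (forall q x, In q l -> P (snd q x) = vzero /\ snd q (P x) = vzero) ->
  forall x, P (bsum l x) = vzero /\ bsum l (P x) = vzero.
Proof.
  induction l as [|q l IH]; intros H x; simpl.
  - split; [apply bop_zero|reflexivity].
  - rewrite bop_add. destruct (H q x (or_introl eq_refl)) as [-> ->].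
    destruct (IH (fun q x Hq => H q x (or_intror Hq)) x) as [-> ->]. split; vmod.
Qed.

Lemma bsum_pieces eps l : pieces eps l ->
  commutes a (bsum l) /\ (forall q x, In q l -> snd q (bsum l x) = snd q x /\ bsum l (snd q x) = snd q x).
Proof.
  induction 1 as [|mu P l Hl IH HPP HF Hc Hn He Heig Horth]; simpl.
  - split; [|tauto]. intro x. rewrite !bzero_app. apply bop_zero.
  - destruct IH as [IH1 IH2]. split; [auto with comm|].
    intros q x [<-|Hq]; simpl.
    + rewrite bop_add, HPP. destruct (bsum_orth Horth x) as [-> ->]. split; vmod.
    + rewrite bop_add. destruct (IH2 q x Hq) as [-> ->]. destruct (Horth q x Hq) as [-> ->]. split; vmod.
Qed.

Definition residual (l : list (C * bop X)) := bsub bid (bsum l).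

(** Apply the Riesz projection to a' = a (1 - Q), with Q the sum of the projections found so far.
    Since P = a' g P and a' annihilates the earlier projections on both sides, P is orthogonal to
    them; on the range of P the operators a and a' agree, so eigenvalue and nilpotency pass to a. *)
Lemma pieces_extend eps l : is_compact a -> 0 < eps -> pieces eps l ->
  ~ pbound (bcomp a (residual l)) eps -> exists p, pieces eps (p :: l).
Proof.
  intros Ha He Hl Hn. set (a' := bcomp a (residual l)) in *.
  destruct (bsum_pieces Hl) as [HQa HQ].
  assert (Ha' : is_compact a') by (apply compact_comp_r, Ha).
  destruct (peripheral_eigenvalue Ha' He Hn) as [mu [e [Hmu [Hp [He0 Hae]]]]].
  assert (Hmu0 : mu <> C0) by (apply Cmod_pos_neq; lra).
  destruct (riesz_projection Ha' Hmu0 Hp) as [P [g [k [HPP [HF [HPc [Hk [HPe [Hg HPg]]]]]]]]].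
  assert (Caa' : commutes a a') by (unfold a', residual; auto 6 with comm).
  assert (Hq1 : forall q x, In q l -> a' (snd q x) = vzero).
  { intros q x Hq. unfold a', residual. rewrite bcomp_app, bsub_app, bid_app. destruct (HQ q x Hq) as [_ ->].
    rewrite vadd_opp. apply bop_zero. }
  assert (Cq : forall q, In q l -> commutes a (snd q)).
  { clear - Hl. induction Hl as [|mu P l Hl IH HPP HF Hc Hn He Heig Horth]; intros q []; [subst; exact Hc|auto]. }
  assert (Hq2 : forall q x, In q l -> snd q (a' x) = vzero).
  { intros q x Hq. unfold a', residual. rewrite bcomp_app, bsub_app, bid_app.
    rewrite <- (Cq q Hq), bop_add, bop_opp. destruct (HQ q x Hq) as [-> _]. rewrite vadd_opp. apply bop_zero. }
  assert (Horth : forall q x, In q l -> P (snd q x) = vzero /\ snd q (P x) = vzero).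
  { intros q x Hq. split.
    - rewrite HPg. rewrite (HPc g Hg (snd q x)).
      rewrite (HPc a' (commutes_refl a') (g (snd q x))), <- (Hg (snd q x)), Hq1, !bop_zero by exact Hq. reflexivity.
    - rewrite HPg. apply Hq2, Hq. }
  exists (mu, P). constructor; auto.
  - exists k. intro x. rewrite <- (Hk x).
    assert (E : forall j, bpow (shift mu a) j (P x) = bpow (shift mu a') j (P x)).
    { induction j as [|j IH]; [reflexivity|]. rewrite !bpow_S, IH.
      assert (Ep : bpow (shift mu a') j (P x) = P (bpow (shift mu a') j x)).
      { apply commutes_sym. apply commutes_pow, commutes_shift, commutes_sym, HPc, commutes_refl. }
      rewrite Ep, !shift_app. unfold a', residual. rewrite bcomp_app, bsub_app, bid_app.
      destruct (bsum_orth Horth (bpow (shift mu (bcomp a (bsub bid (bsum l)))) j x)) as [_ ->]. f_equal. f_equal. f_equal. vmod. }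
    apply E.
  - exists e. assert (EP : P e = e) by (apply HPe, Hae). split; [exact He0|]. split; [|exact EP].
    rewrite <- Hae. unfold a', residual. rewrite bcomp_app, bsub_app, bid_app. f_equal.
    rewrite <- EP at 3. destruct (bsum_orth Horth e) as [_ ->]. vmod.
Qed.

(** An endless extraction gives a-invariant spaces Y n, the ranges of the partial sums, each new
    eigenvector lying in the next space but not in the current one. The argument of [finite_ascent]
    applies to this chain, with separation eps since every mu has modulus at least eps. *)
Lemma pieces_terminate eps : is_compact a -> 0 < eps ->
  exists l, pieces eps l /\ pbound (bcomp a (residual l)) eps.
Proof.
  intros Ha He. apply NNPP. intro N.
  assert (H : forall l, exists p, pieces eps l -> pieces eps (p :: l)).
  { intro l. destruct (classic (pieces eps l)) as [Hl|Hl].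
    - destruct (@pieces_extend eps l Ha He Hl) as [p Hp]; [|exists p; auto].
      intro Hp. apply N. exists l. auto.
    - exists (C0, bzero). tauto. }
  destruct (functional_choice H) as [f Hf]. clear H N.
  set (ls := fix ls n := match n with O => nil | S n => f (ls n) :: ls n end).
  assert (Hls : forall n, pieces eps (ls n)) by (induction n; [constructor|apply Hf, IHn]).
  set (Y := fun n => ker (residual (ls n))).
  assert (Yin : forall n x, Y n x <-> bsum (ls n) x = x).
  { intros n x. unfold Y, ker, residual. rewrite bsub_app, bid_app. split; intro E.
    - symmetry. apply vsub_eq0, E.
    - rewrite E. apply vadd_opp. }
  assert (Ya : forall n x, Y n x -> Y n (a x)).
  { intros n x. rewrite !Yin. intro E. rewrite <- (proj1 (bsum_pieces (Hls n)) x), E. reflexivity. }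
  assert (YS : forall n x, Y n x -> Y (S n) x).
  { intros n x. rewrite !Yin. intro E. pose proof (Hls (S n)) as HS. simpl in HS |- *.
    destruct (f (ls n)) as [mu P]. inversion HS as [|mu' P' l Hl HPP HF Hc Hk Hmu Heig Horth]; subst.
    simpl. rewrite E. rewrite <- E at 1.
    destruct (bsum_orth Horth x) as [-> _]. vmod. }
  assert (Ymono : forall j n x, (j <= n)%nat -> Y j x -> Y n x).
  { intros j n x L. induction L; auto. }
  assert (Hu : forall n, exists u, Y (S n) u /\ vnorm u <= 2 /\ (forall v, Y n v -> 1 <= vnorm (u - v)%V) /\
     exists mu, eps <= Cmod mu /\ Y n (mu * u - a u)%V).
  { intro n. pose proof (Hls (S n)) as HS. simpl in HS.
    destruct (f (ls n)) as [mu P] eqn:Ef.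
    inversion HS as [|mu' P' l Hl HPP HF Hc Hk Hmu [e [He0 [Hae HPe]]] Horth]; subst.
    assert (HQe : bsum (ls n) e = vzero) by (rewrite <- HPe; apply (bsum_orth Horth e)).
    assert (HeY : ~ Y n e) by (rewrite Yin, HQe; auto).
    destruct (riesz_lemma (ker_subspace _) (@ker_closed _ _) HeY) as [c [w [Hw [H2 H1]]]].
    exists (c * (e - w))%V. split; [|split; [exact H2|split; [exact H1|]]].
    - apply vsub_scal; [apply ker_subspace|]. apply vsub_sub; [apply ker_subspace| |apply YS, Hw].
      apply Yin. simpl. rewrite Ef. simpl. rewrite HPe, HQe. vmod.
    - exists mu. split; [exact Hmu|].
      replace (mu * (c * (e - w)) - a (c * (e - w)))%V with (- (c * (mu * w - a w)))%V.
      + apply vsub_opp; [apply ker_subspace|]. apply vsub_scal; [apply ker_subspace|].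
        apply vsub_sub; [apply ker_subspace| |apply Ya, Hw]. apply vsub_scal; [apply ker_subspace|exact Hw].
      + autorewrite with lin. rewrite Hae. vmod. }
  destruct (functional_choice Hu) as [u Hu']. clear Hu.
  apply (@compact_not_separated X a u eps Ha); [exists 2; intro; apply Hu'|exact He|].
  intros j n L. destruct (Hu' n) as [_ [_ [Hd [mu [Hmu Hmu2]]]]]. destruct (Hu' j) as [Hj _].
  assert (Hmu0 : mu <> C0) by (apply Cmod_pos_neq; lra).
  assert (Hv : Y n (Cinv mu * (mu * u n - a (u n) + a (u j)))%V).
  { apply vsub_scal; [apply ker_subspace|]. apply vsub_add; [apply ker_subspace|exact Hmu2|].
    apply Ya. apply (@Ymono (S j)); auto. }
  specialize (Hd _ Hv).
  replace (a (u n) - a (u j))%V with (mu * (u n - Cinv mu * (mu * u n - a (u n) + a (u j))))%V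
    by (vmod_goals; field; exact Hmu0).
  rewrite vnorm_scal. nra.
Qed.

Lemma shift_pow_eigen mu nu k x : a x = (nu * x)%V -> bpow (shift mu a) k x = (Cpow (mu - nu) k * x)%V.
Proof.
  intro H. induction k as [|k IH]; simpl Cpow.
  - simpl. vmod.
  - rewrite bpow_S, IH, shift_app, bop_scal, H. vmod.
Qed.

(** Split at eps / 2. An eigenvector for nu outside the list is killed by every piece, since mu - a
    acts on it as the nonzero scalar mu - nu; the residual operator then acts on it as nu,
    contradicting the power bound eps / 2. *)
Lemma eigenvalues_finite eps : is_compact a -> 0 < eps ->
  exists ms, forall nu, eigenvalue a nu -> eps <= Cmod nu -> In nu ms.
Proof.
  intros Ha He. destruct (@pieces_terminate (eps / 2) Ha ltac:(lra)) as [l [Hl [K [HK0 HK]]]].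
  exists (map fst l). intros nu [x [Hx0 Hx]] Hnu. apply NNPP. intro N.
  assert (HP : bsum l x = vzero).
  { clear HK. induction Hl as [|mu P l Hl IH HPP HF Hc [k Hk] Hmu Heig Horth]; [reflexivity|].
    simpl in N |- *. rewrite IH by tauto.
    assert (Hne : (mu - nu)%C <> C0).
    { intro E. apply N. left. replace mu with (mu - nu + nu)%C by ring. rewrite E. ring. }
    assert (E : P x = vzero).
    { assert (HaP : a (P x) = (nu * P x)%V) by (rewrite Hc, Hx; apply bop_scal).
      pose proof (shift_pow_eigen mu k HaP) as E. rewrite Hk in E.
      pose proof (Cpow_neq0 (n := k) Hne) as Hne'.
      replace (P x) with (Cinv (Cpow (mu - nu) k) * (Cpow (mu - nu) k * P x))%V by (vmod_goals; field; exact Hne').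
      rewrite <- E. apply vscal_vzero. }
    rewrite E. vmod. }
  assert (Hb : forall n, bpow (bcomp a (residual l)) n x = (Cpow nu n * x)%V).
  { induction n as [|n IH]; [simpl; vmod|]. rewrite bpow_S, IH. unfold residual. autorewrite with lin.
    rewrite HP. simpl Cpow. autorewrite with lin. replace (Cpow nu n * (x - vzero))%V with (Cpow nu n * x)%V by vmod.
    rewrite ?bop_scal, Hx. vmod. }
  apply vnorm_gt0 in Hx0.
  destruct (@pow_small (/ 2) K 1) as [n Hn]; [lra|lra|]. specialize (Hn n (le_n n)). specialize (HK n x).
  rewrite Hb, vnorm_scal, Cmod_pow in HK. apply Rmult_le_reg_r in HK; [|exact Hx0].
  assert (P1 : eps ^ n <= Cmod nu ^ n) by (apply pow_incr; lra).
  assert (P2 : 0 < eps ^ n) by (apply pow_lt, He).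
  unfold Rdiv in HK. rewrite Rpow_mult_distr in HK. nra.
Qed.

(** The residual part gets centre 0, where (0 - a)^n is a^n up to sign and inherits the power bound
    eta. On a Riesz piece (mu - a)^k vanishes, so any ratio eta is allowed at the price of the
    constant. *)
Lemma spectral_partition eta : is_compact a -> 0 < eta -> exists l : list (C * bop X),
  (forall x, bsum l x = x) /\
  forall mu P, In (mu, P) l -> commutes a P /\
    (exists K, 0 <= K /\ forall n x, vnorm (bpow (shift mu a) n (P x)) <= K * eta ^ n * vnorm x) /\
    (mu = C0 \/ (eigenvalue a mu /\ is_finite_rank P)).
Proof.
  intros Ha He. destruct (@pieces_terminate eta Ha He) as [l [Hl [K [HK0 HK]]]].
  exists ((C0, residual l) :: l). split.
  { intro x. simpl. unfold residual. autorewrite with lin. vmod. }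
  destruct (bsum_pieces Hl) as [HQa HQ].
  intros mu P [E|Hin].
  - injection E as <- <-. split; [unfold residual; auto with comm|]. split; [|left; reflexivity].
    exists (K * opnorm (residual l)). pose proof (opnorm_ge0 (residual l)). split; [nra|]. intros n x.
    assert (EQ : forall y, residual l (residual l y) = residual l y).
    { intro y. unfold residual. autorewrite with lin.
      assert (Q2 : bsum l (bsum l y) = bsum l y).
      { clear - Hl HQ. revert y.
        assert (G : forall m, (forall q, In q m -> In q l) -> forall y, bsum l (bsum m y) = bsum m y).
        { induction m as [|q m IH]; intros Hm y; simpl; [apply bop_zero|].
          rewrite bop_add, IH by (intros; apply Hm; right; assumption).
          destruct (HQ q y (Hm q (or_introl eq_refl))) as [_ ->]. reflexivity. }
        apply G. auto. }
      rewrite Q2. vmod. }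
    assert (CaR : commutes a (residual l)) by (unfold residual; auto with comm).
    assert (EP : forall n, bpow (shift C0 a) n (residual l x) = (Cpow (- C1)%C n * bpow (bcomp a (residual l)) n (residual l x))%V
       /\ residual l (bpow (bcomp a (residual l)) n (residual l x)) = bpow (bcomp a (residual l)) n (residual l x)).
    { induction n0 as [|j [IH1 IH2]].
      - simpl. split; [vmod|apply EQ].
      - rewrite !bpow_S, IH1, shift_app, bcomp_app, IH2, bop_scal. simpl Cpow. split; [vmod|].
        rewrite <- CaR, IH2. reflexivity. }
    destruct (EP n) as [-> _]. rewrite vnorm_scal, Cmod_pow, Cmod_opp, Cmod_1, pow1, Rmult_1_l.
    eapply Rle_trans; [apply HK|]. pose proof (bop_norm (residual l) x).
    assert (0 <= K * eta ^ n) by (apply Rmult_le_pos; [lra|apply pow_le; lra]).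
    replace (K * opnorm (residual l) * eta ^ n * vnorm x) with (K * eta ^ n * (opnorm (residual l) * vnorm x)) by ring.
    apply Rmult_le_compat_l; assumption.
  - clear HK HQ HQa. induction Hl as [|mu' P' l Hl IH HPP HF Hc [k Hk] Hmu [e [He0 [Hae HPe]]] Horth]; [destruct Hin|].
    destruct Hin as [E|Hin]; [|exact (IH Hin)]. injection E as <- <-. split; [exact Hc|]. split.
    + destruct (bop_bounded (shift mu' a)) as [M [HM0 HM]]. destruct (bop_bounded P') as [B [HB0 HB]].
      assert (Hq : 0 <= M / eta) by (apply Rmult_le_pos; [lra|left; apply Rinv_0_lt_compat, He]).
      exists ((1 + M / eta) ^ k * B). pose proof (pow_le (1 + M / eta) k ltac:(lra)). split; [nra|]. intros n x.
      pose proof (vnorm_ge0 x). pose proof (pow_le eta n ltac:(lra)).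
      destruct (Nat.le_gt_cases k n) as [L|L].
      * replace n with ((n - k) + k)%nat at 1 by lia. rewrite bpow_add, Hk, bop_zero, vnorm_0.
        apply Rmult_le_pos; [apply Rmult_le_pos; [nra|lra]|lra].
      * eapply Rle_trans; [apply (pow_norm_le HM0 HM)|].
        assert (M ^ n <= (1 + M / eta) ^ k * eta ^ n).
        { apply Rle_trans with ((1 + M / eta) ^ n * eta ^ n).
          - rewrite <- Rpow_mult_distr. apply pow_incr. split; [exact HM0|].
            replace ((1 + M / eta) * eta) with (eta + M) by (field; lra). lra.
          - apply Rmult_le_compat_r; [lra|]. apply Rle_pow; [lra|lia]. }
        specialize (HB x). pose proof (pow_le M n HM0). pose proof (vnorm_ge0 (P' x)).
        apply Rle_trans with ((1 + M / eta) ^ k * eta ^ n * (B * vnorm x)); [apply Rmult_le_compat; lra|right; ring].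
    + right. split; [exists e; auto|exact HF].
Qed.
End Decomposition.

(** * Spectral projections onto half-planes *)

Section OperatorSpace.
Variable X : CBanach.
Implicit Types S T : bop X.

Lemma bop_opnorm_eq0 T : opnorm T = 0 -> T = bzero.
Proof.
  intro H. apply bop_eq. intro x. rewrite bzero_app. apply vnorm_eq0.
  pose proof (bop_norm T x). pose proof (vnorm_ge0 (T x)). rewrite H in *. lra.
Qed.

Lemma opnorm_bscal c T : opnorm (bscal c T) = Cmod c * opnorm T.
Proof.
  assert (G : forall c T, opnorm (bscal c T) <= Cmod c * opnorm T).
  { clear. intros c T. pose proof (Cmod_ge0 c). pose proof (opnorm_ge0 T). apply opnorm_le; [nra|]. intro x.
    rewrite bscal_app, vnorm_scal. pose proof (bop_norm T x). nra. }
  apply Rle_antisym; [apply G|]. destruct (classic (c = C0)) as [->|Hc].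
  - rewrite Cmod_0, Rmult_0_l. apply opnorm_ge0.
  - pose proof (G (Cinv c) (bscal c T)) as H. rewrite Cmod_inv in H by exact Hc.
    replace (bscal (Cinv c) (bscal c T)) with T in H.
    + pose proof (Cmod_gt0 Hc). apply (Rmult_le_compat_l (Cmod c)) in H; [|lra].
      rewrite <- Rmult_assoc, Rinv_r in H; lra.
    + apply bop_eq. intro x. autorewrite with lin. vmod_goals; field; exact Hc.
Qed.

Lemma opnorm_badd S T : opnorm (badd S T) <= opnorm S + opnorm T.
Proof.
  pose proof (opnorm_ge0 S). pose proof (opnorm_ge0 T). apply opnorm_le; [lra|]. intro x.
  rewrite badd_app. pose proof (vnorm_triangle (S x) (T x)). pose proof (bop_norm S x). pose proof (bop_norm T x). lra.
Qed.

Lemma bop_complete (u : nat -> bop X) :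
  (forall eps, 0 < eps -> exists N, forall m n, (N <= m)%nat -> (N <= n)%nat -> opnorm (badd (u m) (bopp (u n))) < eps) ->
  exists l, forall eps, 0 < eps -> exists N, forall n, (N <= n)%nat -> opnorm (badd (u n) (bopp l)) < eps.
Proof.
  intro H.
  assert (Hx : forall x, exists y, vlim (fun n => u n x) y).
  { intro x. apply vcomplete. intros eps He. pose proof (vnorm_ge0 x).
    destruct (H (eps / (vnorm x + 1))) as [N HN]; [apply Rdiv_lt_0_compat; lra|].
    exists N. intros m n Hm Hn. specialize (HN m n Hm Hn).
    pose proof (bop_norm (bsub (u m) (u n)) x) as T. rewrite bsub_app in T. unfold bsub in T.
    apply lt_div_cancel in HN; [|lra].
    pose proof (opnorm_ge0 (badd (u m) (bopp (u n)))). nra. }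
  destruct (functional_choice Hx) as [l Hl].
  assert (Hu : forall eps, 0 < eps -> exists N, forall n, (N <= n)%nat -> forall x, vnorm (u n x - l x)%V <= eps * vnorm x).
  { intros eps He. destruct (H eps He) as [N HN]. exists N. intros n Hn x.
    rewrite vnorm_sub_sym. apply (vlim_le_sub (Hl x)). exists N. intros m Hm.
    pose proof (bop_norm (bsub (u m) (u n)) x) as T. rewrite bsub_app in T. unfold bsub in T.
    specialize (HN m n Hm Hn). pose proof (vnorm_ge0 x). nra. }
  assert (HL : is_linear l).
  { split.
    - intros x y. apply (vlim_unique (Hl (x + y)%V)). refine (vlim_ext _ (vlim_add (Hl x) (Hl y))). intro; symmetry; apply bop_add.
    - intros c x. apply (vlim_unique (Hl (c * x)%V)). refine (vlim_ext _ (vlim_scal c (Hl x))). intro; symmetry; apply bop_scal. }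
  assert (HB : is_bounded l).
  { destruct (Hu 1) as [N HN]; [lra|]. exists (opnorm (u N) + 1). intro x. specialize (HN N (le_n N) x).
    pose proof (bop_norm (u N) x). pose proof (vnorm_triangle_sub (l x) (u N x)) as T. rewrite vnorm_sub_sym in T. lra. }
  exists (mkBop (conj HL HB)). intros eps He. destruct (Hu (eps / 2)) as [N HN]; [lra|].
  exists N. intros n Hn. apply Rle_lt_trans with (eps / 2); [|lra].
  apply opnorm_le; [lra|]. intro x. rewrite badd_app, bopp_app. apply HN, Hn.
Qed.

(** Operators as a Banach space of their own, so that power bounds, resolvents and closed invariant
    subspaces make sense for ad a. *)
Definition BX : CBanach.
Proof.
  refine {| car := bop X; vadd := @badd X; vzero := bzero; vopp := @bopp X; vscal := @bscal X;
            vnorm := fun T => opnorm T |};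
    try solve [intros; apply bop_eq; intro; autorewrite with lin; vmod].
  - apply bop_opnorm_eq0.
  - apply opnorm_bscal.
  - apply opnorm_badd.
  - apply bop_complete.
Defined.

Lemma BX_add (S T : BX) (x : X) : @bfun X (@vadd BX S T) x = (@bfun X S x + @bfun X T x)%V. Proof. reflexivity. Qed.
Lemma BX_scal c (T : BX) (x : X) : @bfun X (@vscal BX c T) x = (c * @bfun X T x)%V. Proof. reflexivity. Qed.
Lemma BX_opp (T : BX) (x : X) : @bfun X (@vopp BX T) x = (- @bfun X T x)%V. Proof. apply bopp_app. Qed.
Lemma BX_zero (x : X) : @bfun X (@vzero BX) x = vzero. Proof. reflexivity. Qed.
End OperatorSpace.
#[export] Hint Rewrite BX_add BX_scal BX_opp BX_zero : lin.

(** * Resolvents along a vertical line *)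

Section HalfPlane.
Variable V : CBanach.
Variable T : bop V.

(** Method of continuity. At height M + 1 the Neumann series solves the equation inside W. Changing
    the height by at most kap / 2 changes the operator by at most kap / 2, while solutions are
    bounded by |z| / kap, so the relative error is at most 1/2 and [approx_surj] applies. Finitely
    many such steps reach any height. *)
Lemma shift_surj_line (W : V -> Prop) y0 kap : vsubspace W -> vclosed W -> (forall x, W x -> W (T x)) -> 0 < kap ->
  (forall lam x, Re lam = y0 -> kap * vnorm x <= vnorm (shift lam T x)) ->
  forall lam y, Re lam = y0 -> W y -> exists x, W x /\ shift lam T x = y.
Proof.
  intros HW HC HT Hk Hlow. destruct (bop_bounded T) as [M [HM0 HM]].
  set (surj := fun s => forall y, W y -> exists x, W x /\ shift (mkC y0 s) T x = y).
  assert (Base : surj (M + 1)).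
  { intros y Hy.
    assert (Hl : M < Cmod (mkC y0 (M + 1))).
    { pose proof (Im_le_Cmod (mkC y0 (M + 1))) as I. simpl in I. rewrite Rabs_pos_eq in I by lra. lra. }
    destruct (@neumann_surj V T (mkC y0 (M + 1))) with (W := W) (t := M) (y := y) as [x [Hx E]]; auto.
    - apply Cmod_pos_neq. lra.
    - apply pbound_norm; assumption.
    - exists x. rewrite shift_app. auto. }
  assert (Step : forall s s', Rabs (s - s') <= kap / 2 -> surj s -> surj s').
  { intros s s' Hs H y Hy. destruct (bop_bounded (shift (mkC y0 s') T)) as [M' [_ HM']].
    destruct (@approx_surj V W (shift (mkC y0 s') T) (/ kap) M' HW HC) with (y := y) as [x [Hx [E _]]]; auto.
    - apply bop_add.
    - apply bop_zero.
    - intros x Hx. rewrite shift_app. apply vsub_sub; auto. apply vsub_scal; auto.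
    - intros z Hz. destruct (H z Hz) as [x [Hx E]]. exists x. split; [exact Hx|].
      pose proof (Hlow (mkC y0 s) x eq_refl) as L. rewrite E in L.
      assert (L2 : vnorm x <= / kap * vnorm z) by (apply inv_mul_le; assumption).
      split; [exact L2|].
      assert (Ed : (z - shift (mkC y0 s') T x)%V = (mkC 0 (s - s') * x)%V).
      { rewrite <- E, !shift_app. vmod_goals; apply C_eq; simpl; ring. }
      rewrite Ed, vnorm_scal.
      assert (Hc : Cmod (mkC 0 (s - s')) <= kap / 2).
      { eapply Rle_trans; [apply Cmod_le_Re_Im|]. simpl. rewrite Rabs_R0. lra. }
      pose proof (vnorm_ge0 x). apply Rle_trans with (kap / 2 * (/ kap * vnorm z)).
      + apply Rmult_le_compat; auto. apply Cmod_ge0.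
      + right. field. lra.
    - exists x. auto. }
  assert (All : forall n s, Rabs (s - (M + 1)) <= INR n * (kap / 2) -> surj s).
  { induction n as [|n IH]; intros s Hs.
    - simpl in Hs. rewrite Rmult_0_l in Hs. pose proof (Rle_abs (s - (M + 1))) as R1.
      pose proof (Rle_abs (- (s - (M + 1)))) as R2. rewrite Rabs_Ropp in R2. replace s with (M + 1) by lra. exact Base.
    - pose proof (pos_INR n). rewrite S_INR in Hs.
      set (d := s - (M + 1)) in *.
      apply (Step (M + 1 + d * (INR n / (INR n + 1)))).
      + replace (M + 1 + d * (INR n / (INR n + 1)) - s) with (- (d * / (INR n + 1))) by (unfold d; field; lra).
        rewrite Rabs_Ropp, Rabs_mult, (Rabs_pos_eq (/ (INR n + 1))) by (left; apply Rinv_0_lt_compat; lra).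
        apply Rmult_le_reg_r with (INR n + 1); [lra|]. rewrite Rmult_assoc, Rinv_l by lra. lra.
      + apply IH. replace (M + 1 + d * (INR n / (INR n + 1)) - (M + 1)) with (d * / (INR n + 1) * INR n) by (field; lra).
        rewrite !Rabs_mult, (Rabs_pos_eq (/ (INR n + 1))), (Rabs_pos_eq (INR n)) by (try (left; apply Rinv_0_lt_compat); lra).
        assert (Rabs d * / (INR n + 1) <= kap / 2).
        { apply Rmult_le_reg_r with (INR n + 1); [lra|]. rewrite Rmult_assoc, Rinv_l by lra. lra. }
        rewrite (Rmult_comm (INR n)). apply Rmult_le_compat_r; assumption. }
  intros lam y Hl. destruct lam as [r s]. simpl in Hl. subst r.
  destruct (INR_unbounded (Rabs (s - (M + 1)) / (kap / 2))) as [n Hn].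
  apply (All n). apply Rmult_lt_compat_r with (r := kap / 2) in Hn; [|lra].
  replace (Rabs (s - (M + 1)) / (kap / 2) * (kap / 2)) with (Rabs (s - (M + 1))) in Hn by (field; lra). lra.
Qed.

(* A^m - w B^m, with A = y0 + k0 - T and B = y0 - k0 - T, factors through resolvents on the line Re = y0 *)
Lemma pencil_surj (W : V -> Prop) y0 k0 : vsubspace W -> (forall x, W x -> W (T x)) -> 0 < k0 ->
  (forall lam y, Re lam = y0 -> W y -> exists x, W x /\ shift lam T x = y) ->
  forall k w y, Cmod w = 1 -> W y -> exists z, W z /\
    (bpow (shift (RtoC (y0 + k0)) T) (2 ^ k) z - w * bpow (shift (RtoC (y0 - k0)) T) (2 ^ k) z)%V = y.
Proof.
  intros HW HT Hk Hs. set (A := shift (RtoC (y0 + k0)) T). set (B := shift (RtoC (y0 - k0)) T).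
  assert (CAB : forall m, commutes (bpow A m) (bpow B m)).
  { intro m. apply commutes_pow, commutes_sym, commutes_pow. unfold A, B.
    apply commutes_shift, commutes_sym, commutes_shift, commutes_refl. }
  induction k as [|k IH]; intros w y Hw Hy.
  - change (2 ^ 0)%nat with 1%nat. destruct (classic (w = C1)) as [->|Hw1].
    + exists (RtoC (/ (2 * k0)) * y)%V. split; [apply vsub_scal; auto|].
      rewrite !bpow_S, !bpow_0. unfold A, B. autorewrite with lin. vmod_goals; apply C_eq; simpl; field; lra.
    + assert (Hne : (C1 - w)%C <> C0) by (intro E; apply Hw1; replace w with (C1 - (C1 - w))%C by ring; rewrite E; ring).
      (* A - w B = (1 - w)(lam - T). Since |w| = 1, lam is equidistant from y0 + k0 and y0 - k0,
         hence on the line Re = y0; the case w = 1 is the point at infinity, where A - B = 2 k0. *)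
      set (lam := ((RtoC (y0 + k0) - w * RtoC (y0 - k0)) / (C1 - w))%C).
      destruct (Hs lam (Cinv (C1 - w) * y)%V) as [x [Hx E]].
      * pose proof (C_neq0_norm2 Hne) as Hn. pose proof (Cmod_sqr w) as Hw2. rewrite Hw in Hw2.
        destruct w as [u v]. unfold lam. simpl in Hn, Hw2 |- *.
        apply Rminus_diag_uniq.
        match goal with |- ?L = 0 => replace L with (k0 * (1 - u * u - v * v) / ((1 - u) * (1 - u) + v * v)) end.
        -- replace (1 - u * u - v * v) with 0 by lra. unfold Rdiv. ring.
        -- field. intro E; apply Hn. refine (eq_trans _ E). ring.
      * apply vsub_scal; auto.
      * exists x. split; [exact Hx|]. rewrite !bpow_S, !bpow_0.
        assert (E2 : y = ((C1 - w) * shift lam T x)%V) by (rewrite E; vmod_goals; field; exact Hne).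
        rewrite E2. unfold A, B, lam. autorewrite with lin. vmod_goals; field; exact Hne.
  (* A^(2m) - v^2 B^(2m) = (A^m - v B^m)(A^m + v B^m), both factors being covered by the induction
     hypothesis. *)
  - destruct (unit_sqrt Hw) as [v [Hv <-]].
    destruct (IH v y Hv Hy) as [z1 [Hz1 E1]].
    destruct (IH (- v)%C z1) as [z [Hz E2]]; [rewrite Cmod_opp; exact Hv|exact Hz1|].
    exists z. split; [exact Hz|]. rewrite <- E1, <- E2.
    replace (2 ^ S k)%nat with (2 ^ k + 2 ^ k)%nat by (simpl; lia).
    rewrite !bpow_add. autorewrite with lin. rewrite <- (CAB (2 ^ k)%nat z). vmod.
Qed.

Record block := mkBlock { bc : C; bE : bop V; bN : V -> R }.

(** [bE] is one component of a decomposition of the identity and [bN] a seminorm dominating it. The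
    seminorm is adapted to T: the constant of a power bound is absorbed in it, so that a single
    application of bc - T already contracts by eta. *)
Record is_block (eta : R) (b : block) : Prop := {
  blk_bd : exists K, 0 <= K /\ forall x, bN b x <= K * vnorm x;
  blk_E : forall x, vnorm (bE b x) <= bN b x;
  blk_add : forall x y, bN b (x + y)%V <= bN b x + bN b y;
  blk_scal : forall c x, bN b (c * x)%V = Cmod c * bN b x;
  blk_T : forall x, bN b (shift (bc b) T x) <= eta * bN b x }.

Section Block.
Variable eta : R.
Variable b : block.
Hypothesis Hb : is_block eta b.

Lemma blk_ge0 x : 0 <= bN b x.
Proof. eapply Rle_trans; [apply vnorm_ge0|apply (blk_E Hb)]. Qed.

Lemma blk_opp x : bN b (- x)%V = bN b x.
Proof. rewrite vopp_scal, (blk_scal Hb), Cmod_opp, Cmod_1. ring. Qed.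

Lemma blk_upper lam x : bN b (shift lam T x) <= (Cmod (lam - bc b)%C + eta) * bN b x.
Proof.
  replace (shift lam T x) with ((lam - bc b)%C * x + shift (bc b) T x)%V by (autorewrite with lin; vmod).
  pose proof (blk_add Hb ((lam - bc b)%C * x)%V (shift (bc b) T x)) as H. rewrite (blk_scal Hb) in H.
  pose proof (blk_T Hb x). lra.
Qed.

Lemma blk_lower lam x : (Cmod (lam - bc b)%C - eta) * bN b x <= bN b (shift lam T x).
Proof.
  pose proof (blk_add Hb (shift lam T x) (- shift (bc b) T x)%V) as H.
  replace (shift lam T x - shift (bc b) T x)%V with ((lam - bc b)%C * x)%V in H by (autorewrite with lin; vmod).
  rewrite (blk_scal Hb), blk_opp in H. pose proof (blk_T Hb x). lra.
Qed.

Lemma blk_pow_upper lam m x : 0 <= eta -> bN b (bpow (shift lam T) m x) <= (Cmod (lam - bc b)%C + eta) ^ m * bN b x.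
Proof.
  intro He. pose proof (Cmod_ge0 (lam - bc b)%C). induction m as [|m IH]; [simpl; lra|].
  rewrite bpow_S. eapply Rle_trans; [apply blk_upper|]. simpl. rewrite Rmult_assoc.
  apply Rmult_le_compat_l; lra.
Qed.

Lemma blk_pow_lower lam m x : 0 <= Cmod (lam - bc b)%C - eta ->
  (Cmod (lam - bc b)%C - eta) ^ m * bN b x <= bN b (bpow (shift lam T) m x).
Proof.
  intro He. induction m as [|m IH]; [simpl; lra|].
  rewrite bpow_S. eapply Rle_trans; [|apply blk_lower]. simpl. rewrite Rmult_assoc.
  apply Rmult_le_compat_l; lra.
Qed.

(* On a block where A = p - T is dominated by B = q - T, A^m is negligible with respect to A^m + B^m *)
Lemma blk_dominated p q x eps : 0 <= eta -> 0 < eps ->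
  Cmod (p - bc b)%C + eta < Cmod (q - bc b)%C - eta ->
  exists M, forall m z, (M <= m)%nat -> (bpow (shift p T) m z + bpow (shift q T) m z)%V = x ->
    bN b (bpow (shift p T) m z) < eps.
Proof.
  intros Heta He Hab. set (al := Cmod (p - bc b)%C + eta) in *. set (be := Cmod (q - bc b)%C - eta) in *.
  assert (Hal : 0 <= al) by (unfold al; pose proof (Cmod_ge0 (p - bc b)%C); lra).
  assert (Hq : 0 <= al / be < 1) by (apply ratio_lt_1; lra).
  destruct (@pow_small _ 1 (/ 2) Hq) as [M1 HM1]; [lra|].
  destruct (@pow_small _ (2 * bN b x) eps Hq He) as [M2 HM2].
  exists (max M1 M2). intros m z Hm E. specialize (HM1 m ltac:(lia)). specialize (HM2 m ltac:(lia)).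
  set (tau := (al / be) ^ m) in *. rewrite Rmult_1_l in HM1.
  assert (Ht0 : 0 <= tau) by (apply pow_le, Hq).
  pose proof (blk_pow_upper p m z Heta) as HA. pose proof (@blk_pow_lower q m z) as HB.
  fold al in HA. fold be in HB. specialize (HB ltac:(lra)).
  set (Az := bpow (shift p T) m z) in *. set (Bz := bpow (shift q T) m z) in *.
  assert (Hbe : 0 < be ^ m) by (apply pow_lt; lra).
  assert (H1 : bN b Az <= tau * bN b Bz).
  { eapply Rle_trans; [exact HA|]. unfold tau, Rdiv. rewrite Rpow_mult_distr, pow_inv.
    apply Rle_trans with (al ^ m * / be ^ m * (be ^ m * bN b z)); [right; field; lra|].
    apply Rmult_le_compat_l; [|exact HB]. apply Rmult_le_pos; [apply pow_le; lra|left; apply Rinv_0_lt_compat, Hbe]. }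
  assert (H2 : bN b Bz <= bN b x + bN b Az).
  { replace Bz with (x - Az)%V by (rewrite <- E; vmod). pose proof (blk_add Hb x (- Az)%V) as H. rewrite blk_opp in H. exact H. }
  pose proof (blk_ge0 Az). pose proof (blk_ge0 x). nra.
Qed.
End Block.

Lemma Cmod_lt_of_sqr a r : 0 < r -> Re a ^ 2 + Im a ^ 2 < r ^ 2 -> Cmod a < r.
Proof.
  intros Hr H. rewrite <- Cmod_sqr in H. pose proof (Cmod_ge0 a). nra.
Qed.

(* As k0 grows, |c - (y0 -+ k0)| behaves like k0 +- (Re c - y0) *)
Lemma separate_center c y0 delta eta : 0 <= eta < delta -> delta <= Rabs (Re c - y0) ->
  exists k1, forall k0, k1 <= k0 ->
    (y0 < Re c -> Cmod (RtoC (y0 + k0) - c)%C + eta < Cmod (RtoC (y0 - k0) - c)%C - eta) /\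
    (Re c < y0 -> Cmod (RtoC (y0 - k0) - c)%C + eta < Cmod (RtoC (y0 + k0) - c)%C - eta).
Proof.
  intros He Hd. destruct c as [r s]. simpl in *.
  (* With u = |Re c - y0|, the squares of k0 + u - 2 eta and k0 - u differ by 4 (k0 - eta)(u - eta),
     which has to exceed s^2; k1 ensures (delta - eta)(k0 - eta) >= s^2 + 1. *)
  set (k1 := eta + (s ^ 2 + 1) / (delta - eta)).
  assert (Hq : 0 < (s ^ 2 + 1) / (delta - eta)) by (apply Rdiv_lt_0_compat; nra).
  exists k1. intros k0 Hk.
  assert (Hk2 : s ^ 2 + 1 <= (delta - eta) * (k0 - eta)).
  { apply Rle_trans with ((delta - eta) * ((s ^ 2 + 1) / (delta - eta))); [right; field; lra|].
    apply Rmult_le_compat_l; [lra|]. unfold k1 in Hk. lra. }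
  assert (Hk3 : eta < k0) by (unfold k1 in Hk; lra).
  split; intro Hr.
  - rewrite Rabs_pos_eq in Hd by lra.
    pose proof (Re_le_Cmod (RtoC (y0 - k0) - mkC r s)%C) as G. simpl in G.
    rewrite Rabs_left in G by lra.
    assert (H : Cmod (RtoC (y0 + k0) - mkC r s)%C < k0 + (r - y0) - 2 * eta); [|lra].
    apply Cmod_lt_of_sqr; [lra|]. simpl. simpl in Hk2.
    assert ((delta - eta) * (k0 - eta) <= (r - y0 - eta) * (k0 - eta)) by (apply Rmult_le_compat_r; lra).
    nra.
  - rewrite Rabs_left in Hd by lra.
    pose proof (Re_le_Cmod (RtoC (y0 + k0) - mkC r s)%C) as G. simpl in G.
    rewrite Rabs_pos_eq in G by lra.
    assert (H : Cmod (RtoC (y0 - k0) - mkC r s)%C < k0 + (y0 - r) - 2 * eta); [|lra].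
    apply Cmod_lt_of_sqr; [lra|]. simpl. simpl in Hk2.
    assert ((delta - eta) * (k0 - eta) <= (y0 - r - eta) * (k0 - eta)) by (apply Rmult_le_compat_r; lra).
    nra.
Qed.

Fixpoint esum (l : list block) (x : V) : V :=
  match l with nil => vzero | b :: l => (bE b x + esum l x)%V end.
(** The spectral projection onto the half-plane Re > y0. *)
Fixpoint upper_sum (y0 : R) (l : list block) (x : V) : V :=
  match l with
  | nil => vzero
  | b :: l => ((if Rlt_dec y0 (Re (bc b)) then bE b x else vzero) + upper_sum y0 l x)%V
  end.

(** * The half-plane projection as a limit of rational functions *)

Section Invariance.
Variables (eta delta y0 : R) (l : list block).
Hypothesis Heta : 0 <= eta < delta.
Hypothesis Hl : forall b, In b l -> is_block eta b.
Hypothesis Hgap : forall b, In b l -> delta <= Rabs (Re (bc b) - y0).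
Hypothesis Hsum : forall x, esum l x = x.

(** Every centre is at distance at least delta from the line, so on each block lam - T is bounded
    below by delta - eta in the adapted seminorm; the blocks are summed with [Hsum]. *)
Lemma line_lower_bound : exists kap, 0 < kap /\ forall lam x, Re lam = y0 -> kap * vnorm x <= vnorm (shift lam T x).
Proof.
  assert (G : forall l', (forall b, In b l' -> In b l) -> exists K, 0 <= K /\
     forall lam x, Re lam = y0 -> vnorm (esum l' x) <= K * vnorm (shift lam T x)).
  { induction l' as [|b l' IH]; intro Hin.
    - exists 0. split; [lra|]. intros. simpl. rewrite vnorm_0. lra.
    - destruct IH as [K [HK0 HK]]; [intros; apply Hin; right; assumption|].
      assert (Hb : In b l) by (apply Hin; left; reflexivity).
      destruct (blk_bd (Hl Hb)) as [Kb [HKb0 HKb]].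
      assert (Hi : 0 < / (delta - eta)) by (apply Rinv_0_lt_compat; lra).
      exists (/ (delta - eta) * Kb + K). split; [nra|]. intros lam x Hlam. simpl esum.
      pose proof (vnorm_triangle (bE b x) (esum l' x)). specialize (HK lam x Hlam).
      assert (vnorm (bE b x) <= / (delta - eta) * Kb * vnorm (shift lam T x)); [|lra].
      eapply Rle_trans; [apply (blk_E (Hl Hb))|].
      pose proof (blk_lower (Hl Hb) lam x) as L. specialize (HKb (shift lam T x)).
      pose proof (Re_le_Cmod (lam - bc b)%C) as R1. simpl in R1. rewrite Hlam in R1.
      pose proof (Hgap Hb) as R2. replace (y0 + - Re (bc b)) with (- (Re (bc b) - y0)) in R1 by ring.
      rewrite Rabs_Ropp in R1. pose proof (blk_ge0 (Hl Hb) x).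
      apply Rmult_le_reg_l with (delta - eta); [lra|].
      replace ((delta - eta) * (/ (delta - eta) * Kb * vnorm (shift lam T x))) with (Kb * vnorm (shift lam T x)) by (field; lra).
      apply Rle_trans with ((Cmod (lam - bc b)%C - eta) * bN b x); [apply Rmult_le_compat_r; lra|lra]. }
  destruct (G l (fun b H => H)) as [K [HK0 HK]].
  exists (/ (K + 1)). split; [apply Rinv_0_lt_compat; lra|]. intros lam x Hlam. specialize (HK lam x Hlam).
  rewrite Hsum in HK. pose proof (vnorm_ge0 (shift lam T x)).
  apply Rmult_le_reg_l with (K + 1); [lra|]. rewrite <- Rmult_assoc, Rinv_r by lra. lra.
Qed.

Lemma separate_centers : exists k0, 0 < k0 /\ forall b, In b l ->
    (y0 < Re (bc b) -> Cmod (RtoC (y0 + k0) - bc b)%C + eta < Cmod (RtoC (y0 - k0) - bc b)%C - eta) /\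
    (Re (bc b) < y0 -> Cmod (RtoC (y0 - k0) - bc b)%C + eta < Cmod (RtoC (y0 + k0) - bc b)%C - eta).
Proof.
  assert (G : forall l', (forall b, In b l' -> In b l) -> exists k1, forall k0, k1 <= k0 -> forall b, In b l' ->
    (y0 < Re (bc b) -> Cmod (RtoC (y0 + k0) - bc b)%C + eta < Cmod (RtoC (y0 - k0) - bc b)%C - eta) /\
    (Re (bc b) < y0 -> Cmod (RtoC (y0 - k0) - bc b)%C + eta < Cmod (RtoC (y0 + k0) - bc b)%C - eta)).
  { induction l' as [|b l' IH]; intro Hin.
    - exists 0. intros k0 _ b [].
    - destruct IH as [k1 Hk1]; [intros; apply Hin; right; assumption|].
      destruct (separate_center Heta (Hgap (Hin b (or_introl eq_refl)))) as [k2 Hk2].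
      exists (Rmax k1 k2). intros k0 Hk b' [<-|Hb'].
      + apply Hk2. eapply Rle_trans; [apply Rmax_r|exact Hk].
      + apply Hk1; [|exact Hb']. eapply Rle_trans; [apply Rmax_l|exact Hk]. }
  destruct (G l (fun b H => H)) as [k1 Hk1]. exists (Rmax k1 1). split; [|apply Hk1, Rmax_l].
  apply Rlt_le_trans with 1; [lra|apply Rmax_r].
Qed.

Lemma upper_sum_approx l' x y eps : (forall b, In b l' -> In b l) ->
  (forall b, In b l' -> y0 < Re (bc b) -> bN b (x - y)%V < eps) ->
  (forall b, In b l' -> Re (bc b) < y0 -> bN b y < eps) ->
  vnorm (upper_sum y0 l' x - esum l' y)%V <= INR (length l') * eps.
Proof.
  induction l' as [|b l' IH]; intros Hin HU HL.
  - simpl. rewrite vadd_opp, vnorm_0. lra.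
  - assert (IH' : vnorm (upper_sum y0 l' x - esum l' y)%V <= INR (length l') * eps).
    { apply IH; intros; [apply Hin|apply HU|apply HL]; auto; right; assumption. }
    assert (Hb : In b l) by (apply Hin; left; reflexivity).
    simpl length. rewrite S_INR. simpl.
    destruct (Rlt_dec y0 (Re (bc b))) as [H|H].
    + replace (bE b x + upper_sum y0 l' x - (bE b y + esum l' y))%V
        with (bE b (x - y) + (upper_sum y0 l' x - esum l' y))%V by (autorewrite with lin; vmod).
      pose proof (vnorm_triangle (bE b (x - y)) (upper_sum y0 l' x - esum l' y))%V.
      pose proof (blk_E (Hl Hb) (x - y)%V). specialize (HU b (or_introl eq_refl) H). lra.
    + replace (vzero + upper_sum y0 l' x - (bE b y + esum l' y))%V
        with ((upper_sum y0 l' x - esum l' y) - bE b y)%V by vmod.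
      pose proof (vnorm_sub_le (upper_sum y0 l' x - esum l' y) (bE b y))%V.
      pose proof (blk_E (Hl Hb) y).
      assert (Hlt : Re (bc b) < y0).
      { pose proof (Hgap Hb) as G. apply Rnot_lt_le in H. destruct H as [H|H]; [exact H|].
        rewrite H, Rminus_diag, Rabs_R0 in G. lra. }
      specialize (HL b (or_introl eq_refl) Hlt). lra.
Qed.

(** Solve (A^m + B^m) z = x in W, the pencil with w = -1, and put y = B^m z. To the right of the
    line A^m z = x - y is negligible, to the left y is, so y tends to the projection of x while
    staying in W. If the projection vanishes, y tends to 0 and the seminorm of x on a right-hand
    block is at most that of x - y plus K |y|, hence 0. *)
Theorem upper_sum_invariant (W : V -> Prop) x : vsubspace W -> vclosed W -> (forall x, W x -> W (T x)) -> W x ->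
  W (upper_sum y0 l x) /\ (upper_sum y0 l x = vzero -> forall b, In b l -> y0 < Re (bc b) -> bN b x = 0).
Proof.
  intros HW HC HT Hx. destruct line_lower_bound as [kap [Hkap Hlow]].
  pose proof (shift_surj_line HW HC HT Hkap Hlow) as Hs.
  destruct separate_centers as [k0 [Hk0 Hsep]].
  set (A := shift (RtoC (y0 + k0)) T). set (B := shift (RtoC (y0 - k0)) T).
  assert (Approx : forall eps, 0 < eps -> exists y, W y /\
     (forall b, In b l -> y0 < Re (bc b) -> bN b (x - y)%V < eps) /\
     (forall b, In b l -> Re (bc b) < y0 -> bN b y < eps)).
  { intros eps He.
    assert (G : forall l', (forall b, In b l' -> In b l) -> exists M, forall m z, (M <= m)%nat ->
       (bpow A m z + bpow B m z)%V = x -> forall b, In b l' ->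
       (y0 < Re (bc b) -> bN b (bpow A m z) < eps) /\ (Re (bc b) < y0 -> bN b (bpow B m z) < eps)).
    { induction l' as [|b l' IH]; intro Hin.
      - exists O. intros m z _ _ b [].
      - destruct IH as [M HM]; [intros; apply Hin; right; assumption|].
        assert (Hb : In b l) by (apply Hin; left; reflexivity). destruct (Hsep b Hb) as [S1 S2].
        destruct (Rlt_le_dec y0 (Re (bc b))) as [H|H].
        + destruct (blk_dominated (Hl Hb) x (proj1 Heta) He (S1 H)) as [M2 HM2].
          exists (max M M2). intros m z Hm E b' [<-|Hb'].
          * split; [|lra]. intros _. apply (HM2 m z); [lia|exact E].
          * apply (HM m z); [lia|exact E|exact Hb'].
        + assert (Hlt : Re (bc b) < y0).
          { pose proof (Hgap Hb) as G. destruct H as [H|H]; [exact H|]. rewrite H, Rminus_diag, Rabs_R0 in G. lra. }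
          destruct (blk_dominated (Hl Hb) x (proj1 Heta) He (S2 Hlt)) as [M2 HM2].
          exists (max M M2). intros m z Hm E b' [<-|Hb'].
          * split; [lra|]. intros _. apply (HM2 m z); [lia|]. rewrite vadd_comm. exact E.
          * apply (HM m z); [lia|exact E|exact Hb']. }
    destruct (G l (fun b H => H)) as [M HM].
    destruct (@pencil_surj W y0 k0 HW HT Hk0 Hs M (- C1)%C x) as [z [Hz E]]; [rewrite Cmod_opp; apply Cmod_1|exact Hx|].
    fold A B in E. set (m := (2 ^ M)%nat) in *.
    assert (E' : (bpow A m z + bpow B m z)%V = x) by (rewrite <- E; vmod).
    assert (Hm : (M <= m)%nat) by (apply Nat.lt_le_incl, Nat.pow_gt_lin_r; lia).
    exists (bpow B m z). split; [|split].
    - clear - HW HT Hz. induction m as [|m IH]; [exact Hz|]. rewrite bpow_S. unfold B at 1. rewrite shift_app.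
      apply vsub_sub; auto. apply vsub_scal; auto.
    - intros b Hb Hu. replace (x - bpow B m z)%V with (bpow A m z) by (rewrite <- E'; vmod). apply (HM m z Hm E' b Hb), Hu.
    - intros b Hb Hu. apply (HM m z Hm E' b Hb), Hu. }
  assert (Conv : forall eps, 0 < eps -> exists y, W y /\ vnorm (upper_sum y0 l x - y)%V < eps /\
     forall b, In b l -> y0 < Re (bc b) -> bN b (x - y)%V < eps).
  { intros eps He. pose proof (pos_INR (length l)).
    assert (He' : 0 < eps / (INR (length l) + 1)) by (apply Rdiv_lt_0_compat; lra).
    destruct (Approx _ He') as [y [Hy [HU HL]]]. exists y. split; [exact Hy|].
    pose proof (upper_sum_approx (fun b H => H) HU HL) as U. rewrite Hsum in U.
    assert (Hlt : INR (length l) * (eps / (INR (length l) + 1)) < eps).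
    { apply Rlt_le_trans with ((INR (length l) + 1) * (eps / (INR (length l) + 1))); [lra|right; field; lra]. }
    split; [lra|]. intros b Hb Hu. specialize (HU b Hb Hu).
    apply Rlt_le_trans with (eps / (INR (length l) + 1)); [exact HU|].
    apply Rmult_le_reg_r with (INR (length l) + 1); [lra|]. unfold Rdiv. rewrite Rmult_assoc, Rinv_l; nra. }
  split.
  - apply HC. intros eps He. destruct (Conv eps He) as [y [Hy [Hn _]]]. exists y. auto.
  - intros E0 b Hb Hu. destruct (blk_bd (Hl Hb)) as [K [HK0 HK]].
    apply Rle_antisym; [|apply (blk_ge0 (Hl Hb))]. apply Rnot_lt_le. intro Hpos.
    set (eps := bN b x / (2 * (K + 1))).
    assert (He : 0 < eps) by (apply Rdiv_lt_0_compat; lra).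
    destruct (Conv eps He) as [y [_ [Hn HN]]]. specialize (HN b Hb Hu).
    rewrite E0 in Hn. replace (vzero - y)%V with (- y)%V in Hn by vmod. rewrite vnorm_opp in Hn.
    pose proof (blk_add (Hl Hb) (x - y)%V y) as S. replace (x - y + y)%V with x in S by vmod.
    specialize (HK y). pose proof (vnorm_ge0 y).
    assert (K * vnorm y <= K * eps) by (apply Rmult_le_compat_l; lra).
    assert ((K + 1) * eps = bN b x / 2) by (unfold eps; field; lra). lra.
Qed.
End Invariance.
End HalfPlane.

(** * The spectrum of ad a *)

Lemma Rabs_bounds x y : Rabs x <= y -> - y <= x <= y.
Proof. intro H. pose proof (Rle_abs x). pose proof (Rle_abs (- x)) as G. rewrite Rabs_Ropp in G. lra. Qed.

Lemma interval_avoiding (l : list R) a b : a < b ->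
  exists a' b', a <= a' /\ a' < b' /\ b' <= b /\ forall x, In x l -> ~ (a' < x < b').
Proof.
  intro H. induction l as [|x l IH].
  - exists a, b. repeat split; try lra. intros x [].
  - destruct IH as [a' [b' [H1 [H2 [H3 H4]]]]].
    destruct (Rlt_dec a' x) as [Hx|Hx]; [destruct (Rlt_dec x b') as [Hx'|Hx']|].
    + exists a', x. repeat split; try lra. intros z [<-|Hz]; [lra|]. specialize (H4 z Hz). lra.
    + exists a', b'. repeat split; try lra. intros z [<-|Hz]; [lra|auto].
    + exists a', b'. repeat split; try lra. intros z [<-|Hz]; [lra|auto].
Qed.

(* Differences of points of a set whose only limit point is 0 accumulate only at points of the set and
   their opposites: avoid these first, and then finitely many remaining differences *)
Lemma difference_gap (Sg : C -> Prop) (u : C) r : Cmod u = 1 -> 0 < r ->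
  (forall eps, 0 < eps -> exists ms, forall nu, Sg nu -> eps <= Cmod nu -> In nu ms) ->
  exists y0 delta, 0 < y0 < r /\ 0 < delta /\
    forall mu nu, Sg mu -> Sg nu -> delta <= Rabs (Re (u * (mu - nu))%C - y0).
Proof.
  intros Hu Hr Hfin. set (f := fun z => Re (u * z)%C).
  assert (Hf : forall z, Rabs (f z) <= Cmod z).
  { intro z. unfold f. eapply Rle_trans; [apply Re_le_Cmod|]. rewrite Cmod_mul, Hu. lra. }
  assert (Hsub : forall y z, f (y - z)%C = f y - f z) by (intros; unfold f; simpl; ring).
  (* Points of modulus below r / 2 have |f| < r / 2 and miss the interval by themselves; only
     finitely many others remain. *)
  destruct (Hfin (r / 2)) as [ms1 Hms1]; [lra|].
  destruct (@interval_avoiding (map f ms1 ++ map (fun z => - f z) ms1) (r / 2) r) as [a [b [H1 [H2 [H3 H4]]]]]; [lra|].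
  assert (Free : forall nu, Sg nu -> ~ (a < f nu < b) /\ ~ (a < - f nu < b)).
  { intros nu Hnu. pose proof (Hf nu) as Hn.
    destruct (Rle_lt_dec (r / 2) (Cmod nu)) as [L|L].
    - specialize (Hms1 nu Hnu L). split; apply H4; apply in_or_app; [left|right].
      + apply in_map, Hms1.
      + apply (in_map (fun z => - f z)), Hms1.
    - apply Rabs_bounds in Hn. split; lra. }
  (* If one of mu, nu has modulus below d, the difference is within d of f mu or of - f nu, which
     avoid (a, b); such differences avoid (a + d, b - d). All other pairs come from a finite
     list. *)
  set (d := (b - a) / 3).
  destruct (Hfin d) as [ms2 Hms2]; [unfold d; lra|].
  destruct (@interval_avoiding (flat_map (fun mu => map (fun nu => f (mu - nu)%C) ms2) ms2) (a + d) (b - d))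
    as [a2 [b2 [G1 [G2 [G3 G4]]]]]; [unfold d; lra|].
  exists ((a2 + b2) / 2), ((b2 - a2) / 2). split; [unfold d in *; lra|]. split; [lra|].
  intros mu nu Hmu Hnu. apply Rnot_lt_le. intro L. apply Rabs_def2 in L. fold (f (mu - nu)%C) in L.
  pose proof (Hf mu) as Am. pose proof (Hf nu) as An. apply Rabs_bounds in Am. apply Rabs_bounds in An.
  destruct (Free mu Hmu) as [F1 _]. destruct (Free nu Hnu) as [_ F2].
  destruct (Rle_lt_dec d (Cmod mu)) as [Lm|Lm]; [destruct (Rle_lt_dec d (Cmod nu)) as [Ln|Ln]|].
  - apply (G4 (f (mu - nu)%C)); [|lra]. apply in_flat_map. exists mu. split; [apply Hms2; auto|].
    apply (in_map (fun nu => f (mu - nu)%C)). apply Hms2; auto.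
  - rewrite Hsub in L. apply F1. unfold d in *; lra.
  - rewrite Hsub in L. apply F2. unfold d in *; lra.
Qed.

Lemma finite_rank_zero (X : CBanach) : is_finite_rank (@bzero X).
Proof. exists nil. intro x. exists nil. auto. Qed.

Lemma lincomb_app (X : CBanach) cs ds (vs ws : list X) : length cs = length vs ->
  lincomb (cs ++ ds) (vs ++ ws) = (lincomb cs vs + lincomb ds ws)%V.
Proof.
  revert vs. induction cs as [|c cs IH]; intros [|v vs] H; try discriminate; simpl.
  - vmod.
  - rewrite IH by (injection H; auto). apply vadd_assoc.
Qed.

Lemma finite_rank_add (X : CBanach) (S T : bop X) : is_finite_rank S -> is_finite_rank T -> is_finite_rank (badd S T).
Proof.
  intros [vs Hv] [ws Hw]. exists (vs ++ ws). intro x. destruct (Hv x) as [cs [Lc Ec]]. destruct (Hw x) as [ds [Ld Ed]].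
  exists (cs ++ ds). split; [rewrite !length_app; congruence|].
  rewrite badd_app, Ec, Ed, lincomb_app; auto.
Qed.

Lemma finite_rank_comp_l (X : CBanach) (S T : bop X) : is_finite_rank T -> is_finite_rank (bcomp S T).
Proof.
  intros [vs Hv]. exists (map S vs). intro x. destruct (Hv x) as [cs [Lc Ec]]. exists cs.
  split; [rewrite length_map; exact Lc|]. rewrite bcomp_app, Ec. clear. revert vs.
  induction cs as [|c cs IH]; intros [|v vs]; simpl; rewrite ?bop_zero; auto.
  rewrite bop_add, bop_scal, IH. reflexivity.
Qed.

Lemma finite_rank_comp_r (X : CBanach) (S T : bop X) : is_finite_rank S -> is_finite_rank (bcomp S T).
Proof. intros [vs Hv]. exists vs. intro x. apply (Hv (T x)). Qed.

(** * Blocks for ad a *)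

Section Adjoint.
Variable X : CBanach.
Variable a : bop X.

Lemma opnorm_bcomp (S T : bop X) : opnorm (bcomp S T) <= opnorm S * opnorm T.
Proof.
  pose proof (opnorm_ge0 S). pose proof (opnorm_ge0 T). apply opnorm_le; [nra|]. intro x. rewrite bcomp_app.
  pose proof (bop_norm S (T x)). pose proof (bop_norm T x). nra.
Qed.

Lemma ad_bop : @is_bop (BX X) (fun Y : bop X => bsub (bcomp a Y) (bcomp Y a)).
Proof.
  split; [split|].
  - intros Y Z. apply bop_eq. intro x. autorewrite with lin. vmod.
  - intros c Y. apply bop_eq. intro x. autorewrite with lin. vmod.
  - exists (2 * opnorm a). intro Y. change (opnorm (bsub (bcomp a Y) (bcomp Y a)) <= 2 * opnorm a * opnorm Y).
    pose proof (opnorm_ge0 a). pose proof (opnorm_ge0 Y). apply opnorm_le; [nra|]. intro x.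
    autorewrite with lin. pose proof (vnorm_sub_le (a (Y x)) (Y (a x))).
    pose proof (bop_norm a (Y x)). pose proof (bop_norm Y x). pose proof (bop_norm Y (a x)). pose proof (bop_norm a x).
    pose proof (vnorm_ge0 x). nra.
Qed.
Definition ad : bop (BX X) := mkBop ad_bop.

Lemma ad_app (Y : bop X) x : @bfun X (ad Y) x = (a (Y x) - Y (a x))%V.
Proof. change (bsub (bcomp a Y) (bcomp Y a) x = (a (Y x) - Y (a x))%V). autorewrite with lin. reflexivity. Qed.

Section Pair.
Variable eta : R.
Hypothesis Heta : 0 < eta.
Variables (mu nu : C) (P Q : bop X).
Hypothesis CP : commutes a P.
Hypothesis CQ : commutes a Q.
Hypothesis BP : exists K, 0 <= K /\ forall n x, vnorm (bpow (shift mu a) n (P x)) <= K * eta ^ n * vnorm x.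
Hypothesis BQ : exists K, 0 <= K /\ forall n x, vnorm (bpow (shift nu a) n (Q x)) <= K * eta ^ n * vnorm x.

Let L j := bcomp (bpow (shift mu a) j) P.
Let R' k := bcomp (bpow (shift nu a) k) Q.
Let term j k (Y : bop X) := opnorm (bcomp (L j) (bcomp Y (R' k))) * / (eta ^ j * eta ^ k).

(** An adapted seminorm for Y -> P Y Q. [BP] and [BQ] make the supremum finite, the term j = k = 0
    is the norm of P Y Q, and raising an exponent by one costs a factor eta. *)
Definition pair_norm (Y : BX X) : R :=
  Rsup (fun r => exists j k, r = opnorm (bcomp (bcomp (bpow (shift mu a) j) P) (bcomp Y (bcomp (bpow (shift nu a) k) Q)))
                                * / (eta ^ j * eta ^ k)).

Lemma weight_pos j k : 0 < eta ^ j * eta ^ k.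
Proof. apply Rmult_lt_0_compat; apply pow_lt, Heta. Qed.

Lemma pair_term_bound : exists K, 0 <= K /\ forall j k Y, term j k Y <= K * opnorm Y.
Proof.
  destruct BP as [K [HK0 HK]]. destruct BQ as [M [HM0 HM]]. exists (K * M). split; [nra|]. intros j k Y.
  pose proof (weight_pos j k) as Hw. unfold term.
  apply Rmult_le_reg_r with (eta ^ j * eta ^ k); [exact Hw|]. rewrite Rmult_assoc, Rinv_l, Rmult_1_r by lra.
  pose proof (pow_lt eta j Heta). pose proof (pow_lt eta k Heta). pose proof (opnorm_ge0 Y) as HY.
  assert (HL : opnorm (L j) <= K * eta ^ j) by (apply opnorm_le; [nra|intro x; apply HK]).
  assert (HR : opnorm (R' k) <= M * eta ^ k) by (apply opnorm_le; [nra|intro x; apply HM]).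
  eapply Rle_trans; [apply opnorm_bcomp|].
  apply Rle_trans with (K * eta ^ j * (opnorm Y * (M * eta ^ k))); [|right; ring].
  apply Rmult_le_compat; auto using opnorm_ge0.
  eapply Rle_trans; [apply opnorm_bcomp|]. apply Rmult_le_compat_l; auto.
Qed.

Lemma pair_term_le j k (Y : bop X) : term j k Y <= pair_norm Y.
Proof.
  destruct pair_term_bound as [K [_ HK]]. apply Rsup_ub with (K * opnorm Y).
  - intros r [j' [k' ->]]. apply HK.
  - exists j, k. reflexivity.
Qed.

Lemma pair_norm_le (Y : bop X) B : 0 <= B -> (forall j k, term j k Y <= B) -> pair_norm Y <= B.
Proof. intros HB H. apply Rsup_le; [exact HB|]. intros r [j [k ->]]. apply H. Qed.

Lemma term_ge0 j k Y : 0 <= term j k Y.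
Proof. apply Rmult_le_pos; [apply opnorm_ge0|]. left. apply Rinv_0_lt_compat, weight_pos. Qed.

Lemma pair_norm_ge0 Y : 0 <= pair_norm Y.
Proof. eapply Rle_trans; [apply (@term_ge0 0 0 Y)|apply pair_term_le]. Qed.

Lemma term_add j k (Y Z : bop X) : term j k (badd Y Z) <= term j k Y + term j k Z.
Proof.
  unfold term. rewrite <- Rmult_plus_distr_r. apply Rmult_le_compat_r; [left; apply Rinv_0_lt_compat, weight_pos|].
  eapply Rle_trans; [|apply opnorm_badd]. right. f_equal. f_equal. apply bop_eq. intro x. autorewrite with lin. reflexivity.
Qed.

Lemma term_scal j k c (Y : bop X) : term j k (bscal c Y) = Cmod c * term j k Y.
Proof.
  unfold term. rewrite <- Rmult_assoc, <- opnorm_bscal. f_equal. f_equal. f_equal. apply bop_eq. intro x. autorewrite with lin. reflexivity.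
Qed.

Definition pair_block : block (BX X).
Proof.
  refine (@mkBlock (BX X) (mu - nu)%C (@mkBop (BX X) (fun Y : bop X => bcomp P (bcomp Y Q)) _) pair_norm).
  split; [split|].
  - intros Y Z. apply bop_eq. intro x. autorewrite with lin. reflexivity.
  - intros c Y. apply bop_eq. intro x. autorewrite with lin. reflexivity.
  - exists (opnorm P * opnorm Q). intro Y. change (opnorm (bcomp P (bcomp Y Q)) <= opnorm P * opnorm Q * opnorm Y).
    pose proof (opnorm_bcomp P (bcomp Y Q)). pose proof (opnorm_bcomp Y Q). pose proof (opnorm_ge0 P). nra.
Defined.

Lemma pair_block_spec : is_block ad (2 * eta) pair_block.
Proof.
  split.
  - destruct pair_term_bound as [K [HK0 HK]]. exists K. split; [exact HK0|]. intro Y.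
    apply pair_norm_le; [pose proof (opnorm_ge0 Y); simpl; nra|]. intros; apply HK.
  - intro Y. eapply Rle_trans; [|apply (pair_term_le 0 0)]. unfold term. simpl.
    replace (/ (1 * 1)) with 1 by field. rewrite Rmult_1_r. right. reflexivity.
  - intros Y Z. change (pair_norm (badd Y Z) <= pair_norm Y + pair_norm Z).
    apply pair_norm_le; [pose proof (pair_norm_ge0 Y); pose proof (pair_norm_ge0 Z); lra|].
    intros j k. pose proof (term_add j k Y Z). pose proof (pair_term_le j k Y). pose proof (pair_term_le j k Z). lra.
  - assert (G : forall c Y, pair_norm (bscal c Y) <= Cmod c * pair_norm Y).
    { intros c Y. pose proof (Cmod_ge0 c). pose proof (pair_norm_ge0 Y). apply pair_norm_le; [nra|]. intros j k. rewrite term_scal.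
      apply Rmult_le_compat_l; [lra|apply pair_term_le]. }
    intros c Y. change (pair_norm (bscal c Y) = Cmod c * pair_norm Y). apply Rle_antisym; [apply G|].
    destruct (classic (c = C0)) as [->|Hc]; [rewrite Cmod_0, Rmult_0_l; apply pair_norm_ge0|].
    pose proof (G (Cinv c) (bscal c Y)) as H. rewrite Cmod_inv in H by exact Hc.
    replace (bscal (Cinv c) (bscal c Y)) with (Y : bop X) in H.
    + pose proof (Cmod_gt0 Hc). apply (Rmult_le_compat_l (Cmod c)) in H; [|lra].
      rewrite <- Rmult_assoc, Rinv_r in H; lra.
    + apply bop_eq. intro x. autorewrite with lin. vmod_goals; field; exact Hc.
  - intro Y. change (pair_norm (shift (mu - nu)%C ad Y) <= 2 * eta * pair_norm Y).
    pose proof (pair_norm_ge0 Y) as H0. apply pair_norm_le; [nra|]. intros j k.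
    (* (mu - nu) Y - ad a Y = (mu - a) Y - Y (nu - a): each summand raises one of the exponents j,
       k, whence the ratio 2 eta. *)
    assert (E : bcomp (L j) (bcomp (shift (mu - nu)%C ad Y : bop X) (R' k)) =
                badd (bcomp (L (S j)) (bcomp Y (R' k))) (bopp (bcomp (L j) (bcomp Y (R' (S k)))))).
    { apply bop_eq. intro x. unfold L, R'. autorewrite with lin. rewrite ad_app.
      rewrite (bpow_Sr (shift mu a)), bpow_S, !shift_app. autorewrite with lin. rewrite <- !CP. autorewrite with lin. vmod. }
    unfold term. rewrite E.
    pose proof (weight_pos j k) as Hw.
    apply Rmult_le_reg_r with (eta ^ j * eta ^ k); [exact Hw|]. rewrite Rmult_assoc, Rinv_l, Rmult_1_r by lra.
    eapply Rle_trans; [apply opnorm_badd|]. unfold bopp. rewrite opnorm_bscal, Cmod_opp, Cmod_1, Rmult_1_l.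
    pose proof (pair_term_le (S j) k Y) as T1. pose proof (pair_term_le j (S k) Y) as T2. unfold term in T1, T2.
    apply (Rmult_le_compat_r (eta ^ S j * eta ^ k)) in T1; [|left; apply weight_pos].
    apply (Rmult_le_compat_r (eta ^ j * eta ^ S k)) in T2; [|left; apply weight_pos].
    rewrite Rmult_assoc, Rinv_l, Rmult_1_r in T1 by (pose proof (weight_pos (S j) k); lra).
    rewrite Rmult_assoc, Rinv_l, Rmult_1_r in T2 by (pose proof (weight_pos j (S k)); lra).
    simpl pow in T1, T2. lra.
Qed.
End Pair.
End Adjoint.

(** Passing from T to u T turns the half-plane Re (u z) > y0 into Re z > y0, so the vertical line is
    the only case to be treated. The seminorm is unchanged because |u| = 1. *)
Definition rotate_block (V : CBanach) (u : C) (b : block V) : block V := mkBlock (u * bc b)%C (bE b) (bN b).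

Lemma rotate_block_spec (V : CBanach) (T : bop V) eta u b : Cmod u = 1 -> is_block T eta b ->
  is_block (bscal u T) eta (rotate_block u b).
Proof.
  intros Hu [H1 H2 H3 H4 H5]. split; auto.
  intro x. change (bN b (shift (u * bc b)%C (bscal u T) x) <= eta * bN b x). rewrite shift_app, bscal_app.
  replace (u * bc b * x - u * T x)%V with (u * shift (bc b) T x)%V by (rewrite shift_app; vmod).
  rewrite H4, Hu, Rmult_1_l. apply H5.
Qed.

Lemma esum_app (V : CBanach) (l m : list (block V)) x : esum (l ++ m) x = (esum l x + esum m x)%V.
Proof. induction l as [|b l IH]; simpl; [vmod|]. rewrite IH. apply vadd_assoc. Qed.

Lemma esum_rotate (V : CBanach) u (l : list (block V)) x : esum (map (rotate_block u) l) x = esum l x.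
Proof. induction l as [|b l IH]; simpl; [reflexivity|]. rewrite IH. reflexivity. Qed.

Lemma blk_pow_T (V : CBanach) (T : bop V) eta b n x : is_block T eta b -> 0 <= eta ->
  bN b (bpow T n x) <= (Cmod (bc b) + eta) ^ n * bN b x.
Proof.
  intros Hb He. pose proof (Cmod_ge0 (bc b)). induction n as [|n IH]; [simpl; lra|].
  rewrite bpow_S. pose proof (blk_upper Hb C0 (bpow T n x)) as U.
  replace (shift C0 T (bpow T n x)) with (- T (bpow T n x))%V in U by (rewrite shift_app; vmod).
  rewrite (blk_opp Hb), Cmod_sub_sym in U. replace (bc b - C0)%C with (bc b) in U by ring.
  eapply Rle_trans; [exact U|]. simpl. rewrite Rmult_assoc. apply Rmult_le_compat_l; lra.
Qed.

Lemma upper_sum_sub (V : CBanach) y0 (l : list (block V)) x y :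
  upper_sum y0 l (x - y)%V = (upper_sum y0 l x - upper_sum y0 l y)%V.
Proof.
  induction l as [|b l IH]; simpl; [vmod|]. rewrite IH.
  destruct (Rlt_dec y0 (Re (bc b))); rewrite ?bop_add, ?bop_opp; vmod.
Qed.

(** * Growth of the powers of ad a *)

Section AdGrowth.
Variable X : CBanach.
Variable a : bop X.
Hypothesis Ha : is_compact a.

Definition pair_blocks (eta : R) (l : list (C * bop X)) : list (block (BX X)) :=
  flat_map (fun p => map (fun q => pair_block a eta (fst p) (fst q) (snd p) (snd q)) l) l.

Lemma esum_row eta mu (P : bop X) l (Y : bop X) :
  esum (map (fun q => pair_block a eta mu (fst q) P (snd q)) l) Y = bcomp P (bcomp Y (bsum l)).
Proof.
  induction l as [|q l IH]; simpl.
  - apply bop_eq. intro x. autorewrite with lin. reflexivity.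
  - rewrite IH. apply bop_eq. intro x. autorewrite with lin. reflexivity.
Qed.

Lemma esum_pair_blocks eta l (Y : bop X) : (forall x, bsum l x = x) -> esum (pair_blocks eta l) Y = Y.
Proof.
  intro Hl. unfold pair_blocks.
  assert (G : forall m, esum (flat_map (fun p => map (fun q => pair_block a eta (fst p) (fst q) (snd p) (snd q)) l) m) Y
            = bcomp (bsum m) Y).
  { induction m as [|p m IH]; simpl.
    - apply bop_eq. intro x. reflexivity.
    - rewrite esum_app, IH, esum_row. apply bop_eq. intro x. autorewrite with lin. rewrite Hl. reflexivity. }
  rewrite G. apply bop_eq. intro x. apply Hl.
Qed.

(** One delta has to serve all directions, since eta and the partition of a depend on it. The
    existential stands before [In u us] so that [functional_choice] yields y as a total function of
    u. *)
Lemma difference_gaps (us : list C) r : 0 < r -> (forall u, In u us -> Cmod u = 1) ->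
  exists delta, 0 < delta /\ forall u, exists y0, In u us -> 0 < y0 < r /\
    forall mu nu, (mu = C0 \/ eigenvalue a mu) -> (nu = C0 \/ eigenvalue a nu) ->
      delta <= Rabs (Re (u * (mu - nu))%C - y0).
Proof.
  intros Hr. induction us as [|u us IH]; intro Hu.
  - exists 1. split; [lra|]. intro u. exists 0. intros [].
  - destruct IH as [d [Hd IH]]; [intros; apply Hu; right; assumption|].
    destruct (@difference_gap (fun mu => mu = C0 \/ eigenvalue a mu) u r) as [y [e [Hy [He H]]]]; auto.
    + apply Hu. left. reflexivity.
    + intros eps Hp. destruct (eigenvalues_finite Ha Hp) as [ms Hms]. exists ms. intros nu [->|Hnu] L.
      * rewrite Cmod_0 in L. lra.
      * apply Hms; assumption.
    + exists (Rmin d e). split; [apply Rmin_glb_lt; assumption|]. intro v.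
      destruct (classic (v = u)) as [->|Hv].
      * exists y. intros _. split; [exact Hy|]. intros mu nu Hmu Hnu. eapply Rle_trans; [apply Rmin_r|]. apply H; assumption.
      * destruct (IH v) as [y' Hy']. exists y'. intros [E|Hin]; [congruence|]. destruct (Hy' Hin) as [H1 H2].
        split; [exact H1|]. intros mu nu Hmu Hnu. eapply Rle_trans; [apply Rmin_l|]. apply H2; assumption.
Qed.

Lemma finite_rank_upper_sum y0 u (l : list (block (BX X))) (Y : bop X) :
  (forall b, In b l -> y0 < Re (u * bc b)%C -> is_finite_rank (@bfun X (bE b Y))) ->
  is_finite_rank (@bfun X (upper_sum y0 (map (rotate_block u) l) Y)).
Proof.
  induction l as [|b l IH]; intro H.
  - apply finite_rank_zero.
  - simpl map. simpl upper_sum. apply finite_rank_add.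
    + destruct (Rlt_dec y0 _) as [L|L]; [|apply finite_rank_zero]. apply H; [left; reflexivity|exact L].
    + apply IH. intros; apply H; [right; assumption|assumption].
Qed.

(* The maps F are spectral projections of ad a onto half-planes away from 0, one for each of the four
   directions; their joint kernel is a spectral subspace of ad a inside the disc of radius r *)
Theorem ad_growth r : 0 < r -> exists (Fs : list (BX X -> BX X)) K, 0 <= K /\
  (forall F, In F Fs -> forall Y Z, F (Y - Z)%V = (F Y - F Z)%V) /\
  (forall F, In F Fs -> forall Y, is_finite_rank (@bfun X (F Y))) /\
  (forall F, In F Fs -> forall W : BX X -> Prop, vsubspace W -> vclosed W -> (forall Y, W Y -> W (ad a Y)) ->
     forall Y, W Y -> W (F Y)) /\
  (forall Y, (forall F, In F Fs -> F Y = vzero) -> forall n, vnorm (bpow (ad a) n Y) <= K * r ^ n * vnorm Y).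
Proof.
  intro Hr. set (us := C1 :: (- C1)%C :: mkC 0 1 :: mkC 0 (-1) :: nil).
  assert (Hus : forall u, In u us -> Cmod u = 1).
  { assert (Ci : Cmod (mkC 0 1) = 1).
    { unfold Cmod; simpl. replace (0 * (0 * 1) + 1 * (1 * 1)) with 1 by ring. apply sqrt_1. }
    intros u [<-|[<-|[<-|[<-|[]]]]].
    - apply Cmod_1.
    - rewrite Cmod_opp. apply Cmod_1.
    - exact Ci.
    - rewrite <- Ci, <- Cmod_opp. f_equal. apply C_eq; simpl; ring. }
  destruct (@difference_gaps us (r / 4)) as [delta [Hdelta Hgap]]; [lra|exact Hus|].
  destruct (functional_choice Hgap) as [y Hy]. clear Hgap.
  (* 2 eta < delta keeps the blocks off the lines. The lines pass within r / 4 of 0, so the centres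
     left over have modulus at most r / 2, and r / 2 + 2 eta < r. *)
  set (eta := Rmin (delta / 4) (r / 8)).
  assert (Heta : 0 < eta) by (apply Rmin_glb_lt; lra).
  assert (Heta1 : eta <= delta / 4) by apply Rmin_l.
  assert (Heta2 : eta <= r / 8) by apply Rmin_r.
  destruct (spectral_partition Ha Heta) as [l [Hsum Hl]].
  set (bs := pair_blocks eta l).
  assert (Hbs : forall b, In b bs -> exists mu P nu Q, In (mu, P) l /\ In (nu, Q) l /\ b = pair_block a eta mu nu P Q).
  { intros b Hb. unfold bs, pair_blocks in Hb. apply in_flat_map in Hb. destruct Hb as [[mu P] [Hp Hb]].
    apply in_map_iff in Hb. destruct Hb as [[nu Q] [<- Hq]]. exists mu, P, nu, Q. auto. }
  assert (Hblk : forall b, In b bs -> is_block (ad a) (2 * eta) b).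
  { intros b Hb. destruct (Hbs b Hb) as [mu [P [nu [Q [Hp [Hq ->]]]]]].
    destruct (Hl mu P Hp) as [C1' [B1 _]]. destruct (Hl nu Q Hq) as [C2' [B2 _]].
    apply pair_block_spec; assumption. }
  assert (Hspec : forall mu P, In (mu, P) l -> mu = C0 \/ eigenvalue a mu).
  { intros mu P Hp. destruct (Hl mu P Hp) as [_ [_ [H|[H _]]]]; auto. }
  assert (Hcen : forall u b, In u us -> In b bs -> delta <= Rabs (Re (u * bc b)%C - y u)).
  { intros u b Hu Hb. destruct (Hbs b Hb) as [mu [P [nu [Q [Hp [Hq ->]]]]]].
    apply (Hy u Hu); [apply (Hspec mu P Hp)|apply (Hspec nu Q Hq)]. }
  assert (HbsSum : forall Y : BX X, esum bs Y = Y) by (intro Y; apply esum_pair_blocks, Hsum).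
  assert (Inv : forall u, In u us -> forall W : BX X -> Prop, vsubspace W -> vclosed W -> (forall Y, W Y -> W (ad a Y)) ->
     forall Y, W Y -> W (upper_sum (y u) (map (rotate_block u) bs) Y) /\
       (upper_sum (y u) (map (rotate_block u) bs) Y = vzero -> forall b, In b bs -> y u < Re (u * bc b)%C -> bN b Y = 0)).
  { intros u Hu W HW HC HT Y HY.
    destruct (@upper_sum_invariant (BX X) (bscal u (ad a)) (2 * eta) delta (y u) (map (rotate_block u) bs)) with (W := W) (x := Y) as [I1 I2]; auto.
    - lra.
    - intros b Hb. apply in_map_iff in Hb. destruct Hb as [b' [<- Hb']]. apply rotate_block_spec; auto.
    - intros b Hb. apply in_map_iff in Hb. destruct Hb as [b' [<- Hb']]. simpl. apply Hcen; assumption.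
    - intro Z. rewrite esum_rotate. apply HbsSum.
    - intros Z HZ. rewrite bscal_app. apply vsub_scal; auto.
    - split; [exact I1|]. intros E b Hb L. apply (I2 E (rotate_block u b)); [apply in_map, Hb|exact L]. }
  assert (HK : exists K, 0 <= K /\ forall Y, (forall u, In u us -> upper_sum (y u) (map (rotate_block u) bs) Y = vzero) ->
     forall n, vnorm (bpow (ad a) n Y) <= K * r ^ n * vnorm Y).
  { assert (G : forall m, (forall b, In b m -> In b bs) -> exists K, 0 <= K /\
      forall Y, (forall u, In u us -> upper_sum (y u) (map (rotate_block u) bs) Y = vzero) ->
      forall n, vnorm (esum m (bpow (ad a) n Y)) <= K * r ^ n * vnorm Y).
    { induction m as [|b m IH]; intro Hin.
      - exists 0. split; [lra|]. intros. change (vnorm (vzero : BX X) <= 0 * r ^ n * vnorm Y). rewrite vnorm_0. lra.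
      - destruct IH as [K [HK0 HK]]; [intros; apply Hin; right; assumption|].
        assert (Hb : In b bs) by (apply Hin; left; reflexivity).
        destruct (blk_bd (Hblk b Hb)) as [M [HM0 HM]]. exists (M + K). split; [lra|]. intros Y HY n.
        specialize (HK Y HY n).
        change (vnorm (bE b (bpow (ad a) n Y) + esum m (bpow (ad a) n Y))%V <= (M + K) * r ^ n * vnorm Y).
        pose proof (vnorm_triangle (bE b (bpow (ad a) n Y)) (esum m (bpow (ad a) n Y))) as T1.
        pose proof (blk_E (Hblk b Hb) (bpow (ad a) n Y)) as T2.
        pose proof (@blk_pow_T _ (ad a) (2 * eta) b n Y (Hblk b Hb) ltac:(lra)) as T3.
        assert (T4 : bN b (bpow (ad a) n Y) <= M * r ^ n * vnorm Y); [|lra].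
        specialize (HM Y). pose proof (vnorm_ge0 Y). pose proof (pow_le r n ltac:(lra)).
        destruct (classic (bN b Y = 0)) as [E|E].
        + rewrite E, Rmult_0_r in T3. eapply Rle_trans; [exact T3|]. apply Rmult_le_pos; [nra|lra].
        (* A block on which Y does not vanish has its centre in none of the four half-planes. Here
           [Inv] is used on the whole space, for its second clause. *)
        + assert (Box : forall u, In u us -> Re (u * bc b)%C <= r / 4).
          { intros u Hu. apply Rnot_lt_le. intro L. apply E.
            destruct (@Inv u Hu (fun _ => True) (@full_subspace _) (@full_closed _) (fun _ _ => I) Y I) as [_ I2].
            apply (I2 (HY u Hu) b Hb). destruct (Hy u Hu) as [Hyu _]. lra. }
          pose proof (Box C1 ltac:(simpl; auto)) as B1. pose proof (Box (- C1)%C ltac:(simpl; auto)) as B2.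
          pose proof (Box (mkC 0 1) ltac:(simpl; auto)) as B3. pose proof (Box (mkC 0 (-1)) ltac:(simpl; auto)) as B4.
          simpl in B1, B2, B3, B4.
          assert (Hc : Cmod (bc b) <= r / 2).
          { eapply Rle_trans; [apply Cmod_le_Re_Im|].
            assert (Rabs (Re (bc b)) <= r / 4) by (apply Rabs_le; lra).
            assert (Rabs (Im (bc b)) <= r / 4) by (apply Rabs_le; lra). lra. }
          pose proof (Cmod_ge0 (bc b)).
          assert ((Cmod (bc b) + 2 * eta) ^ n <= r ^ n) by (apply pow_incr; lra).
          pose proof (blk_ge0 (Hblk b Hb) Y).
          eapply Rle_trans; [exact T3|]. apply Rle_trans with (r ^ n * (M * vnorm Y)); [|right; ring].
          apply Rmult_le_compat; try lra. apply pow_le. lra. }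
    destruct (G bs (fun b H => H)) as [K [HK0 HK]]. exists K. split; [exact HK0|]. intros Y HY n.
    rewrite <- (HbsSum (bpow (ad a) n Y)). apply HK, HY. }
  destruct HK as [K [HK0 HK]].
  exists (map (fun u => upper_sum (y u) (map (rotate_block u) bs)) us), K. split; [exact HK0|]. split; [|split; [|split]].
  - intros F HF Y Z. apply in_map_iff in HF. destruct HF as [u [<- Hu]]. apply upper_sum_sub.
  - intros F HF Y. apply in_map_iff in HF. destruct HF as [u [<- Hu]]. apply finite_rank_upper_sum.
    intros b Hb L. destruct (Hbs b Hb) as [mu [P [nu [Q [Hp [Hq ->]]]]]].
    destruct (Hl mu P Hp) as [_ [_ F1]]. destruct (Hl nu Q Hq) as [_ [_ F2]].
    change (is_finite_rank (bcomp P (bcomp Y Q))).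
    (* If both centres are 0 their difference is 0, which is not beyond a line with y0 > 0; for any
       other pair P or Q has finite rank. *)
    destruct F1 as [->|[_ F1]]; [destruct F2 as [->|[_ F2]]|].
    + exfalso. destruct (Hy u Hu) as [Hyu _]. simpl in L. lra.
    + apply finite_rank_comp_l, finite_rank_comp_l, F2.
    + apply finite_rank_comp_r, F1.
  - intros F HF W HW HC HT Y HY. apply in_map_iff in HF. destruct HF as [u [<- Hu]].
    apply (Inv u Hu W HW HC HT Y HY).
  - intros Y HY n. apply HK. intros u Hu. apply HY. apply in_map_iff. exists u. auto.
Qed.
End AdGrowth.

(** * Operators on the power X^G *)

Section Sums.
Variable I : Type.

Fixpoint vsum (V : CBanach) (l : list I) (h : I -> V) : V :=
  match l with nil => vzero | i :: l => (h i + vsum l h)%V end.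
Fixpoint rsum (l : list I) (h : I -> R) : R :=
  match l with nil => 0 | i :: l => h i + rsum l h end.

Variable V : CBanach.
Implicit Types (h k : I -> V) (l : list I).

Lemma vsum_ext l h k : (forall i, h i = k i) -> vsum l h = vsum l k.
Proof. intro H. induction l as [|i l IH]; simpl; [reflexivity|]. rewrite H, IH. reflexivity. Qed.
Lemma vsum_add l h k : vsum l (fun i => h i + k i)%V = (vsum l h + vsum l k)%V.
Proof. induction l as [|i l IH]; simpl; [vmod|]. rewrite IH. vmod. Qed.
Lemma vsum_scal l c h : vsum l (fun i => c * h i)%V = (c * vsum l h)%V.
Proof. induction l as [|i l IH]; simpl; [vmod|]. rewrite IH. vmod. Qed.
Lemma vsum_zero l : vsum l (fun _ => vzero) = (vzero : V).
Proof. induction l as [|i l IH]; simpl; [reflexivity|]. rewrite IH. vmod. Qed.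
Lemma vsum_sub l h k : vsum l (fun i => h i - k i)%V = (vsum l h - vsum l k)%V.
Proof. induction l as [|i l IH]; simpl; [vmod|]. rewrite IH. vmod. Qed.
Lemma vsum_const l (x : V) : vsum l (fun _ => x) = (RtoC (INR (length l)) * x)%V.
Proof.
  induction l as [|i l IH]; [simpl; vmod_goals; apply C_eq; simpl; ring|].
  change (length (i :: l)) with (S (length l)). rewrite S_INR. simpl. rewrite IH.
  vmod_goals; apply C_eq; simpl; ring.
Qed.
Lemma vsum_bop l (T : bop V) h : T (vsum l h) = vsum l (fun i => T (h i)).
Proof. induction l as [|i l IH]; simpl; [apply bop_zero|]. rewrite bop_add, IH. reflexivity. Qed.
Lemma vsum_perm l l' h : Permutation l l' -> vsum l h = vsum l' h.
Proof. induction 1; simpl; try congruence. vmod. Qed.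

Lemma vsum_single l i0 (h : I -> V) : NoDup l -> In i0 l ->
  (forall i, i <> i0 -> h i = vzero) -> vsum l h = h i0.
Proof.
  intros Hnd Hin Hz.
  assert (Z : forall l, ~ In i0 l -> vsum l h = vzero).
  { clear - Hz. induction l as [|i l IH]; intro H; simpl; [reflexivity|].
    rewrite IH by (intro; apply H; right; assumption). rewrite Hz by (intro; subst; apply H; left; reflexivity). vmod. }
  induction Hnd as [|i l Hni Hnd IH]; [destruct Hin|]. simpl. destruct Hin as [->|Hin].
  - rewrite Z by exact Hni. vmod.
  - rewrite IH by exact Hin. rewrite Hz by (intros ->; contradiction). vmod.
Qed.

Lemma rsum_le l (f g : I -> R) : (forall i, f i <= g i) -> rsum l f <= rsum l g.
Proof. intro H. induction l as [|i l IH]; simpl; [lra|]. specialize (H i). lra. Qed.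
Lemma rsum_ge0 l (f : I -> R) : (forall i, 0 <= f i) -> 0 <= rsum l f.
Proof. intro H. induction l as [|i l IH]; simpl; [lra|]. specialize (H i). lra. Qed.
Lemma rsum_in l (f : I -> R) i : (forall i, 0 <= f i) -> In i l -> f i <= rsum l f.
Proof.
  intros H. induction l as [|j l IH]; intros []; simpl.
  - subst. pose proof (rsum_ge0 l H). lra.
  - specialize (IH H0). specialize (H j). lra.
Qed.
Lemma rsum_scal l c (f : I -> R) : rsum l (fun i => c * f i) = c * rsum l f.
Proof. induction l as [|i l IH]; simpl; [ring|]. rewrite IH. ring. Qed.
Lemma rsum_add l (f g : I -> R) : rsum l (fun i => f i + g i) = rsum l f + rsum l g.
Proof. induction l as [|i l IH]; simpl; [ring|]. rewrite IH. ring. Qed.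
Lemma rsum_const l c : rsum l (fun _ => c) = INR (length l) * c.
Proof.
  induction l as [|i l IH]; [simpl; ring|]. change (length (i :: l)) with (S (length l)). rewrite S_INR. simpl. rewrite IH. ring.
Qed.
Lemma vsum_norm l h : vnorm (vsum l h) <= rsum l (fun i => vnorm (h i)).
Proof.
  induction l as [|i l IH]; simpl; [rewrite vnorm_0; lra|].
  pose proof (vnorm_triangle (h i) (vsum l h)). lra.
Qed.
End Sums.

Lemma vsum_exchange (I J : Type) (V : CBanach) (l : list I) (m : list J) (h : I -> J -> V) :
  vsum l (fun i => vsum m (fun j => h i j)) = vsum m (fun j => vsum l (fun i => h i j)).
Proof.
  induction l as [|i l IH]; simpl; [symmetry; apply vsum_zero|]. rewrite IH, <- vsum_add. reflexivity.
Qed.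

Lemma vsum_map (I J : Type) (V : CBanach) (s : I -> J) (l : list I) (h : J -> V) :
  vsum (map s l) h = vsum l (fun i => h (s i)).
Proof. induction l as [|i l IH]; simpl; [reflexivity|]. rewrite IH. reflexivity. Qed.

Section Power.
Variable G : FinAbGroup.
Variable X : CBanach.

Let gen : list G := @genum G.

Lemma genum_reindex (V : CBanach) (s t : G -> G) (h : G -> V) : (forall g, s (t g) = g) -> (forall g, t (s g) = g) ->
  vsum gen (fun g => h (s g)) = vsum gen h.
Proof.
  intros Hst Hts. rewrite <- vsum_map. apply vsum_perm. apply NoDup_Permutation.
  - apply FinFun.Injective_map_NoDup; [|apply genum_nodup].
    intros x y E. rewrite <- (Hts x), <- (Hts y), E. reflexivity.
  - apply genum_nodup.
  - intro g. split; intros _; [apply genum_full|]. apply in_map_iff. exists (t g). split; [apply Hst|apply genum_full].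
Qed.

(** With the l^1 norm a point mass is no larger than its value, and a constant function has norm |G|
    |x|, a factor that cancels in [constop_norm]. *)
Definition GX : CBanach.
Proof.
  refine {| car := G -> X; vadd := fun f h g => (f g + h g)%V; vzero := fun _ => vzero;
            vopp := fun f g => (- f g)%V; vscal := fun c f g => (c * f g)%V;
            vnorm := fun f => rsum gen (fun g => vnorm (f g)) |};
    try solve [intros; apply functional_extensionality; intro; vmod].
  - intros f Hf. apply functional_extensionality. intro g. apply vnorm_eq0.
    apply Rle_antisym; [|apply vnorm_ge0]. rewrite <- Hf.
    apply (@rsum_in G gen (fun g => vnorm (f g))); [intro; apply vnorm_ge0|apply genum_full].
  - intros c f. rewrite <- rsum_scal. f_equal. apply functional_extensionality. intro g. apply vnorm_scal.
  - intros f h. rewrite <- rsum_add. apply rsum_le. intro g. apply vnorm_triangle.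
  - intros u Hu.
    assert (Hg : forall g, exists l, vlim (fun n => u n g) l).
    { intro g. apply vcomplete. intros eps He. destruct (Hu eps He) as [N HN]. exists N. intros m n Hm Hn.
      eapply Rle_lt_trans; [|apply (HN m n Hm Hn)].
      apply (@rsum_in G gen (fun g => vnorm (u m g - u n g)%V)); [intro; apply vnorm_ge0|apply genum_full]. }
    destruct (functional_choice Hg) as [l Hl]. exists l.
    assert (K : forall m eps, 0 < eps -> exists N, forall n, (N <= n)%nat -> rsum m (fun g => vnorm (u n g - l g)%V) < eps).
    { induction m as [|g m IH]; intros eps He.
      - exists O. intros. simpl. exact He.
      - destruct (IH (eps / 2)) as [N HN]; [lra|]. destruct (Hl g (eps / 2)) as [N' HN']; [lra|].
        exists (max N N'). intros n Hn. specialize (HN n ltac:(lia)). specialize (HN' n ltac:(lia)). simpl. lra. }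
    apply K.
Defined.

Lemma GX_add (f h : GX) (g : G) : (@vadd GX f h : G -> X) g = (f g + h g)%V. Proof. reflexivity. Qed.
Lemma GX_coord (f : GX) (g : G) : vnorm ((f : G -> X) g) <= vnorm f.
Proof. apply (@rsum_in G gen (fun g => vnorm ((f : G -> X) g))); [intro; apply vnorm_ge0|apply genum_full]. Qed.
Lemma GX_vsum (I : Type) (l : list I) (h : I -> GX) (g : G) : (vsum l h : G -> X) g = vsum l (fun i => (h i : G -> X) g).
Proof. induction l as [|i l IH]; [reflexivity|]. simpl. rewrite <- IH. reflexivity. Qed.
Lemma BX_vsum (V : CBanach) (I : Type) (l : list I) (h : I -> BX V) (x : V) :
  @bfun V (vsum l h) x = vsum l (fun i => @bfun V (h i) x).
Proof. induction l as [|i l IH]; [reflexivity|]. simpl vsum. rewrite <- IH. reflexivity. Qed.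

Definition point (d : G) (x : X) : GX := fun g => if excluded_middle_informative (g = d) then x else vzero.

Lemma point_same d x : (point d x : G -> X) d = x.
Proof. unfold point. destruct excluded_middle_informative; [reflexivity|contradiction]. Qed.
Lemma point_other d x g : g <> d -> (point d x : G -> X) g = vzero.
Proof. intro H. unfold point. destruct excluded_middle_informative; [contradiction|reflexivity]. Qed.

Lemma point_add d x y : point d (x + y)%V = (point d x + point d y)%V.
Proof. apply functional_extensionality. intro g. rewrite GX_add. unfold point. destruct excluded_middle_informative; [reflexivity|vmod]. Qed.
Lemma point_scal d c x : point d (c * x)%V = (c * point d x)%V.
Proof.
  apply functional_extensionality. intro g. change (point d (c * x)%V g = (c * (point d x : G -> X) g)%V).
  unfold point. destruct excluded_middle_informative; [reflexivity|vmod].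
Qed.
Lemma rsum_point (l : list G) d x : NoDup l -> rsum l (fun g => vnorm ((point d x : G -> X) g)) <= vnorm x.
Proof.
  induction 1 as [|g l Hni Hnd IH]; simpl; [apply vnorm_ge0|].
  destruct (classic (g = d)) as [->|Hg].
  - rewrite point_same. assert (rsum l (fun g => vnorm ((point d x : G -> X) g)) <= 0); [|lra].
    clear - Hni. induction l as [|g l IH]; simpl; [lra|].
    rewrite point_other by (intros ->; apply Hni; left; reflexivity). rewrite vnorm_0.
    specialize (IH (fun H => Hni (or_intror H))). lra.
  - rewrite point_other by exact Hg. rewrite vnorm_0. lra.
Qed.
Lemma point_norm d x : vnorm (point d x) <= vnorm x.
Proof. apply rsum_point, genum_nodup. Qed.

Lemma point_decompose (f : GX) : f = vsum gen (fun g => point g ((f : G -> X) g)).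
Proof.
  apply functional_extensionality. intro g. rewrite GX_vsum.
  rewrite (@vsum_single _ _ _ g); [rewrite point_same; reflexivity|apply genum_nodup|apply genum_full|].
  intros h Hh. apply point_other. auto.
Qed.

Lemma elem_bop d e (a : bop X) : @is_bop GX (fun f => point d (a ((f : G -> X) e))).
Proof.
  split; [split|].
  - intros f h. rewrite GX_add, bop_add. apply point_add.
  - intros c f. change (@vscal GX c f e) with (c * (f : G -> X) e)%V. rewrite bop_scal. apply point_scal.
  - exists (opnorm a). intro f. eapply Rle_trans; [apply point_norm|]. eapply Rle_trans; [apply bop_norm|].
    apply Rmult_le_compat_l; [apply opnorm_ge0|apply GX_coord].
Qed.
Definition elem d e (a : bop X) : bop GX := mkBop (elem_bop d e a).

Lemma elem_compact d e (a : bop X) : is_compact a -> is_compact (elem d e a).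
Proof.
  intros [_ Ha]. split; [apply bfun_bop|]. intros u [M HM].
  destruct (Ha (fun n => (u n : G -> X) e)) as [phi [Hphi [l Hl]]].
  { exists M. intro n. eapply Rle_trans; [apply GX_coord|apply HM]. }
  exists phi. split; [exact Hphi|]. exists (point d l). intros eps He. destruct (Hl eps He) as [N HN]. exists N. intros n Hn.
  specialize (HN n Hn). eapply Rle_lt_trans; [|exact HN].
  change (elem d e a (u (phi n))) with (point d (a ((u (phi n) : G -> X) e))).
  rewrite (vopp_scal (point d l)), <- point_scal, <- point_add, <- vopp_scal. apply point_norm.
Qed.

(** Written as a finite sum of single-entry operators so that compactness passes from the entries to
    the matrix. *)
Definition matop (M : G -> G -> bop X) : bop GX := vsum (V := BX GX) gen (fun d => vsum (V := BX GX) gen (fun e => elem d e (M d e))).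

Lemma matop_app M (f : GX) d : (matop M f : G -> X) d = vsum gen (fun e => M d e ((f : G -> X) e)).
Proof.
  unfold matop. rewrite BX_vsum, GX_vsum.
  rewrite (@vsum_single _ _ _ d); [|apply genum_nodup|apply genum_full|].
  - rewrite BX_vsum, GX_vsum. apply vsum_ext. intro e. apply point_same.
  - intros d' Hd. rewrite BX_vsum, GX_vsum. rewrite <- (vsum_zero X gen). apply vsum_ext. intro e. apply point_other. auto.
Qed.

Lemma compact_vsum (V : CBanach) (I : Type) (l : list I) (h : I -> BX V) :
  (forall i, is_compact (@bfun V (h i))) -> is_compact (@bfun V (vsum l h)).
Proof. intro H. induction l as [|i l IH]; [apply compact_zero|]. simpl vsum. apply compact_add; [apply H|apply IH]. Qed.

Lemma matop_compact (M : G -> G -> bop X) : (forall d e, is_compact (M d e)) -> is_compact (matop M).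
Proof. intro H. apply compact_vsum. intro d. apply compact_vsum. intro e. apply elem_compact, H. Qed.

Lemma entry_bop (Y : bop GX) d e : is_bop (fun x => (Y (point e x) : G -> X) d).
Proof.
  split; [split|].
  - intros x y. rewrite point_add, bop_add. reflexivity.
  - intros c x. rewrite point_scal, bop_scal. reflexivity.
  - exists (opnorm Y). intro x. eapply Rle_trans; [apply GX_coord|]. eapply Rle_trans; [apply bop_norm|].
    apply Rmult_le_compat_l; [apply opnorm_ge0|apply point_norm].
Qed.
Definition entry (Y : bop GX) d e : bop X := mkBop (entry_bop Y d e).

Lemma entry_norm Y d e : opnorm (entry Y d e) <= opnorm Y.
Proof.
  apply opnorm_le; [apply opnorm_ge0|]. intro x. eapply Rle_trans; [apply GX_coord|]. eapply Rle_trans; [apply bop_norm|].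
  apply Rmult_le_compat_l; [apply opnorm_ge0|apply point_norm].
Qed.

Lemma entry_matop M d e : entry (matop M) d e = M d e.
Proof.
  apply bop_eq. intro x. change ((matop M (point e x) : G -> X) d = M d e x). rewrite matop_app.
  rewrite (@vsum_single _ _ _ e); [rewrite point_same; reflexivity|apply genum_nodup|apply genum_full|].
  intros i Hi. rewrite point_other by exact Hi. apply bop_zero.
Qed.

Lemma bop_entries_zero (Y : bop GX) : (forall d e, entry Y d e = bzero) -> Y = bzero.
Proof.
  intro H. apply bop_eq. intro f. rewrite (point_decompose f), vsum_bop.
  apply functional_extensionality. intro d. rewrite GX_vsum.
  transitivity (vsum gen (fun _ : G => (vzero : X))); [|apply vsum_zero].
  apply vsum_ext. intro e. change (entry Y d e ((f : G -> X) e) = vzero). rewrite H. reflexivity.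
Qed.

Lemma entry_finite_rank (Y : bop GX) d e : is_finite_rank Y -> is_finite_rank (entry Y d e).
Proof.
  intros [vs Hv]. exists (map (fun f : GX => (f : G -> X) d) vs). intro x. destruct (Hv (point e x)) as [cs [Hl E]].
  exists cs. split; [rewrite length_map; exact Hl|].
  change ((Y (point e x) : G -> X) d = lincomb cs (map (fun f : GX => (f : G -> X) d) vs)). rewrite E.
  clear. revert vs. induction cs as [|c cs IH]; intros [|v vs]; try reflexivity.
  simpl. rewrite <- IH. reflexivity.
Qed.
End Power.

(** * The graded algebra *)

Arguments gadd_assoc {f} x y z.
Arguments gadd_comm {f} x y.
Arguments gadd_0 {f} x.
Arguments gadd_opp {f} x.
Arguments genum_full {f} g.
Arguments gopp {f} x.

Section Group.
Variable G : FinAbGroup.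
Definition gsub (x y : G) : G := gadd x (gopp y).

Lemma gadd_sub (x y : G) : gadd y (gsub x y) = x.
Proof. unfold gsub. rewrite (gadd_comm x), gadd_assoc, gadd_opp, gadd_comm. apply gadd_0. Qed.
Lemma gsub_add (x y : G) : gsub (gadd x y) y = x.
Proof. unfold gsub. rewrite <- gadd_assoc, gadd_opp. apply gadd_0. Qed.
Lemma gsub_unique (x y z : G) : gadd y z = x -> z = gsub x y.
Proof. intros <-. rewrite gadd_comm. symmetry. apply gsub_add. Qed.
Lemma gsub_0 (x : G) : gsub x (@g0 G) = x.
Proof. symmetry. apply gsub_unique. rewrite gadd_comm. apply gadd_0. Qed.
Lemma gsub_gsub (x y : G) : gsub x (gsub x y) = y.
Proof. symmetry. apply gsub_unique. rewrite gadd_comm. apply gadd_sub. Qed.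
Lemma gsub_shift (x y s : G) : gsub (gadd x s) (gadd y s) = gsub x y.
Proof.
  symmetry. apply gsub_unique. rewrite (gadd_comm y), <- gadd_assoc, gadd_sub. apply gadd_comm.
Qed.
End Group.

(** * Norm closures of operator spaces *)

Section Closure.
Variable X : CBanach.

Lemma opsub_bop (T U : Op X) : is_bop T -> is_bop U -> is_bop (opsub T U).
Proof.
  intros HT HU. replace (opsub T U) with (bfun (bsub (mkBop HT) (mkBop HU))); [apply bfun_bop|].
  apply functional_extensionality. intro x. rewrite bsub_app. reflexivity.
Qed.

Lemma closure_incl (S : Op X -> Prop) T : is_bop T -> S T -> in_closure S T.
Proof.
  intros HT H. split; [exact HT|]. intros eps He. exists T. split; [exact H|].
  apply Rle_lt_trans with 0; [|exact He]. apply opnorm_le; [lra|]. intro x. unfold opsub. rewrite vadd_opp, vnorm_0. lra.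
Qed.

Variable S : Op X -> Prop.
Hypothesis HS : is_subspace S.
Hypothesis HSb : forall U, S U -> is_bop U.

Lemma closure_approx T : in_closure S T -> forall eps, 0 < eps ->
  exists U, S U /\ is_bop U /\ forall x, vnorm (T x - U x)%V <= eps * vnorm x.
Proof.
  intros [HT H] eps He. destruct (H eps He) as [U [HU Hn]]. exists U. split; [exact HU|]. split; [apply HSb, HU|].
  intro x. eapply Rle_trans; [apply (opnorm_ub x (opsub_bop HT (HSb HU)))|].
  apply Rmult_le_compat_r; [apply vnorm_ge0|lra].
Qed.

Lemma closure_intro T : is_bop T ->
  (forall eps, 0 < eps -> exists U, S U /\ forall x, vnorm (T x - U x)%V <= eps * vnorm x) -> in_closure S T.
Proof.
  intros HT H. split; [exact HT|]. intros eps He. destruct (H (eps / 2)) as [U [HU Hn]]; [lra|].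
  exists U. split; [exact HU|]. apply Rle_lt_trans with (eps / 2); [|lra]. apply opnorm_le; [lra|exact Hn].
Qed.

Lemma closure_zero : in_closure S opzero.
Proof. apply closure_incl; [apply bzero_bop|apply HS]. Qed.

Lemma closure_add T T' : in_closure S T -> in_closure S T' -> in_closure S (opadd T T').
Proof.
  intros H H'. apply closure_intro; [exact (badd_bop (mkBop (proj1 H)) (mkBop (proj1 H')))|].
  intros eps He. destruct (closure_approx H (eps := eps / 2)) as [U [HU [_ Hn]]]; [lra|].
  destruct (closure_approx H' (eps := eps / 2)) as [U' [HU' [_ Hn']]]; [lra|].
  exists (opadd U U'). split; [apply HS; assumption|]. intro x. unfold opadd.
  replace (T x + T' x - (U x + U' x))%V with ((T x - U x) + (T' x - U' x))%V by vmod.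
  pose proof (vnorm_triangle (T x - U x)%V (T' x - U' x)%V). specialize (Hn x). specialize (Hn' x). lra.
Qed.

Lemma closure_scal c T : in_closure S T -> in_closure S (opscal c T).
Proof.
  intro H. apply closure_intro; [exact (bscal_bop c (mkBop (proj1 H)))|].
  intros eps He. pose proof (Cmod_ge0 c).
  destruct (closure_approx H (eps := eps / (Cmod c + 1))) as [U [HU [_ Hn]]]; [apply Rdiv_lt_0_compat; lra|].
  exists (opscal c U). split; [apply HS; assumption|]. intro x. unfold opscal.
  replace (c * T x - c * U x)%V with (c * (T x - U x))%V by vmod. rewrite vnorm_scal. specialize (Hn x).
  pose proof (vnorm_ge0 (T x - U x)%V).
  apply Rle_trans with ((Cmod c + 1) * (eps / (Cmod c + 1) * vnorm x)); [|right; field; lra].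
  apply Rmult_le_compat; lra.
Qed.

Lemma closure_closure T : is_bop T ->
  (forall eps, 0 < eps -> exists U, in_closure S U /\ forall x, vnorm (T x - U x)%V <= eps * vnorm x) -> in_closure S T.
Proof.
  intros HT H. apply closure_intro; [exact HT|]. intros eps He.
  destruct (H (eps / 2)) as [U [HU Hn]]; [lra|].
  destruct (closure_approx HU (eps := eps / 2)) as [U' [HU' [_ Hn']]]; [lra|].
  exists U'. split; [exact HU'|]. intro x. pose proof (vnorm_sub_triangle (U x) (T x) (U' x)).
  specialize (Hn x). specialize (Hn' x). lra.
Qed.

(** The bracket with a fixed A is continuous, so the grading relation survives when one argument
    passes to the closure; the other stays in the algebra. *)
Lemma closure_comm (S' : Op X -> Prop) (A : Op X) T : is_bop A -> (forall U, S U -> S' (comm A U)) ->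
  in_closure S T -> in_closure S' (comm A T).
Proof.
  intros HA HSS H.
  assert (HC : is_bop (comm A T)).
  { exact (opsub_bop (bcomp_bop (mkBop HA) (mkBop (proj1 H))) (bcomp_bop (mkBop (proj1 H)) (mkBop HA))). }
  split; [exact HC|]. intros eps He. pose proof (opnorm_ge0 A) as H0.
  destruct (closure_approx H (eps := eps / (4 * (opnorm A + 1)))) as [U [HU [HUb Hn]]]; [apply Rdiv_lt_0_compat; lra|].
  exists (comm A U). split; [apply HSS, HU|]. apply Rle_lt_trans with (eps / 2); [|lra].
  apply opnorm_le; [lra|]. intro x. unfold opsub, comm.
  replace (A (T x) - T (A x) - (A (U x) - U (A x)))%V with (A (T x - U x) - (T (A x) - U (A x)))%V.
  - pose proof (vnorm_sub_le (A (T x - U x)) (T (A x) - U (A x)))%V as T1.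
    pose proof (opnorm_ub (T x - U x)%V HA) as T2. pose proof (opnorm_ub x HA) as T3.
    pose proof (Hn x) as T4. pose proof (Hn (A x)) as T5. pose proof (vnorm_ge0 x).
    set (d := eps / (4 * (opnorm A + 1))) in *.
    assert (Hd : 0 < d) by (apply Rdiv_lt_0_compat; lra).
    assert (opnorm A * d <= eps / 4).
    { apply Rle_trans with ((opnorm A + 1) * d); [nra|right; unfold d; field; lra]. }
    assert (T6 : opnorm A * vnorm (T x - U x)%V <= opnorm A * (d * vnorm x)) by (apply Rmult_le_compat_l; lra).
    assert (T7 : d * vnorm (A x) <= d * (opnorm A * vnorm x)) by (apply Rmult_le_compat_l; lra).
    assert (T8 : opnorm A * d * vnorm x <= eps / 4 * vnorm x) by (apply Rmult_le_compat_r; lra).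
    lra.
  - change (A (T x - U x)%V) with (@bfun X (mkBop HA) (T x - U x)%V). rewrite bop_add, bop_opp. simpl. vmod.
Qed.
End Closure.

(** * Convolution operators and the transfer back to X *)

Section Main.
Variable X : CBanach.
Variable G : FinAbGroup.
Variable Lg : G -> Op X -> Prop.
Hypothesis Hsub : forall g, is_subspace (Lg g).
Hypothesis Hbop : forall g T, Lg g T -> is_bop T.
Hypothesis Hcpt : forall g T, Lg g T -> is_compact T.
Hypothesis Hgr : forall g h S T, Lg g S -> Lg h T -> Lg (gadd g h) (comm S T).
Hypothesis Hfin : forall g F, in_closure (Lg g) F -> is_finite_rank F -> F = opzero.

Local Notation gen := (@genum G).
Local Notation E := (GX G X).

(** Convolution with f. Its entries keep the components f g apart, while [total f] only remembers
    their sum; a family f with a given total need not be unique. *)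
Definition convop (f : G -> bop X) : bop E := matop (fun d e => f (gsub d e)).
Definition total (f : G -> bop X) : bop X := vsum (V := BX X) gen f.
Definition card_inv : C := RtoC (/ INR (length gen)).
Definition avg (phi : G -> X) : X := (card_inv * vsum gen phi)%V.
(** Averages over G, applies x and returns a constant function: an isometric copy of the operators
    on X inside those on X^G. *)
Definition constop (x : bop X) : bop E := matop (fun _ _ => bscal card_inv x).

Lemma card_pos : 0 < INR (length gen).
Proof.
  apply lt_0_INR. pose proof (genum_full (@g0 G)) as H. destruct gen; [destruct H|simpl; lia].
Qed.

Lemma total_app f x : total f x = vsum gen (fun g => f g x).
Proof. apply BX_vsum. Qed.

Lemma convop_app f (phi : E) d : (convop f phi : G -> X) d = vsum gen (fun e => f (gsub d e) ((phi : G -> X) e)).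
Proof. apply matop_app. Qed.

Lemma constop_app x (phi : E) d : (constop x phi : G -> X) d = x (avg phi).
Proof.
  unfold constop. rewrite matop_app. unfold avg. rewrite bop_scal, vsum_bop, <- vsum_scal. reflexivity.
Qed.

Lemma avg_const (x : X) : avg (fun _ => x) = x.
Proof.
  unfold avg. rewrite vsum_const. pose proof card_pos. unfold card_inv.
  vmod_goals; apply C_eq; simpl; field; lra.
Qed.

Lemma sum_gsub_l (V : CBanach) (h : G -> V) d : vsum gen (fun e => h (gsub d e)) = vsum gen h.
Proof. apply (@genum_reindex G V (fun e => gsub d e) (fun e => gsub d e)); intro; apply gsub_gsub. Qed.
Lemma sum_gsub_r (V : CBanach) (h : G -> V) e : vsum gen (fun d => h (gsub d e)) = vsum gen h.
Proof.
  apply (@genum_reindex G V (fun d => gsub d e) (fun d => gadd d e)); intro g; [apply gsub_add|].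
  rewrite gadd_comm. apply gadd_sub.
Qed.
Lemma sum_gadd (V : CBanach) (h : G -> V) s : vsum gen (fun d => h (gadd d s)) = vsum gen h.
Proof.
  apply (@genum_reindex G V (fun d => gadd d s) (fun d => gsub d s)); intro g; [|apply gsub_add].
  rewrite gadd_comm. apply gadd_sub.
Qed.

Lemma convop_const f x d : (convop f (fun _ => x) : G -> X) d = total f x.
Proof. rewrite convop_app, total_app. apply (sum_gsub_l (fun g => f g x)). Qed.

Lemma avg_convop f (phi : E) : avg (convop f phi) = total f (avg phi).
Proof.
  unfold avg. rewrite bop_scal, vsum_bop. f_equal.
  rewrite (vsum_ext gen (k := fun d => vsum gen (fun e => f (gsub d e) ((phi : G -> X) e)))) by (intro; apply convop_app).
  rewrite vsum_exchange. apply vsum_ext. intro e. rewrite total_app.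
  apply (sum_gsub_r (fun g => f g ((phi : G -> X) e))).
Qed.

Lemma E_eq (phi psi : E) : (forall d, (phi : G -> X) d = (psi : G -> X) d) -> phi = psi.
Proof. apply functional_extensionality. Qed.

Lemma constop_eq x (phi : E) : constop x phi = (fun _ => x (avg phi) : X).
Proof. apply E_eq. intro d. apply constop_app. Qed.

Definition sandwich_bop : @is_bop (BX E) (fun Y : bop E => bcomp (constop bid) (bcomp Y (constop bid))).
Proof.
  split; [split|].
  - intros Y Z. apply bop_eq. intro x. autorewrite with lin. reflexivity.
  - intros c Y. apply bop_eq. intro x. autorewrite with lin. reflexivity.
  - exists (opnorm (constop bid) * opnorm (constop bid)). intro Y.
    change (opnorm (bcomp (constop bid) (bcomp Y (constop bid))) <= opnorm (constop bid) * opnorm (constop bid) * opnorm Y).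
    pose proof (opnorm_bcomp (constop bid) (bcomp Y (constop bid))). pose proof (opnorm_bcomp Y (constop bid)).
    pose proof (opnorm_ge0 (constop bid)). nra.
Qed.
(** Compression to the constant functions: [constop bid] is the averaging projection. It commutes
    with every [convop f], so the compression commutes with [ad (convop f)]; it sends [convop h] to
    [constop (total h)]. *)
Definition sandwich : bop (BX E) := mkBop sandwich_bop.
Lemma sandwich_app (Y : bop E) (phi : E) : @bfun E (sandwich Y) phi = constop bid (Y (constop bid phi)).
Proof. reflexivity. Qed.

Lemma sandwich_convop f : sandwich (convop f) = constop (total f).
Proof.
  apply bop_eq. intro phi. rewrite sandwich_app, !constop_eq, !bid_app. apply E_eq. intro d. rewrite avg_convop.
  rewrite avg_const. reflexivity.
Qed.

Lemma sandwich_constop x : sandwich (constop x) = constop x.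
Proof.
  apply bop_eq. intro phi. rewrite sandwich_app, !constop_eq, !bid_app, !avg_const. reflexivity.
Qed.

Lemma ad_sandwich f (Y : bop E) : ad (convop f) (sandwich Y) = sandwich (ad (convop f) Y).
Proof.
  apply bop_eq. intro phi. rewrite ad_app, !sandwich_app, ad_app.
  assert (H : forall psi : E, convop f (constop bid psi) = constop bid (convop f psi)).
  { intro psi. apply E_eq. intro d. rewrite !constop_eq, !bid_app, convop_const, avg_convop. reflexivity. }
  rewrite bop_add, bop_opp, !H. reflexivity.
Qed.

Lemma ad_constop f (x : bop X) : ad (convop f) (constop x) = constop (ad (total f) x).
Proof.
  apply bop_eq. intro phi. rewrite ad_app. apply E_eq. intro d.
  change ((convop f (constop x phi) : G -> X) d - (constop x (convop f phi) : G -> X) d = (constop (ad (total f) x) phi : G -> X) d)%V.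
  rewrite !constop_app, avg_convop, ad_app, constop_eq, convop_const. reflexivity.
Qed.

Lemma ad_pow_constop f (x : bop X) n : bpow (ad (convop f)) n (constop x) = constop (bpow (ad (total f)) n x).
Proof. induction n as [|n IH]; [reflexivity|]. rewrite !bpow_S, IH. apply ad_constop. Qed.

Lemma norm_const (x : X) : vnorm ((fun _ => x) : E) = INR (length gen) * vnorm x.
Proof. change (rsum gen (fun _ : G => vnorm x) = INR (length gen) * vnorm x). apply rsum_const. Qed.

Lemma avg_norm (phi : E) : INR (length gen) * vnorm (avg phi) <= vnorm phi.
Proof.
  pose proof card_pos as Hc. unfold avg. rewrite vnorm_scal. unfold card_inv. rewrite Cmod_RtoC, Rabs_pos_eq
    by (left; apply Rinv_0_lt_compat, Hc).
  rewrite <- Rmult_assoc, Rinv_r, Rmult_1_l by lra. apply vsum_norm.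
Qed.

Lemma constop_norm (x : bop X) : opnorm (constop x) = opnorm x.
Proof.
  pose proof card_pos as Hc. apply Rle_antisym.
  - apply opnorm_le; [apply opnorm_ge0|]. intro phi. rewrite constop_eq, norm_const.
    pose proof (avg_norm phi). pose proof (bop_norm x (avg phi)). pose proof (opnorm_ge0 x).
    apply Rle_trans with (INR (length gen) * (opnorm x * vnorm (avg phi))); [apply Rmult_le_compat_l; lra|].
    apply Rle_trans with (opnorm x * (INR (length gen) * vnorm (avg phi))); [right; ring|]. apply Rmult_le_compat_l; lra.
  - apply opnorm_le; [apply opnorm_ge0|]. intro v.
    pose proof (bop_norm (constop x) ((fun _ => v) : E)) as H.
    rewrite constop_eq, avg_const in H. change (vnorm ((fun _ : G => x v) : E) <= opnorm (constop x) * vnorm ((fun _ : G => v) : E)) in H.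
    rewrite !norm_const in H. apply Rmult_le_reg_l with (INR (length gen)); [exact Hc|]. lra.
Qed.

(* Operators on X^G whose matrix (y_(d - e)) is constant along the diagonals d - e = g, with y_g in the
   closure of L_g; this is the honestly graded version of L *)
Definition graded (Y : BX E) : Prop :=
  (forall d e s, entry Y (gadd d s) (gadd e s) = entry Y d e) /\
  (forall d, in_closure (Lg d) (entry Y d (@g0 G))).

Lemma entry_add (Y Z : BX E) d e : entry (Y + Z)%V d e = badd (entry Y d e) (entry Z d e).
Proof. apply bop_eq. intro x. reflexivity. Qed.
Lemma entry_scal c (Y : BX E) d e : entry (c * Y)%V d e = bscal c (entry Y d e).
Proof. apply bop_eq. intro x. reflexivity. Qed.
Lemma entry_sub (Y Z : BX E) d e : entry (Y - Z)%V d e = bsub (entry Y d e) (entry Z d e).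
Proof. apply bop_eq. intro x. reflexivity. Qed.

Lemma graded_subspace : vsubspace graded.
Proof.
  split.
  - split.
    + intros. apply bop_eq. intro x. reflexivity.
    + intro d. apply (closure_zero (Hsub d)).
  - intros Y Z [HY1 HY2] [HZ1 HZ2]. split.
    + intros d e s. rewrite !entry_add, HY1, HZ1. reflexivity.
    + intro d. rewrite entry_add. apply (closure_add (Hsub d) (@Hbop d) (HY2 d) (HZ2 d)).
  - intros c Y [HY1 HY2]. split.
    + intros d e s. rewrite !entry_scal, HY1. reflexivity.
    + intro d. rewrite entry_scal. apply (closure_scal (Hsub d) (@Hbop d) c (HY2 d)).
Qed.

Lemma graded_closed : vclosed graded.
Proof.
  intros Y H. split.
  - intros d e s. change (entry Y (gadd d s) (gadd e s) = entry Y d e :> BX X). apply vsub_eq0, vnorm_arb_small. intros eps He.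
    destruct (H (eps / 3)) as [Z [[HZ1 _] HZn]]; [lra|].
    pose proof (entry_norm (Y - Z : BX E)%V (gadd d s) (gadd e s)) as N1. pose proof (entry_norm (Y - Z : BX E)%V d e) as N2.
    rewrite entry_sub in N1, N2. rewrite HZ1 in N1.
    change (opnorm (Y - Z : BX E)%V) with (vnorm (Y - Z : BX E)%V) in N1, N2.
    set (u := entry Y (gadd d s) (gadd e s) : BX X) in *. set (v := entry Y d e : BX X) in *. set (w := entry Z d e : BX X) in *.
    change (vnorm (u - w)%V <= vnorm (Y - Z)%V) in N1. change (vnorm (v - w)%V <= vnorm (Y - Z)%V) in N2.
    pose proof (vnorm_sub_triangle w u v) as T. rewrite (vnorm_sub_sym w) in T. lra.
  - intro d. apply (closure_closure (@Hbop d)); [apply bfun_bop|]. intros eps He.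
    destruct (H eps He) as [Z [[_ HZ2] HZn]]. exists (entry Z d (@g0 G)). split; [apply HZ2|]. intro x.
    pose proof (bop_norm (entry (Y - Z : BX E)%V d (@g0 G)) x) as N. rewrite entry_sub, bsub_app in N.
    pose proof (entry_norm (Y - Z : BX E)%V d (@g0 G)) as N1. rewrite entry_sub in N1.
    change (opnorm (Y - Z : BX E)%V) with (vnorm (Y - Z : BX E)%V) in N1.
    eapply Rle_trans; [exact N|]. apply Rmult_le_compat_r; [apply vnorm_ge0|lra].
Qed.

Lemma graded_entry (Y : BX E) d e : graded Y -> entry Y d e = entry Y (gsub d e) (@g0 G).
Proof.
  intros [H1 _]. rewrite <- (H1 (gsub d e) (@g0 G) e), (gadd_comm (@g0 G)), gadd_0, (gadd_comm _ e), gadd_sub.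
  reflexivity.
Qed.

(** Here the hypothesis on the closures enters: each entry of Y has finite rank and, by invariance
    along diagonals, lies in the closure of a single component. *)
Lemma graded_finite_rank (Y : BX E) : graded Y -> is_finite_rank (@bfun E Y) -> Y = vzero.
Proof.
  intros HY HF. apply bop_entries_zero. intros d e. rewrite (graded_entry d e HY).
  pose proof (Hfin (proj2 HY (gsub d e)) (entry_finite_rank (gsub d e) (@g0 G) HF)) as E0.
  apply bop_eq. intro x. rewrite E0. reflexivity.
Qed.

Lemma closure_vsum g (I : Type) (l : list I) (h : I -> BX X) :
  (forall i, in_closure (Lg g) (@bfun X (h i))) -> in_closure (Lg g) (@bfun X (vsum l h)).
Proof.
  intro H. induction l as [|i l IH]; [apply (closure_zero (Hsub g))|].
  simpl vsum. apply (closure_add (Hsub g) (@Hbop g) (H i) IH).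
Qed.

Section Generator.
Variable f : G -> bop X.
Hypothesis Hf : forall g, Lg g (f g).

Lemma entry_convop_l (Y : bop E) d e x :
  entry (bcomp (convop f) Y) d e x = vsum gen (fun s => f (gsub d s) (entry Y s e x)).
Proof. change ((convop f (Y (point e x)) : G -> X) d = vsum gen (fun s => f (gsub d s) (entry Y s e x))). apply convop_app. Qed.

Lemma entry_convop_r (Y : bop E) d e x :
  entry (bcomp Y (convop f)) d e x = vsum gen (fun s => entry Y d s (f (gsub s e) x)).
Proof.
  change ((Y (convop f (point e x)) : G -> X) d = vsum gen (fun s => entry Y d s (f (gsub s e) x))).
  rewrite (point_decompose (convop f (point e x))), vsum_bop, GX_vsum. apply vsum_ext. intro s.
  change (entry Y d s ((convop f (point e x) : G -> X) s) = entry Y d s (f (gsub s e) x)). f_equal.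
  change (entry (matop (fun d e => f (gsub d e))) s e x = f (gsub s e) x). rewrite entry_matop. reflexivity.
Qed.

Lemma entry_ad (Y : BX E) d e x : entry (ad (convop f) Y) d e x =
  (vsum gen (fun s => f (gsub d s) (entry Y s e x)) - vsum gen (fun s => entry Y d s (f (gsub s e) x)))%V.
Proof.
  rewrite <- entry_convop_l, <- entry_convop_r.
  change ((@bfun E (ad (convop f) Y) (point e x) : G -> X) d = ((convop f (@bfun E Y (point e x)) : G -> X) d - (@bfun E Y (convop f (point e x)) : G -> X) d)%V).
  rewrite ad_app. reflexivity.
Qed.

Lemma graded_ad (Y : BX E) : graded Y -> graded (ad (convop f) Y).
Proof.
  intro HY. destruct HY as [H1 H2] eqn:EY. clear EY. split.
  - intros d e t. apply bop_eq. intro x. rewrite !entry_ad. f_equal; [|f_equal].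
    + rewrite <- (sum_gadd (fun s => f (gsub (gadd d t) s) (entry Y s (gadd e t) x)) t). apply vsum_ext. intro s.
      rewrite gsub_shift, H1. reflexivity.
    + rewrite <- (sum_gadd (fun s => entry Y (gadd d t) s (f (gsub s (gadd e t)) x)) t). apply vsum_ext. intro s.
      rewrite gsub_shift, H1. reflexivity.
  - intro d.
    (* Substituting s -> d - s in the first sum pairs it with the second: the (d, 0) entry becomes
       the sum over s of the brackets of f s with Y_(d - s), each in the closure of L_d. *)
    assert (E0 : entry (ad (convop f) Y) d (@g0 G) =
       vsum (V := BX X) gen (fun s => bsub (bcomp (f s) (entry Y (gsub d s) (@g0 G))) (bcomp (entry Y (gsub d s) (@g0 G)) (f s)))).
    { apply bop_eq. intro x. rewrite entry_ad, BX_vsum.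
      rewrite <- (sum_gsub_l (fun s => f (gsub d s) (entry Y s (@g0 G) x)) d), <- vsum_sub. apply vsum_ext. intro s.
      rewrite gsub_gsub, gsub_0, bsub_app, !bcomp_app. f_equal. f_equal.
      rewrite (graded_entry d s HY). reflexivity. }
    rewrite E0. apply closure_vsum. intro s.
    assert (E1 : bfun (bsub (bcomp (f s) (entry Y (gsub d s) (@g0 G))) (bcomp (entry Y (gsub d s) (@g0 G)) (f s)))
       = comm (f s) (entry Y (gsub d s) (@g0 G))).
    { apply functional_extensionality. intro x. rewrite bsub_app. reflexivity. }
    rewrite E1. apply (closure_comm (@Hbop (gsub d s))) with (S' := Lg d); [apply bfun_bop| |apply H2].
    intros U HU. rewrite <- (gadd_sub d s). apply Hgr; [apply Hf|exact HU].
Qed.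

Lemma graded_convop (h : G -> bop X) : (forall g, Lg g (h g)) -> graded (convop h).
Proof.
  intro Hh. split.
  - intros d e s. unfold convop. rewrite !entry_matop, gsub_shift. reflexivity.
  - intro d. unfold convop. rewrite entry_matop, gsub_0. apply closure_incl; [apply bfun_bop|apply Hh].
Qed.

(** Each F is known to preserve closed subspaces invariant under ad, and two such subspaces replace
    commutation with the compression. F kills [convop h], whose image is graded and of finite rank.
    The difference of [convop h] and [constop (total h)] lies in the kernel of [sandwich], and
    [constop (total h)] in the kernel of 1 - [sandwich]; applying F, the image of
    [constop (total h)] lies in both kernels and is 0. K depends on f and r only, not on h or on its
    representation. *)
Lemma ad_total_growth r : 0 < r -> exists K, 0 <= K /\ forall h : G -> bop X, (forall g, Lg g (h g)) ->
  forall n, opnorm (bpow (ad (total f)) n (total h) : bop X) <= K * r ^ n * opnorm (total h).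
Proof.
  intro Hr.
  assert (Hc : is_compact (convop f)) by (apply matop_compact; intros; apply (Hcpt (Hf _))).
  destruct (ad_growth Hc Hr) as [Fs [K [HK0 [Fadd [Ffr [Finv HK]]]]]].
  exists K. split; [exact HK0|]. intros h Hh n.
  rewrite <- (constop_norm (bpow (ad (total f)) n (total h))), <- (constop_norm (total h)), <- ad_pow_constop.
  apply (HK (constop (total h) : BX E)).
  intros F HF.
  assert (F0 : F (convop h : BX E) = vzero).
  { apply graded_finite_rank; [|apply Ffr, HF]. apply (Finv F HF graded graded_subspace graded_closed graded_ad), graded_convop, Hh. }
  assert (Fker : ker sandwich (F ((convop h : BX E) - (constop (total h) : BX E))%V)).
  { apply (Finv F HF (ker sandwich) (ker_subspace sandwich) (@ker_closed _ sandwich)).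
    - intros Y HY. unfold ker in *. rewrite <- ad_sandwich, HY. apply bop_zero.
    - unfold ker. rewrite bop_add, bop_opp. rewrite sandwich_convop, sandwich_constop. apply vadd_opp. }
  set (D := bsub (bid : bop (BX E)) sandwich).
  assert (Ffix : ker D (F (constop (total h) : BX E))).
  { apply (Finv F HF (ker D) (ker_subspace D) (@ker_closed _ D)).
    - intros Y HY. unfold ker, D in *. rewrite bsub_app, bid_app in HY |- *. apply vsub_eq0 in HY.
      rewrite <- ad_sandwich, <- HY. apply vadd_opp.
    - unfold ker, D. rewrite bsub_app, bid_app, sandwich_constop. apply vadd_opp. }
  unfold ker, D in Ffix. rewrite bsub_app, bid_app in Ffix. apply vsub_eq0 in Ffix.
  unfold ker in Fker. rewrite (Fadd F HF), F0, bop_add, bop_opp, bop_zero, <- Ffix in Fker.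
  replace (F (constop (total h) : BX E)) with (- (vzero - F (constop (total h) : BX E)))%V by vmod.
  rewrite Fker. vmod.
Qed.
End Generator.
End Main.

(** Used with ratio eps / 2, the bound leaves a factor 2^(-n) that swallows K, so v n < eps^n
    eventually. *)
Lemma nroot_cv_0 (v : nat -> R) :
  (forall r, 0 < r -> exists K, 0 <= K /\ forall n, v n <= K * r ^ n) -> Un_cv (fun n => nroot n (v n)) 0.
Proof.
  intros H eps He. destruct (H (eps / 2)) as [K [HK0 HK]]; [lra|].
  destruct (@pow_small (/ 2) K 1) as [N HN]; [lra|lra|].
  (* The successor keeps n positive, so that 1/n is a genuine exponent. *)
  exists (S N). intros n Hn. unfold Rdist. rewrite Rminus_0_r.
  unfold nroot. destruct (Rle_dec (v n) 0) as [L|L]; [rewrite Rabs_R0; exact He|].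
  apply Rnot_le_lt in L.
  rewrite Rabs_pos_eq by (left; apply exp_pos).
  assert (Hv : v n < eps ^ n).
  { eapply Rle_lt_trans; [apply HK|]. specialize (HN n ltac:(lia)). unfold Rdiv. rewrite Rpow_mult_distr.
    assert (0 < eps ^ n) by (apply pow_lt, He). nra. }
  assert (Hn0 : 0 < INR n) by (apply lt_0_INR; lia).
  apply Rlt_le_trans with (Rpower (eps ^ n) (/ INR n)).
  - apply Rlt_Rpower_l; [apply Rinv_0_lt_compat, Hn0|lra].
  - right. rewrite <- Rpower_pow by exact He. rewrite Rpower_mult, Rinv_r by lra. apply Rpower_1, He.
Qed.

Lemma opsum_app (X : CBanach) (I : Type) (l : list I) (f : I -> Op X) x :
  opsum (map f l) x = vsum l (fun i => f i x).
Proof. induction l as [|i l IH]; [reflexivity|]. simpl. rewrite <- IH. reflexivity. Qed.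

Lemma iter_comm_ad (X : CBanach) (a x : bop X) n : Nat.iter n (comm a) x = @bfun X (bpow (ad a) n x).
Proof.
  induction n as [|n IH]; [reflexivity|]. simpl Nat.iter. rewrite IH, bpow_S.
  apply functional_extensionality. intro z. rewrite ad_app. reflexivity.
Qed.

Theorem mainTheorem7 (X : CBanach) (G : FinAbGroup)
  (L : Op X -> Prop) (Lg : G -> Op X -> Prop) :
  is_op_Lie_algebra L ->
  (forall T, L T -> is_compact T) ->
  is_subgraded G L Lg ->
  (forall (g : G) (F : Op X),
      in_closure (Lg g) F -> is_finite_rank F -> F = opzero) ->
  is_Engel L.
Proof.
  intros [HLb _] HLc [Hsub [HLd Hgr]] Hfin a Ha.
  assert (HgL : forall g T, Lg g T -> L T).
  { intros g T HT. apply HLd. exists (fun h => if excluded_middle_informative (h = g) then T else opzero). split.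
    - intro h. destruct excluded_middle_informative as [->|]; [exact HT|apply Hsub].
    - apply functional_extensionality. intro x. rewrite opsum_app.
      rewrite (@vsum_single _ _ _ g); [|apply genum_nodup|apply genum_full|].
      + destruct excluded_middle_informative; [reflexivity|contradiction].
      + intros i Hi. destruct excluded_middle_informative; [contradiction|reflexivity]. }
  assert (Hbop : forall g T, Lg g T -> is_bop T) by (intros g T HT; apply HLb, (HgL g), HT).
  assert (Hcpt : forall g T, Lg g T -> is_compact T) by (intros g T HT; apply HLc, (HgL g), HT).
  assert (Hdec : forall T, L T -> exists f : G -> bop X, (forall g, Lg g (f g)) /\ T = bfun (total f)).
  { intros T HT. apply HLd in HT. destruct HT as [f [Hf ->]].
    exists (fun g => mkBop (Hbop g (f g) (Hf g))). split; [exact Hf|].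
    apply functional_extensionality. intro x. rewrite opsum_app, total_app. reflexivity. }
  destruct (Hdec a Ha) as [f [Hf ->]].
  apply nroot_cv_0. intros r Hr.
  destruct (ad_total_growth Hsub Hbop Hcpt Hgr Hfin Hf Hr) as [K [HK0 HK]].
  exists K. split; [exact HK0|]. intro n. pose proof (pow_le r n ltac:(lra)) as Hrn.
  (* K is fixed before T, so one bound covers the whole unit ball of L; any decomposition h of T may
     be chosen. *)
  apply Rsup_le; [nra|]. intros v [T [HT [HT1 ->]]].
  destruct (Hdec T HT) as [h [Hh ->]]. rewrite iter_comm_ad.
  eapply Rle_trans; [apply (HK h Hh n)|].
  rewrite <- (Rmult_1_r (K * r ^ n)) at 2. apply Rmult_le_compat_l; [nra|exact HT1].
Qed.
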